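(* Let $n$ be a positive integer and define the polynomials $$\theta_1(x)=\sum_{j=0}^{\lfloor n/2\rfloor}\binom{n}{2j}x^j,\qquad \theta_2(x)=\sum_{j=0}^{\lfloor (n-1)/2\rfloor}\binom{n}{2j+1}x^j .$$ Let $a$ be a complex parameter. Then the rational function $\varphi(x)=x\,\theta_2(x)^2/\theta_1(x)^2$ realizes the degree $n$ pull-back transformation $E\left(\frac12,\frac12,a\right)\stackrel{n}{\longleftarrow}E\left(\frac12,\frac12,na\right)$ (with local exponent difference $\frac12$ at $z=0,\infty$ and at $x=0,\infty$, difference $a$ at $z=1$ and difference $na$ at $x=1$), and the following identities hold: $$(1-x)^n=\theta_1(x^2)-x\,\theta_2(x^2),$$ $$(1-x)^n=\theta_1(x)^2-x\,\theta_2(x)^2,$$ $${}_2F_1\!\left(\left.{\frac{na}2,\frac{na+1}2\atop\frac12}\right|x\right)=\theta_1(x)^{-a}\,{}_2F_1\!\left(\left.{\frac a2,\frac{a+1}2\atop\frac12}\right|\frac{x\,\theta_2(x)^2}{\theta_1(x)^2}\right),$$ $${}_2F_1\!\left(\left.{\frac{na+1}2,\frac{na}2+1\atop\frac32}\right|x\right)=\theta_1(x)^{-a-1}\,\frac{\theta_2(x)}{n}\,{}_2F_1\!\left(\left.{\frac{a+1}2,\frac a2+1\atop\frac32}\right|\frac{x\,\theta_2(x)^2}{\theta_1(x)^2}\right),$$ $${}_2F_1\!\left(\left.{\frac{na}2,-\frac{na}2\atop\frac12}\right|\frac{x}{x-1}\right)={}_2F_1\!\left(\left.{\frac a2,-\frac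 a2\atop\frac12}\right|-\frac{x\,\theta_2(x)^2}{(1-x)^n}\right),$$ $${}_2F_1\!\left(\left.{\frac{na}2,\frac{na+1}2\atop na+1}\right|1-x\right)=\left(\frac{\theta_1(x)}{2^{n-1}}\right)^{-a}{}_2F_1\!\left(\left.{\frac a2,\frac{a+1}2\atop a+1}\right|\frac{(1-x)^n}{\theta_1(x)^2}\right).$$ The first two are polynomial identities. The next three ${}_2F_1$ identities hold in a neighbourhood of $x=0$, and the last one holds in a neighbourhood of $x=1$, for those $a$ for which the ${}_2F_1$ series appearing in it are defined.
   Context: ${}_2F_1\!\left(\left.{A,B\atop C}\right|z\right)=\sum_{j\ge0}\frac{(A)_j(B)_j}{(C)_j\,j!}z^j$ is the Gauss hypergeometric series, $(x)_j=x(x+1)\cdots(x+j-1)$. The hypergeometric equation is $$z(1-z)y''+(C-(A+B+1)z)y'-AB\,y=0,$$ with local exponent differences (up to sign) $1-C$ at $z=0$, $C-A-B$ at $z=1$, $A-B$ at $z=\infty$. $E(d_1,d_2,d_3)$ denotes a hypergeometric equation whose local exponent differences at its three singular points are $d_1,d_2,d_3$ up to sign (in some order). A pull-back transformation $E_0\stackrel{d}{\longleftarrow}E_1$ of degree $d$ from an equation $E_0$ in the variable $z$ to an equation $E_1$ in the variable $x$ is a substitution $z\mapsto\varphi(x)$, $y(z)\mapsto Y(x)=\theta(x)\,y(\varphi(x))$, where $\varphi$ is a rational function of degree $d$ and $\theta$ is a product of powers of rational functions, which transforms the solutions of $E_0$ into solutions of $E_1$. Powers $\theta_1(x)^{-a}$,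 $\theta_1(x)^{-a-1}$ near $x=0$ are the branches equal to $1$ at $x=0$ (note $\theta_1(0)=1$), and $(\theta_1(x)/2^{n-1})^{-a}$ near $x=1$ is the branch equal to $1$ at $x=1$ (note $\theta_1(1)=2^{n-1}$). *)

(* Defs.v *)
From Stdlib Require Export Reals List Factorial.
From Coquelicot Require Export Coquelicot.
Import ListNotations.

Open Scope C_scope.

Definition NtoC (n : nat) : C := RtoC (INR n).

Definition Cexp (z : C) : C :=
  (exp (Re z) * cos (Im z), exp (Re z) * sin (Im z))%R.

Definition disk (x0 : C) (r : R) (x : C) : Prop := (Cmod (x - x0) < r)%R.

Definition C_open (U : C -> Prop) : Prop := @open C_UniformSpace U.

Definition C_continuous (f : C -> C) (x : C) : Prop :=
  @continuous C_UniformSpace C_UniformSpace f x.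

Definition is_C_derive (f : C -> C) (x l : C) : Prop :=
  @is_derive C_AbsRing C_NormedModule f x l.

(* [p] is a single-valued continuous branch of the power [f ^ c] on [U]. *)
Definition power_branch_on (U : C -> Prop) (f : C -> C) (c : C) (p : C -> C)
  : Prop :=
  exists L : C -> C, forall x : C, U x ->
    C_continuous L x /\ Cexp (L x) = f x /\ p x = Cexp (c * L x).

(* [p] is the branch of [f ^ c] on a disk about [x0] that equals 1 at [x0];
   as the disk is connected, there is at most one such [p] on it. *)
Definition power_branch_at (x0 : C) (r : R) (f : C -> C) (c : C) (p : C -> C)
  : Prop :=
  power_branch_on (disk x0 r) f c p /\ p x0 = 1.

(* [theta] is, on [U], a branch of the product of the powers [f ^ c],
   [(f, c)] in [l]. *)
Fixpoint power_product_on (U : C -> Prop) (l : list ((C -> C) * C))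
  (theta : C -> C) : Prop :=
  match l with
  | [] => forall x : C, U x -> theta x = 1
  | (f, c) :: l' =>
      exists p theta' : C -> C,
        power_branch_on U f c p /\ power_product_on U l' theta' /\
        forall x : C, U x -> theta x = p x * theta' x
  end.

Definition polyval (b : nat -> C) (d : nat) (x : C) : C :=
  sum_n (fun i => b i * x ^ i) d.

Definition is_poly (p : C -> C) : Prop :=
  exists (b : nat -> C) (d : nat), forall x : C, p x = polyval b d x.

(* The value of [f] at a pole is not constrained, but [power_branch_on U f c p]
   forces [f] to be continuous and nonzero on an open [U], so such a [U]
   contains no pole of [f]. *)
Definition nonzero_ratfun (f : C -> C) : Prop :=
  exists p q : C -> C,
    is_poly p /\ is_poly q /\ (exists x, p x <> 0) /\ (exists x, q x <> 0) /\
    forall x : C, q x <> 0 -> f x = p x / q x.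

(* [num / den] is a rational function in lowest terms, of degree
   [d = max (deg num) (deg den)]. *)
Definition ratfun_degree (num den : C -> C) (d : nat) : Prop :=
  (exists b c : nat -> C,
     (b d <> 0 \/ c d <> 0) /\
     (forall x : C, num x = polyval b d x) /\
     (forall x : C, den x = polyval c d x)) /\
  (exists x : C, den x <> 0) /\
  (forall x : C, ~ (num x = 0 /\ den x = 0)).

Fixpoint poch (x : C) (j : nat) : C :=
  match j with
  | O => 1
  | S k => poch x k * (x + NtoC k)
  end.

Definition hyp2F1_coef (A B C0 : C) (j : nat) : C :=
  poch A j * poch B j / (poch C0 j * NtoC (fact j)).

(* [Cinv 0 = 0] makes the coefficients total; they are meaningful only under
   this condition. *)
Definition hyp2F1_defined (C0 : C) : Prop := forall k : nat, C0 <> - NtoC k.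

(* The series converges at [z], with sum [v]. *)
Definition is_hyp2F1 (A B C0 z v : C) : Prop :=
  @is_pseries C_AbsRing C_NormedModule (hyp2F1_coef A B C0) z v.

Definition hypergeom_solution (A B C0 : C) (D : C -> Prop) (y : C -> C)
  : Prop :=
  exists y1 y2 : C -> C, forall z : C, D z ->
    is_C_derive y z (y1 z) /\ is_C_derive y1 z (y2 z) /\
    z * (1 - z) * y2 z + (C0 - (A + B + 1) * z) * y1 z - A * B * y z = 0.

(* The hypergeometric equation with parameters [A], [B], [C0] has local
   exponent differences [d0], [d1], [dinf] at 0, 1, infinity, up to sign. *)
Definition exponent_differences (A B C0 d0 d1 dinf : C) : Prop :=
  (1 - C0 = d0 \/ 1 - C0 = - d0) /\
  (C0 - A - B = d1 \/ C0 - A - B = - d1) /\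
  (A - B = dinf \/ A - B = - dinf).

(* The rational function [num / den], of degree [d], realizes a pull-back
   transformation from the hypergeometric equation with parameters
   [A0], [B0], [C0] to the one with parameters [A1], [B1], [C1].
   The factor [theta] is multivalued, hence the quantification over all open
   sets [U] and all branches of [theta] on [U]; the factors [l] do not depend
   on [U], on the branch or on the solution [y]. *)
Definition pullback_transformation (A0 B0 C0 A1 B1 C1 : C)
  (num den : C -> C) (d : nat) : Prop :=
  ratfun_degree num den d /\
  exists l : list ((C -> C) * C),
    List.Forall (fun fc => nonzero_ratfun (fst fc)) l /\
    forall (U D : C -> Prop) (theta y : C -> C),
      C_open U -> C_open D ->
      (forall x : C, U x -> den x <> 0 /\ D (num x / den x)) ->
      power_product_on U l theta ->
      hypergeom_solution A0 B0 C0 D y ->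
      hypergeom_solution A1 B1 C1 U (fun x => theta x * y (num x / den x)).

Definition theta1 (n : nat) (x : C) : C :=
  sum_n (fun j => RtoC (Binomial.C n (2 * j)) * x ^ j) (n / 2)%nat.

Definition theta2 (n : nat) (x : C) : C :=
  sum_n (fun j => RtoC (Binomial.C n (2 * j + 1)) * x ^ j) ((n - 1) / 2)%nat.

Definition phi (n : nat) (x : C) : C :=
  x * theta2 n x ^ 2 / theta1 n x ^ 2.

(* Main.v *)
Require Import Defs.
From Stdlib Require Import Lra Lia Classical.
Import ListNotations.

(** The idea is that [phi] is the multiplication formula of the hyperbolic tangent. If
    [x = s ^ 2], then [theta1 x + s * theta2 x = (1 + s) ^ n] and
    [theta1 x - s * theta2 x = (1 - s) ^ n] ([theta_plus], [theta_minus]); the two polynomial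
    identities follow at once. With [s = tanh t] this says that
    [theta1 x = cosh (n t) / cosh (t) ^ n] and [phi x = tanh (n t) ^ 2].

    An equation with exponent differences [1/2, a, 1/2] at [0, 1, infinity] becomes, in the
    coordinate [t] with [z = tanh (t) ^ 2] and after multiplication of the solutions by powers of
    [z] and [1 - z], the equation [W'' = a ^ 2 W]. In this coordinate the pull-back along [phi] is
    the dilation [t -> n t], which turns the parameter [a] into [n a]. For the transformation of
    equations this is carried out on an arbitrary open set by [hypergeom_to_osc] and
    [osc_to_hypergeom], with [t] entering only through [sqrt x] and [sqrt phi].

    Near [x = 0] the hypergeometric series are, up to elementary factors, the solutions
    [cosh (a t)] and [sinh (a t) / a] of [W'' = a ^ 2 W], characterized by their initial values
    ([osc_even], [osc_odd], [osc_sinh]). The solution with parameter [n a] at [t] is therefore a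
    constant multiple of the one with parameter [a] at [n t] ([osc_dilation]), and translating
    back gives the three identities near 0. For the factors [theta1 ^ (- a)] one checks that
    the principal logarithms of [cosh (n t)], [cosh t] and [theta1] match for small [t].

    Near [x = 1] the parameter [t] is infinite, and [q = exp (- 2 t) = (1 - s) / (1 + s)] is used
    instead: [1 - x = 4 q / (1 + q) ^ 2], and [1 - phi] is the same expression in [q ^ n]. The last
    identity reduces to the closed form [(1 + q) ^ a] of
    2F1 (a/2, (a+1)/2; a+1 | 4q / (1+q)^2), applied to [a] and to [n a]. Since [q = 0] is a
    singular point of the equation, uniqueness of the solution is available directly only for
    [0 <= Re a] ([quadratic_form_right_half_plane]); other parameters are reached by a contiguity
    relation between [a] and [a + 2] ([quadratic_form_shift]). *)

(** * Continuity and complex differentiability *)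

Lemma C_continuous_eps (f : C -> C) (x : C) :
  C_continuous f x <->
  forall eps : R, (0 < eps)%R -> exists d : R, (0 < d)%R /\
    forall y, (Cmod (y - x) < d)%R -> (Cmod (f y - f x) < eps)%R.
Proof.
  split.
  - intros H eps He.
    assert (Hs : (0 < sqrt 2)%R) by (apply sqrt_lt_R0; lra).
    assert (He' : (0 < eps / sqrt 2)%R) by (apply Rdiv_lt_0_compat; assumption).
    destruct (proj1 (filterlim_locally _ _) H (mkposreal _ He')) as [d Hd].
    exists d; split; [apply cond_pos|].
    intros y Hy.
    assert (B := Hd y (C_NormedModule_mixin_compat1 x y d Hy)).
    apply C_NormedModule_mixin_compat2 in B.
    simpl in B. replace (sqrt 2 * (eps / sqrt 2))%R with eps in B by (field; lra).
    exact B.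
  - intros H. apply filterlim_locally. intros eps.
    destruct (H eps (cond_pos eps)) as [d [Hd1 Hd2]].
    assert (Hs : (0 < sqrt 2)%R) by (apply sqrt_lt_R0; lra).
    assert (He' : (0 < d / sqrt 2)%R) by (apply Rdiv_lt_0_compat; assumption).
    exists (mkposreal _ He'). intros y Hy.
    apply C_NormedModule_mixin_compat1. apply Hd2.
    apply C_NormedModule_mixin_compat2 in Hy. simpl in Hy.
    replace (sqrt 2 * (d / sqrt 2))%R with d in Hy by (field; lra). exact Hy.
Qed.

Lemma C_open_eps (U : C -> Prop) (x : C) :
  C_open U -> U x ->
  exists d : R, (0 < d)%R /\ forall y, (Cmod (y - x) < d)%R -> U y.
Proof.
  intros H Hx. destruct (H x Hx) as [d Hd].
  exists d; split; [apply cond_pos|]. intros y Hy.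
  apply Hd. apply C_NormedModule_mixin_compat1. exact Hy.
Qed.

Lemma is_C_derive_eps (f : C -> C) (x l : C) :
  is_C_derive f x l <->
  forall eps : R, (0 < eps)%R -> exists d : R, (0 < d)%R /\
    forall y, (Cmod (y - x) < d)%R ->
      (Cmod (f y - f x - (y - x) * l) <= eps * Cmod (y - x))%R.
Proof.
  split.
  - intros [_ H] eps He.
    destruct (H x (fun P HP => HP) (mkposreal _ He)) as [d Hd].
    exists d; split; [apply cond_pos|]. intros y Hy.
    exact (Hd y Hy).
  - intros H. split; [apply is_linear_scal_l|].
    intros x' Hx' eps.
    pose proof (is_filter_lim_locally_unique (V := AbsRing_NormedModule C_AbsRing) x x' Hx') as E; rewrite <- E; clear E.
    destruct (H eps (cond_pos eps)) as [d [Hd1 Hd2]].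
    exists (mkposreal _ Hd1). intros y Hy. exact (Hd2 y Hy).
Qed.

Lemma Cmod_sub_sym (x y : C) : Cmod (x - y) = Cmod (y - x).
Proof. rewrite <- Cmod_opp. f_equal. ring. Qed.

Lemma C_continuous_const (c x : C) : C_continuous (fun _ => c) x.
Proof.
  apply C_continuous_eps. intros e He. exists 1%R. split; [lra|]. intros y _.
  replace (c - c) with (RtoC 0) by ring. rewrite Cmod_0. exact He.
Qed.

Lemma C_continuous_id (x : C) : C_continuous (fun y => y) x.
Proof. apply C_continuous_eps. intros e He. exists e. auto. Qed.

Lemma C_continuous_plus (f g : C -> C) (x : C) :
  C_continuous f x -> C_continuous g x -> C_continuous (fun y => f y + g y) x.
Proof.
  rewrite !C_continuous_eps. intros Hf Hg e He.
  destruct (Hf (e / 2)%R) as [d1 [P1 H1]]; [lra|].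
  destruct (Hg (e / 2)%R) as [d2 [P2 H2]]; [lra|].
  exists (Rmin d1 d2). split; [apply Rmin_glb_lt; assumption|]. intros y Hy.
  specialize (H1 y (Rlt_le_trans _ _ _ Hy (Rmin_l _ _))).
  specialize (H2 y (Rlt_le_trans _ _ _ Hy (Rmin_r _ _))).
  replace (f y + g y - (f x + g x)) with ((f y - f x) + (g y - g x)) by ring.
  eapply Rle_lt_trans; [apply Cmod_triangle|]. lra.
Qed.

Lemma C_continuous_mult (f g : C -> C) (x : C) :
  C_continuous f x -> C_continuous g x -> C_continuous (fun y => f y * g y) x.
Proof.
  rewrite !C_continuous_eps. intros Hf Hg e He.
  pose proof (Cmod_ge_0 (f x)) as A. pose proof (Cmod_ge_0 (g x)) as B.
  set (K := (Cmod (f x) + Cmod (g x) + 1)%R).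
  assert (HK : (0 < K)%R) by (unfold K; lra).
  assert (He' : (0 < Rmin 1 (e / (2 * K)))%R).
  { apply Rmin_glb_lt; [lra|]. apply Rdiv_lt_0_compat; lra. }
  destruct (Hf _ He') as [d1 [P1 H1]].
  destruct (Hg _ He') as [d2 [P2 H2]].
  exists (Rmin d1 d2). split; [apply Rmin_glb_lt; assumption|]. intros y Hy.
  specialize (H1 y (Rlt_le_trans _ _ _ Hy (Rmin_l _ _))).
  specialize (H2 y (Rlt_le_trans _ _ _ Hy (Rmin_r _ _))).
  set (m := Rmin 1 (e / (2 * K))) in *.
  assert (m1 : (m <= 1)%R) by apply Rmin_l.
  assert (m2 : (m * K <= e / 2)%R).
  { apply Rle_trans with (e / (2 * K) * K)%R.
    - apply Rmult_le_compat_r; [lra|apply Rmin_r].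
    - right. field. lra. }
  replace (f y * g y - f x * g x)
    with ((f y - f x) * (g y - g x) + (f y - f x) * g x + f x * (g y - g x)) by ring.
  eapply Rle_lt_trans; [apply Cmod_triangle|].
  eapply Rle_lt_trans; [apply Rplus_le_compat_r; apply Cmod_triangle|].
  rewrite !Cmod_mult.
  pose proof (Cmod_ge_0 (f y - f x)). pose proof (Cmod_ge_0 (g y - g x)).
  apply Rle_lt_trans with (m * K)%R; [unfold K; nra|lra].
Qed.

Lemma C_continuous_comp (f g : C -> C) (x : C) :
  C_continuous g x -> C_continuous f (g x) -> C_continuous (fun y => f (g y)) x.
Proof.
  rewrite !C_continuous_eps. intros Hg Hf e He.
  destruct (Hf e He) as [d1 [P1 H1]]. destruct (Hg d1 P1) as [d2 [P2 H2]].
  exists d2. auto.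
Qed.

Lemma C_continuous_neq0 (f : C -> C) (x : C) :
  C_continuous f x -> f x <> 0 ->
  exists d : R, (0 < d)%R /\ forall y, (Cmod (y - x) < d)%R ->
    (Cmod (f x) / 2 <= Cmod (f y))%R.
Proof.
  rewrite C_continuous_eps. intros H Hx.
  apply Cmod_gt_0 in Hx.
  destruct (H (Cmod (f x) / 2)%R) as [d [P D]]; [lra|].
  exists d; split; [assumption|]. intros y Hy. specialize (D y Hy).
  rewrite Cmod_sub_sym in D.
  pose proof (Cmod_triangle (f x - f y) (f y)) as T.
  replace (f x - f y + f y) with (f x) in T by ring. lra.
Qed.

Lemma C_continuous_inv (f : C -> C) (x : C) :
  C_continuous f x -> f x <> 0 -> C_continuous (fun y => / f y) x.
Proof.
  intros H Hx. destruct (C_continuous_neq0 f x H Hx) as [d1 [P1 H1]].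
  rewrite C_continuous_eps in *. intros e He.
  pose proof (proj1 (Cmod_gt_0 _) Hx) as Hm.
  destruct (H (e * (Cmod (f x) * (Cmod (f x) / 2)))%R) as [d2 [P2 H2]].
  { apply Rmult_lt_0_compat; [lra|]. apply Rmult_lt_0_compat; lra. }
  exists (Rmin d1 d2). split; [apply Rmin_glb_lt; assumption|]. intros y Hy.
  specialize (H1 y (Rlt_le_trans _ _ _ Hy (Rmin_l _ _))).
  specialize (H2 y (Rlt_le_trans _ _ _ Hy (Rmin_r _ _))).
  assert (Hy0 : f y <> 0) by (apply Cmod_gt_0; lra).
  replace (/ f y - / f x) with ((f x - f y) / (f x * f y)) by (field; auto).
  rewrite Cmod_div by (apply Cmult_neq_0; assumption).
  rewrite Cmod_mult, Cmod_sub_sym.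
  apply Rlt_div_l; [apply Rmult_lt_0_compat; lra|].
  eapply Rlt_le_trans; [exact H2|].
  apply Rmult_le_compat_l; [lra|]. apply Rmult_le_compat_l; lra.
Qed.

Lemma C_continuous_ext_loc (f g : C -> C) (x : C) (d : R) :
  (0 < d)%R -> (forall y, (Cmod (y - x) < d)%R -> f y = g y) ->
  C_continuous f x -> C_continuous g x.
Proof.
  rewrite !C_continuous_eps. intros P E H e He.
  destruct (H e He) as [d2 [P2 H2]].
  exists (Rmin d d2). split; [apply Rmin_glb_lt; assumption|]. intros y Hy.
  rewrite <- !E. 
  - apply H2. eapply Rlt_le_trans; [exact Hy|apply Rmin_r].
  - replace (x - x) with (RtoC 0) by ring. rewrite Cmod_0. exact P.
  - eapply Rlt_le_trans; [exact Hy|apply Rmin_l].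
Qed.

(** Caratheodory's form of the derivative. It turns the product, chain and inverse rules
    below into statements about continuous functions only. *)
Lemma is_C_derive_slope (f : C -> C) (x l : C) :
  is_C_derive f x l <->
  exists g : C -> C, C_continuous g x /\ g x = l /\
    forall y, f y = f x + g y * (y - x).
Proof.
  rewrite is_C_derive_eps. split.
  - intros H.
    assert (D : forall y : C, {y = x} + {y <> x}).
    { intros [y1 y2]; destruct x as [x1 x2].
      destruct (Req_EM_T y1 x1); [destruct (Req_EM_T y2 x2)|];
        [left; congruence|right; congruence|right; congruence]. }
    exists (fun y => if D y then l else (f y - f x) / (y - x)).
    split; [|split].
    + apply C_continuous_eps. intros e He.
      destruct (H (e / 2)%R) as [d [P Q]]; [lra|].
      exists d; split; [assumption|]. intros y Hy.
      destruct (D x) as [_|n]; [|congruence].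
      destruct (D y) as [E|n].
      * replace (l - l) with (RtoC 0) by ring. rewrite Cmod_0. exact He.
      * assert (N : y - x <> 0) by (apply Cminus_eq_contra; exact n).
        replace ((f y - f x) / (y - x) - l)
          with ((f y - f x - (y - x) * l) / (y - x)) by (field; exact N).
        rewrite Cmod_div by exact N.
        apply Rlt_div_l; [apply Cmod_gt_0; exact N|].
        apply Cmod_gt_0 in N. specialize (Q y Hy). nra.
    + destruct (D x); congruence.
    + intros y. destruct (D y) as [E|n].
      * rewrite E. ring.
      * field. apply Cminus_eq_contra; exact n.
  - intros [g [Hc [Hl Hg]]] e He.
    rewrite C_continuous_eps in Hc. destruct (Hc e He) as [d [P Q]].
    exists d; split; [assumption|]. intros y Hy. specialize (Q y Hy).
    rewrite (Hg y). subst l.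
    replace (f x + g y * (y - x) - f x - (y - x) * g x)
      with ((g y - g x) * (y - x)) by ring.
    rewrite Cmod_mult. apply Rmult_le_compat_r; [apply Cmod_ge_0|lra].
Qed.

Lemma is_C_derive_continuous (f : C -> C) (x l : C) :
  is_C_derive f x l -> C_continuous f x.
Proof.
  rewrite is_C_derive_slope. intros [g [Hc [_ Hg]]].
  apply C_continuous_ext_loc with (f := fun y => f x + g y * (y + - x)) (d := 1%R); [lra| |].
  - intros y _. rewrite (Hg y). reflexivity.
  - apply C_continuous_plus; [apply C_continuous_const|].
    apply C_continuous_mult; [exact Hc|].
    apply C_continuous_plus; [apply C_continuous_id|apply C_continuous_const].
Qed.

Lemma is_C_derive_ext_loc (f g : C -> C) (x l : C) (d : R) :
  (0 < d)%R -> (forall y, (Cmod (y - x) < d)%R -> f y = g y) ->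
  is_C_derive f x l -> is_C_derive g x l.
Proof.
  rewrite !is_C_derive_eps. intros P E H e He.
  destruct (H e He) as [d2 [P2 H2]].
  exists (Rmin d d2). split; [apply Rmin_glb_lt; assumption|]. intros y Hy.
  rewrite <- !E.
  - apply H2. eapply Rlt_le_trans; [exact Hy|apply Rmin_r].
  - replace (x - x) with (RtoC 0) by ring. rewrite Cmod_0. exact P.
  - eapply Rlt_le_trans; [exact Hy|apply Rmin_l].
Qed.

Lemma is_C_derive_ext (f g : C -> C) (x l : C) :
  (forall y, f y = g y) -> is_C_derive f x l -> is_C_derive g x l.
Proof. intros E. apply is_C_derive_ext_loc with (d := 1%R); [lra|auto]. Qed.

Lemma is_C_derive_const (c x : C) : is_C_derive (fun _ => c) x 0.
Proof.
  apply is_C_derive_slope. exists (fun _ => 0).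
  split; [apply C_continuous_const|]. split; [reflexivity|intros; ring].
Qed.

Lemma is_C_derive_id (x : C) : is_C_derive (fun y => y) x 1.
Proof.
  apply is_C_derive_slope. exists (fun _ => 1).
  split; [apply C_continuous_const|]. split; [reflexivity|intros; ring].
Qed.

Lemma is_C_derive_plus (f g : C -> C) (x l m : C) :
  is_C_derive f x l -> is_C_derive g x m -> is_C_derive (fun y => f y + g y) x (l + m).
Proof.
  rewrite !is_C_derive_slope. intros [u [U1 [U2 U3]]] [v [V1 [V2 V3]]].
  exists (fun y => u y + v y). split; [apply C_continuous_plus; assumption|].
  split; [congruence|]. intros y. rewrite (U3 y), (V3 y). ring.
Qed.

Lemma is_C_derive_mult (f g : C -> C) (x l m : C) :
  is_C_derive f x l -> is_C_derive g x m ->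
  is_C_derive (fun y => f y * g y) x (l * g x + f x * m).
Proof.
  intros Hf Hg. pose proof (is_C_derive_continuous g x m Hg) as Gc.
  rewrite is_C_derive_slope in *.
  destruct Hf as [u [U1 [U2 U3]]]. destruct Hg as [v [V1 [V2 V3]]].
  exists (fun y => u y * g y + f x * v y). split.
  - apply C_continuous_plus; apply C_continuous_mult; auto using C_continuous_const.
  - split; [congruence|]. intros y.
    transitivity ((f x + u y * (y - x)) * g y); [rewrite <- U3; reflexivity|].
    transitivity (f x * (g x + v y * (y - x)) + u y * (y - x) * g y);
      [rewrite <- V3; ring|]. ring.
Qed.

Lemma is_C_derive_comp (f g : C -> C) (x l m : C) :
  is_C_derive g x m -> is_C_derive f (g x) l -> is_C_derive (fun y => f (g y)) x (l * m).
Proof.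
  intros Hg Hf. pose proof (is_C_derive_continuous g x m Hg) as Gc.
  rewrite is_C_derive_slope in *.
  destruct Hf as [u [U1 [U2 U3]]]. destruct Hg as [v [V1 [V2 V3]]].
  exists (fun y => u (g y) * v y). split.
  - apply C_continuous_mult; [|assumption]. apply C_continuous_comp; assumption.
  - split; [congruence|]. intros y. rewrite (U3 (g y)). rewrite (V3 y) at 2. ring.
Qed.

Lemma is_C_derive_inv (f : C -> C) (x l : C) :
  is_C_derive f x l -> f x <> 0 -> is_C_derive (fun y => / f y) x (- l / f x ^ 2).
Proof.
  intros Hf Hx. pose proof (is_C_derive_continuous f x l Hf) as Fc.
  destruct (C_continuous_neq0 f x Fc Hx) as [d [P D]].
  apply is_C_derive_slope in Hf. destruct Hf as [u [U1 [U2 U3]]].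
  apply is_C_derive_ext_loc with (f := fun y => / f x + (- u y * / f y * / f x) * (y - x)) (d := d);
    [exact P| |].
  - intros y Hy. specialize (D y Hy). apply Cmod_gt_0 in Hx as Hx'.
    assert (N : f y <> 0) by (apply Cmod_gt_0; lra).
    transitivity (/ f x - (f y - f x) / (f y * f x)); [|field; auto].
    assert (E : f y - f x = u y * (y - x)) by (rewrite (U3 y); ring).
    rewrite E. field. auto.
  - apply is_C_derive_slope. exists (fun y => (- (1) * u y) * (/ f y * / f x)).
    split; [|split].
    + apply C_continuous_mult; [apply C_continuous_mult; auto using C_continuous_const|].
      apply C_continuous_mult; [|apply C_continuous_const].
      apply C_continuous_inv; assumption.
    + rewrite U2. field. exact Hx.
    + intros y. ring.
Qed.

Lemma is_C_derive_eq (f : C -> C) (x l m : C) :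
  is_C_derive f x l -> l = m -> is_C_derive f x m.
Proof. intros H <-. exact H. Qed.

Lemma is_C_derive_opp (f : C -> C) (x l : C) :
  is_C_derive f x l -> is_C_derive (fun y => - f y) x (- l).
Proof.
  intros H. apply is_C_derive_ext with (f := fun y => - (1) * f y); [intros; ring|].
  eapply is_C_derive_eq; [apply is_C_derive_mult; [apply is_C_derive_const|exact H]|cbv beta; ring].
Qed.

Lemma is_C_derive_minus (f g : C -> C) (x l m : C) :
  is_C_derive f x l -> is_C_derive g x m -> is_C_derive (fun y => f y - g y) x (l - m).
Proof. intros. apply is_C_derive_plus; [assumption|]. apply is_C_derive_opp; assumption. Qed.

Lemma is_C_derive_div (f g : C -> C) (x l m : C) :
  is_C_derive f x l -> is_C_derive g x m -> g x <> 0 ->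
  is_C_derive (fun y => f y / g y) x ((l * g x - f x * m) / g x ^ 2).
Proof.
  intros Hf Hg N. eapply is_C_derive_eq.
  - apply is_C_derive_mult; [exact Hf|]. apply is_C_derive_inv; [exact Hg|exact N].
  - cbv beta; field. exact N.
Qed.

Lemma is_C_derive_pow (f : C -> C) (n : nat) (x l : C) :
  is_C_derive f x l -> is_C_derive (fun y => f y ^ n) x (NtoC n * f x ^ (n - 1) * l).
Proof.
  intros H. induction n as [|n IH].
  - eapply is_C_derive_eq; [exact (is_C_derive_const 1 x)|].
    unfold NtoC. change (INR 0) with 0%R. ring.
  - apply is_C_derive_ext with (f := fun y => f y * f y ^ n); [intros; simpl; ring|].
    eapply is_C_derive_eq; [apply is_C_derive_mult; [exact H|exact IH]|].
    cbv beta.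
    cbv beta; unfold NtoC; rewrite S_INR, RtoC_plus. replace (S n - 1)%nat with n by lia.
    destruct n as [|n]; [simpl; ring|]. replace (S n - 1)%nat with n by lia.
    rewrite Cpow_S. ring.
Qed.

Lemma is_C_derive_sqr (f : C -> C) (x l : C) :
  is_C_derive f x l -> is_C_derive (fun y => f y ^ 2) x (2 * f x * l).
Proof.
  intros H. apply is_C_derive_ext with (f := fun y => f y * f y); [intros; ring|].
  eapply is_C_derive_eq; [apply is_C_derive_mult; exact H|ring].
Qed.

Lemma is_C_derive_fun (f : C -> C) (x l m : C) :
  is_C_derive f x l -> is_C_derive f x m -> l = m.
Proof.
  intros H1 H2. rewrite <- (is_C_derive_unique f x l H1). apply is_C_derive_unique. exact H2.
Qed.

(** Decomposes a derivative along the arithmetic operations and leaves the resulting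
    value to unification, so that one [field] compares it with the announced one. *)
Ltac derive_C :=
  lazymatch goal with
  | |- is_C_derive (fun _ => ?c) _ _ => apply is_C_derive_const
  | |- is_C_derive (fun y => y) _ _ => apply is_C_derive_id
  | |- is_C_derive (fun y => @?f y + @?g y) _ _ =>
      eapply (is_C_derive_plus f g); derive_C
  | |- is_C_derive (fun y => @?f y - @?g y) _ _ =>
      eapply (is_C_derive_minus f g); derive_C
  | |- is_C_derive (fun y => - @?f y) _ _ =>
      eapply (is_C_derive_opp f); derive_C
  | |- is_C_derive (fun y => @?f y * @?g y) _ _ =>
      eapply (is_C_derive_mult f g); derive_C
  | |- is_C_derive (fun y => @?f y / @?g y) _ _ =>
      eapply (is_C_derive_div f g); [derive_C | derive_C | cbv beta]
  | |- is_C_derive (fun y => @?f y ^ 2) _ _ =>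
      eapply (is_C_derive_sqr f); derive_C
  | |- is_C_derive (fun y => @?f y ^ ?n) _ _ =>
      eapply (is_C_derive_pow f n); derive_C
  (* partial applications to which unification reduces [fun y => - y] and [fun y => c * y] *)
  | |- is_C_derive Copp _ _ => eapply (is_C_derive_opp (fun y => y)); derive_C
  | |- is_C_derive (Cmult ?c) _ _ => eapply (is_C_derive_mult (fun _ => c) (fun y => y)); derive_C
  | _ => try eassumption
  end.

(** * The complex exponential and its local inverse *)

Lemma Cexp_0 : Cexp 0 = 1.
Proof. unfold Cexp. simpl. rewrite exp_0, cos_0, sin_0. apply injective_projections; simpl; ring. Qed.

Lemma Cexp_plus (x y : C) : Cexp (x + y) = Cexp x * Cexp y.
Proof.
  destruct x as [a b], y as [c d]. unfold Cexp. simpl.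
  rewrite exp_plus, cos_plus, sin_plus.
  apply injective_projections; simpl; ring.
Qed.

Lemma Cexp_neq_0 (x : C) : Cexp x <> 0.
Proof.
  intros E. pose proof (Cexp_plus x (- x)) as H.
  replace (x + - x) with (RtoC 0) in H by ring.
  rewrite Cexp_0, E, Cmult_0_l in H. apply C1_nz. exact H.
Qed.

Lemma Cexp_opp (x : C) : Cexp (- x) = / Cexp x.
Proof.
  pose proof (Cexp_plus x (- x)) as H.
  replace (x + - x) with (RtoC 0) in H by ring. rewrite Cexp_0 in H.
  pose proof (Cexp_neq_0 x).
  replace (Cexp (- x)) with (Cexp x * Cexp (- x) / Cexp x) by (field; auto).
  rewrite <- H. field. auto.
Qed.

Lemma Cexp_NtoC_mult (n : nat) (x : C) : Cexp (NtoC n * x) = Cexp x ^ n.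
Proof.
  unfold NtoC. induction n as [|n IH].
  - change (INR 0) with 0%R. rewrite Cmult_0_l, Cexp_0. reflexivity.
  - rewrite S_INR, RtoC_plus, Cpow_S, <- IH, <- Cexp_plus. f_equal. ring.
Qed.

Lemma derivable_pt_lim_remainder (f : R -> R) (l e : R) :
  derivable_pt_lim f 0 l -> (0 < e)%R ->
  exists d : R, (0 < d)%R /\
    forall h, (Rabs h < d)%R -> (Rabs (f h - f 0 - l * h) <= e * Rabs h)%R.
Proof.
  intros H He. destruct (H e He) as [d D].
  exists d. split; [apply cond_pos|]. intros h Hh.
  destruct (Req_dec h 0) as [->|N].
  - replace (f 0 - f 0 - l * 0)%R with 0%R by ring. rewrite Rabs_R0. lra.
  - specialize (D h N Hh). rewrite Rplus_0_l in D.
    replace (f h - f 0 - l * h)%R with (((f h - f 0) / h - l) * h)%R by (field; exact N).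
    rewrite Rabs_mult. apply Rmult_le_compat_r; [apply Rabs_pos|lra].
Qed.

Lemma Cmod_le_Re_Im (z : C) : (Cmod z <= Rabs (Re z) + Rabs (Im z))%R.
Proof.
  replace z with (RtoC (Re z) + Ci * RtoC (Im z)) at 1.
  - eapply Rle_trans; [apply Cmod_triangle|].
    rewrite Cmod_mult, Cmod_Ci, !Cmod_R. lra.
  - destruct z as [a b]. apply injective_projections; simpl; ring.
Qed.

Lemma Im_le_Cmod (z : C) : (Rabs (Im z) <= Cmod z)%R.
Proof. eapply Rle_trans; [|apply Rmax_Cmod]. apply Rmax_r. Qed.

(** With [exp x = 1 + x + p], [cos y = 1 + q] and [sin y = y + r], where [p], [q], [r] are
    small relative to [|x|] or [|y|], the remainder is a sum of products of these terms. *)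
Lemma is_C_derive_Cexp_0 : is_C_derive Cexp 0 1.
Proof.
  apply is_C_derive_eps. intros eps He.
  set (e := (Rmin 1 (eps / 8))%R).
  assert (e0 : (0 < e)%R) by (apply Rmin_glb_lt; lra).
  assert (e1 : (e <= 1)%R) by apply Rmin_l.
  assert (e2 : (e <= eps / 8)%R) by apply Rmin_r.
  destruct (derivable_pt_lim_remainder exp 1 e) as [d1 [P1 D1]];
    [pose proof (derivable_pt_lim_exp 0) as D; rewrite exp_0 in D; exact D|assumption|].
  destruct (derivable_pt_lim_remainder cos 0 e) as [d2 [P2 D2]];
    [pose proof (derivable_pt_lim_cos 0) as D; rewrite sin_0, Ropp_0 in D; exact D|assumption|].
  destruct (derivable_pt_lim_remainder sin 1 e) as [d3 [P3 D3]];
    [pose proof (derivable_pt_lim_sin 0) as D; rewrite cos_0 in D; exact D|assumption|].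
  exists (Rmin (Rmin d1 (e / 2)) (Rmin d2 d3)).
  split; [repeat apply Rmin_glb_lt; lra|].
  intros z Hz. replace (z - 0) with z in * by ring.
  pose proof (Rlt_le_trans _ _ _ Hz (Rmin_l _ _)) as Hz1.
  pose proof (Rlt_le_trans _ _ _ Hz (Rmin_r _ _)) as Hz2.
  pose proof (Rlt_le_trans _ _ _ Hz1 (Rmin_l _ _)) as Z1.
  pose proof (Rlt_le_trans _ _ _ Hz1 (Rmin_r _ _)) as Z2.
  pose proof (Rlt_le_trans _ _ _ Hz2 (Rmin_l _ _)) as Z3.
  pose proof (Rlt_le_trans _ _ _ Hz2 (Rmin_r _ _)) as Z4.
  rewrite Cexp_0, Cmult_1_r.
  pose proof (re_le_Cmod z) as Hr. pose proof (Im_le_Cmod z) as Hi.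
  set (m := Cmod z) in *.
  destruct z as [x y]. simpl in Hr, Hi.
  assert (A1 : (Rabs (exp x - exp 0 - 1 * x) <= e * Rabs x)%R) by (apply D1; lra).
  assert (A2 : (Rabs (cos y - cos 0 - 0 * y) <= e * Rabs y)%R) by (apply D2; lra).
  assert (A3 : (Rabs (sin y - sin 0 - 1 * y) <= e * Rabs y)%R) by (apply D3; lra).
  rewrite exp_0 in A1. rewrite cos_0 in A2. rewrite sin_0 in A3.
  eapply Rle_trans; [apply Cmod_le_Re_Im|].
  unfold Cexp; simpl.
  set (E := exp x) in *. set (c := cos y) in *. set (s := sin y) in *.
  replace (E * c + - (1) + - x)%R
    with ((E - 1 - 1 * x) + (c - 1 - 0 * y) + (E - 1 - 1 * x + x) * (c - 1 - 0 * y))%R by ring.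
  replace (E * s + - 0 + - y)%R
    with ((s - 0 - 1 * y) + (E - 1 - 1 * x + x) * (s - 0 - 1 * y) + (E - 1 - 1 * x + x) * y)%R by ring.
  set (p := (E - 1 - 1 * x)%R) in *. set (q := (c - 1 - 0 * y)%R) in *.
  set (r := (s - 0 - 1 * y)%R) in *.
  pose proof (Rabs_pos x). pose proof (Rabs_pos y).
  assert (B : (Rabs (p + x) <= e)%R).
  { eapply Rle_trans; [apply Rabs_triang|]. nra. }
  assert (T1 : (Rabs (p + q + (p + x) * q) <= 3 * e * m)%R).
  { eapply Rle_trans; [apply Rabs_triang|].
    pose proof (Rabs_triang p q). rewrite Rabs_mult.
    pose proof (Rabs_pos q). pose proof (Rabs_pos (p + x)). nra. }
  assert (T2 : (Rabs (r + (p + x) * r + (p + x) * y) <= 3 * e * m)%R).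
  { eapply Rle_trans; [apply Rabs_triang|].
    pose proof (Rabs_triang r ((p + x) * r)).
    rewrite (Rabs_mult (p + x) r) in *. rewrite (Rabs_mult (p + x) y).
    pose proof (Rabs_pos r). pose proof (Rabs_pos (p + x)). nra. }
  assert (0 <= m)%R by lra. nra.
Qed.

Lemma is_C_derive_Cexp (x : C) : is_C_derive Cexp x (Cexp x).
Proof.
  apply is_C_derive_ext with (f := fun y => Cexp x * Cexp (y - x)).
  - intros y. rewrite <- Cexp_plus. f_equal. ring.
  - eapply is_C_derive_eq.
    + eapply is_C_derive_mult; [derive_C|].
      apply is_C_derive_comp; [derive_C|].
      replace (x - x) with (RtoC 0) by ring. apply is_C_derive_Cexp_0.
    + cbv beta. ring.
Qed.

Lemma is_C_derive_Cexp_comp (f : C -> C) (x l : C) :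
  is_C_derive f x l -> is_C_derive (fun y => Cexp (f y)) x (Cexp (f x) * l).
Proof. intros H. apply is_C_derive_comp; [exact H|apply is_C_derive_Cexp]. Qed.

Lemma C_continuous_Cexp (x : C) : C_continuous Cexp x.
Proof. exact (is_C_derive_continuous _ _ _ (is_C_derive_Cexp x)). Qed.

(** A continuous logarithm is automatically differentiable: [Cexp] has nonzero slope at
    [L x], so the increment of [L] is that of [f] divided by this slope. *)
Lemma is_C_derive_log_branch (L f : C -> C) (x l : C) (d : R) :
  (0 < d)%R -> C_continuous L x -> 
  (forall y, (Cmod (y - x) < d)%R -> Cexp (L y) = f y) ->
  is_C_derive f x l -> is_C_derive L x (l / f x).
Proof.
  intros P Lc E Hf.
  pose proof (is_C_derive_Cexp (L x)) as He.
  apply is_C_derive_slope in He. destruct He as [u [U1 [U2 U3]]].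
  apply is_C_derive_slope in Hf. destruct Hf as [v [V1 [V2 V3]]].
  assert (Ex : Cexp (L x) = f x).
  { apply E. replace (x - x) with (RtoC 0) by ring. rewrite Cmod_0. exact P. }
  assert (Cu : C_continuous (fun y => u (L y)) x) by (apply C_continuous_comp; assumption).
  assert (Nu : u (L x) <> 0) by (rewrite U2; apply Cexp_neq_0).
  destruct (C_continuous_neq0 (fun y => u (L y)) x Cu Nu) as [d' [P' D']].
  apply is_C_derive_ext_loc with (f := fun y => L x + (v y * / u (L y)) * (y - x))
    (d := Rmin d d'); [apply Rmin_glb_lt; assumption| |].
  - intros y Hy.
    assert (Ey := E y (Rlt_le_trans _ _ _ Hy (Rmin_l _ _))).
    specialize (D' y (Rlt_le_trans _ _ _ Hy (Rmin_r _ _))).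
    apply Cmod_gt_0 in Nu. assert (N : u (L y) <> 0) by (apply Cmod_gt_0; lra).
    assert (Q : u (L y) * (L y - L x) = v y * (y - x)).
    { transitivity (Cexp (L y) - Cexp (L x)); [rewrite (U3 (L y)); ring|].
      rewrite Ey, Ex, (V3 y). ring. }
    replace (v y * / u (L y) * (y - x)) with (v y * (y - x) / u (L y)) by (field; exact N).
    rewrite <- Q. field. exact N.
  - apply is_C_derive_slope. exists (fun y => v y * / u (L y)). split; [|split].
    + apply C_continuous_mult; [assumption|]. apply C_continuous_inv; assumption.
    + rewrite V2, U2, Ex. reflexivity.
    + intros y. ring.
Qed.

(** The principal logarithm on the half plane [0 < Re z], where the argument is an
    arctangent. *)
Definition Clog (z : C) : C := (ln (Cmod z), atan (Im z / Re z)).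

Lemma Cexp_Clog (z : C) : (0 < Re z)%R -> Cexp (Clog z) = z.
Proof.
  intros H. destruct z as [x y]. simpl in H. unfold Cexp, Clog. simpl.
  assert (N : (0 < Cmod (x, y))%R).
  { apply Rlt_le_trans with (Rabs x); [rewrite Rabs_pos_eq; lra|]. apply (re_le_Cmod (x, y)). }
  rewrite exp_ln by exact N.
  rewrite cos_atan, sin_atan.
  assert (S : sqrt (1 + (y / x)²) = (Cmod (x, y) / x)%R).
  { unfold Cmod; simpl fst; simpl snd.
    replace (1 + (y / x)²)%R with ((x ^ 2 + y ^ 2) / x ^ 2)%R by (unfold Rsqr; field; lra).
    rewrite sqrt_div_alt by nra. rewrite sqrt_pow2 by lra. reflexivity. }
  rewrite S. apply injective_projections; simpl; field; lra.
Qed.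

Lemma Clog_Cexp (v : C) : (- (PI / 2) < Im v < PI / 2)%R -> Clog (Cexp v) = v.
Proof.
  intros H. destruct v as [x y]. simpl in H. unfold Clog.
  assert (M : Cmod (Cexp (x, y)) = exp x).
  { unfold Cexp, Cmod. simpl fst; simpl snd. simpl Re; simpl Im.
    replace ((exp x * cos y) ^ 2 + (exp x * sin y) ^ 2)%R
      with ((exp x) ^ 2 * ((sin y)² + (cos y)²))%R by (unfold Rsqr; ring).
    rewrite sin2_cos2, Rmult_1_r. apply sqrt_pow2. left. apply exp_pos. }
  rewrite M, ln_exp. unfold Cexp; simpl.
  replace (exp x * sin y / (exp x * cos y))%R with (tan y).
  - rewrite atan_tan by exact H. reflexivity.
  - unfold tan. field. split.
    + apply Rgt_not_eq. apply cos_gt_0; lra.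
    + apply Rgt_not_eq, exp_pos.
Qed.

Lemma continuity_pt_eps (f : R -> R) (x e : R) :
  continuity_pt f x -> (0 < e)%R ->
  exists d : R, (0 < d)%R /\ forall y, (Rabs (y - x) < d)%R -> (Rabs (f y - f x) < e)%R.
Proof.
  intros H He. destruct (H e He) as [d [P D]]. exists d. split; [exact P|].
  intros y Hy. destruct (Req_dec x y) as [<-|N].
  - replace (f x - f x)%R with 0%R by ring. rewrite Rabs_R0. exact He.
  - apply (D y). split; [split; [exact I|exact N]|exact Hy].
Qed.

Lemma C_continuous_Clog (z : C) : (0 < Re z)%R -> C_continuous Clog z.
Proof.
  intros H. apply C_continuous_eps. intros e He.
  assert (N : (0 < Cmod z)%R).
  { eapply Rlt_le_trans; [|apply re_le_Cmod]. rewrite Rabs_pos_eq; lra. }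
  destruct (continuity_pt_eps ln (Cmod z) (e / 2)) as [d1 [P1 D1]];
    [apply derivable_continuous_pt; exists (/ Cmod z)%R; apply derivable_pt_lim_ln, N|lra|].
  destruct (continuity_pt_eps atan (Im z / Re z) (e / 2)) as [d2 [P2 D2]];
    [apply derivable_continuous_pt, derivable_pt_atan|lra|].
  set (K := (Cmod z + Re z)%R).
  assert (HK : (0 < K)%R) by (unfold K; lra).
  exists (Rmin d1 (Rmin (Re z / 2) (d2 * (Re z * (Re z / 2)) / K))).
  assert (Pz : (0 < Re z * (Re z / 2))%R) by nra.
  split.
  { repeat apply Rmin_glb_lt; try lra. apply Rdiv_lt_0_compat; [nra|lra]. }
  intros y Hy.
  pose proof (Rlt_le_trans _ _ _ Hy (Rmin_l _ _)) as Y1.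
  pose proof (Rlt_le_trans _ _ _ Hy (Rmin_r _ _)) as Y'.
  pose proof (Rlt_le_trans _ _ _ Y' (Rmin_l _ _)) as Y2.
  pose proof (Rlt_le_trans _ _ _ Y' (Rmin_r _ _)) as Y3.
  eapply Rle_lt_trans; [apply Cmod_le_Re_Im|].
  assert (Q1 : (Rabs (Cmod y - Cmod z) < d1)%R).
  { eapply Rle_lt_trans; [|exact Y1].
    apply Rabs_le. split.
    - pose proof (Cmod_triangle (z - y) y) as T.
      replace (z - y + y) with z in T by ring. rewrite Cmod_sub_sym in T. lra.
    - pose proof (Cmod_triangle (y - z) z) as T.
      replace (y - z + z) with y in T by ring. lra. }
  specialize (D1 _ Q1).
  pose proof (re_le_Cmod (y - z)) as R1. pose proof (Im_le_Cmod (y - z)) as R2.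
  pose proof (re_le_Cmod z) as R3. pose proof (Im_le_Cmod z) as R4.
  destruct y as [a b], z as [u v]; simpl in *. 
  set (m := Cmod ((a, b) - (u, v))) in *.
  assert (Ha : (u / 2 < a)%R) by (pose proof (Rle_abs (-(a + - u))); rewrite Rabs_Ropp in *; lra).
  assert (Q2 : (Rabs (b / a - v / u) < d2)%R).
  { replace (b / a - v / u)%R with (((b + - v) * u - v * (a + - u)) / (u * a))%R by (field; lra).
    unfold Rdiv. rewrite Rabs_mult, Rabs_inv.
    rewrite (Rabs_pos_eq (u * a)) by nra.
    apply Rlt_div_l; [nra|].
    apply Rle_lt_trans with (m * K)%R.
    - eapply Rle_trans; [apply Rabs_triang|]. rewrite Rabs_Ropp, !Rabs_mult.
      rewrite (Rabs_pos_eq u) by lra. unfold K.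
      pose proof (Rabs_pos v). pose proof (Rabs_pos (a + - u)). pose proof (Rabs_pos (b + - v)). nra.
    - apply Rlt_le_trans with (d2 * (u * (u / 2)))%R; [|apply Rmult_le_compat_l; [lra|]; apply Rmult_le_compat_l; lra].
      apply Rlt_div_r in Y3; [exact Y3|exact HK]. }
  specialize (D2 _ Q2).
  unfold Rminus in *. lra.
Qed.

Lemma Clog_1 : Clog 1 = 0.
Proof.
  rewrite <- Cexp_0. apply Clog_Cexp. simpl. pose proof PI_RGT_0. lra.
Qed.

Lemma C_sqrt_exists (z : C) : exists s : C, s ^ 2 = z.
Proof.
  destruct z as [x y].
  pose proof (re_le_Cmod (x, y)) as H. simpl in H.
  pose proof (Rle_abs x). pose proof (Rle_abs (- x)). rewrite Rabs_Ropp in *.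
  set (m := Cmod (x, y)) in *.
  assert (M : (m * m = x * x + y * y)%R).
  { unfold m, Cmod. simpl fst; simpl snd. rewrite sqrt_sqrt by nra. ring. }
  (* half-angle formulas: 2 Re(s)^2 = |z| + Re z and 2 Im(s)^2 = |z| - Re z *)
  set (p := sqrt ((m + x) / 2)). set (q := sqrt ((m - x) / 2)).
  assert (Pp : (p * p = (m + x) / 2)%R) by (apply sqrt_sqrt; lra).
  assert (Pq : (q * q = (m - x) / 2)%R) by (apply sqrt_sqrt; lra).
  assert (Ppq : (2 * (p * q) = Rabs y)%R).
  { unfold p, q. rewrite <- sqrt_mult by lra.
    replace ((m + x) / 2 * ((m - x) / 2))%R with ((y / 2) ^ 2)%R.
    - rewrite <- (Rabs_pos_eq 2) at 1 by lra.
      replace ((y / 2) ^ 2)%R with (Rsqr (y / 2)) by (unfold Rsqr; ring).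
      rewrite sqrt_Rsqr_abs, <- Rabs_mult. f_equal. field.
    - replace ((m + x) / 2 * ((m - x) / 2))%R with ((m * m - x * x) / 4)%R by field.
      rewrite M. field. }
  destruct (Rle_dec 0 y) as [Hy|Hy].
  - rewrite Rabs_pos_eq in Ppq by exact Hy.
    exists (p, q). simpl. apply injective_projections; simpl; lra.
  - rewrite Rabs_left in Ppq by lra.
    exists (p, (- q)%R). simpl. apply injective_projections; simpl; lra.
Qed.

(** * Functions with vanishing derivative *)

Lemma is_derive_ray_Re (f : C -> C) (z l : C) (t : R) :
  is_C_derive f (t * z) l -> is_derive (fun s : R => Re (f (s * z))) t (Re (z * l)).
Proof.
  intros H. split; [apply is_linear_scal_l|].
  intros t' Ht' eps.
  pose proof (is_filter_lim_locally_unique (V := R_NormedModule) t t' Ht') as E.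
  rewrite <- E; clear E Ht'.
  pose proof (Cmod_ge_0 z) as Hz.
  assert (He : (0 < eps / (Cmod z + 1))%R) by (apply Rdiv_lt_0_compat; [apply cond_pos|lra]).
  destruct (proj1 (is_C_derive_eps _ _ _) H _ He) as [d [P D]].
  assert (Hd : (0 < d / (Cmod z + 1))%R) by (apply Rdiv_lt_0_compat; lra).
  exists (mkposreal _ Hd).
  change (forall s : R, (Rabs (s - t) < d / (Cmod z + 1))%R ->
    (Rabs (Re (f (s * z)%C) - Re (f (t * z)%C) - (s - t) * Re (z * l)%C) <= eps * Rabs (s - t))%R).
  intros s Hs.
  assert (M : Cmod (s * z - t * z) = (Rabs (s - t) * Cmod z)%R).
  { rewrite <- Cmod_R, RtoC_minus, <- Cmod_mult. f_equal. ring. }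
  assert (B := D (s * z)). rewrite M in B.
  apply Rlt_div_r in Hs; [|lra]. pose proof (Rabs_pos (s - t)).
  specialize (B ltac:(nra)).
  eapply Rle_trans with (Cmod (f (s * z) - f (t * z) - (s * z - t * z) * l)).
  - eapply Rle_trans; [|apply re_le_Cmod]. right. f_equal.
    replace (s * z - t * z) with (RtoC (s - t) * z) by (rewrite RtoC_minus; ring).
    rewrite <- Cmult_assoc.
    unfold Cminus. rewrite !re_plus, !re_opp, re_scal_l. ring.
  - eapply Rle_trans; [exact B|].
    pose proof (cond_pos eps).
    apply Rle_trans with (eps / (Cmod z + 1) * (Cmod z + 1) * Rabs (s - t))%R.
    + assert (0 <= eps / (Cmod z + 1) * Rabs (s - t))%R by nra. nra.
    + right. field. lra.
Qed.

Lemma is_derive_ray_Im (f : C -> C) (z l : C) (t : R) :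
  is_C_derive f (t * z) l -> is_derive (fun s : R => Im (f (s * z))) t (Im (z * l)).
Proof.
  intros H.
  replace (Im (z * l)) with (Re (z * (- Ci * l)))
    by (destruct z, l; simpl; ring).
  apply is_derive_ext with (f := fun s : R => Re (- Ci * f (s * z))).
  - intros s. destruct (f (s * z)). simpl. ring.
  - apply (is_derive_ray_Re (fun y => - Ci * f y)).
    eapply is_C_derive_eq; [derive_C|]. cbv beta. ring.
Qed.

(** Along each ray from 0 the real and imaginary parts are real functions with zero
    derivative. *)
Lemma is_C_derive_zero_const (f : C -> C) (r : R) :
  (forall z, (Cmod z < r)%R -> is_C_derive f z 0) ->
  forall z, (Cmod z < r)%R -> f z = f 0.
Proof.
  intros H z Hz.
  assert (B : forall t : R, (0 <= t <= 1)%R -> is_C_derive f (t * z) 0).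
  { intros t Ht. apply H. rewrite Cmod_mult, Cmod_R, Rabs_pos_eq by lra.
    pose proof (Cmod_ge_0 z). nra. }
  replace z with (RtoC 1 * z) by ring. replace (RtoC 0) with (RtoC 0 * z) by ring.
  apply injective_projections; symmetry.
  - apply (eq_is_derive (V := R_NormedModule) (fun s : R => Re (f (s * z))) 0 1); [|lra].
    intros t Ht. eapply (is_derive_ray_Re f z 0 t) in B; [|exact Ht].
    now rewrite Cmult_0_r in B.
  - apply (eq_is_derive (V := R_NormedModule) (fun s : R => Im (f (s * z))) 0 1); [|lra].
    intros t Ht. eapply (is_derive_ray_Im f z 0 t) in B; [|exact Ht].
    now rewrite Cmult_0_r in B.
Qed.

(** * Convergent complex power series *)

Definition is_Cseries (a : nat -> C) (v : C) : Prop :=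
  @is_series C_AbsRing C_NormedModule a v.

Lemma is_Cseries_ext (a b : nat -> C) (v : C) :
  (forall k, a k = b k) -> is_Cseries a v -> is_Cseries b v.
Proof. intros E. apply is_series_ext. exact E. Qed.

Lemma is_Cseries_plus (a b : nat -> C) (u v : C) :
  is_Cseries a u -> is_Cseries b v -> is_Cseries (fun k => a k + b k) (u + v).
Proof. apply (is_series_plus (V := C_NormedModule)). Qed.

Lemma is_Cseries_scal (c : C) (a : nat -> C) (u : C) :
  is_Cseries a u -> is_Cseries (fun k => c * a k) (c * u).
Proof. apply (is_series_scal (V := C_NormedModule)). Qed.

Lemma is_Cseries_unique (a : nat -> C) (u v : C) :
  is_Cseries a u -> is_Cseries a v -> u = v.
Proof. apply (filterlim_locally_unique (V := C_NormedModule)). Qed.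

Lemma is_Cseries_0 : is_Cseries (fun _ => 0) 0.
Proof.
  apply (filterlim_ext (fun _ : nat => RtoC 0)).
  - intros n. induction n as [|n IH].
    + now rewrite sum_O.
    + rewrite sum_Sn, <- IH. symmetry. apply Cplus_0_l.
  - apply filterlim_const.
Qed.

Lemma is_Cseries_shift (a : nat -> C) (v : C) :
  is_Cseries (fun k => a (S k)) v -> a 0%nat = 0 -> is_Cseries a v.
Proof.
  intros H E. apply (is_series_decr_1 (V := C_NormedModule)).
  replace (@plus C_NormedModule v (@opp C_NormedModule (a 0%nat))) with v; [exact H|].
  rewrite E. change (v = v + - 0). ring.
Qed.

Lemma is_pseries_iff (c : nat -> C) (z v : C) :
  @is_pseries C_AbsRing C_NormedModule c z v <-> is_Cseries (fun k => c k * z ^ k) v.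
Proof.
  assert (P : forall k, @pow_n C_AbsRing z k = z ^ k).
  { induction k as [|k IH]; [reflexivity|]. simpl. rewrite IH. reflexivity. }
  assert (E : forall k, @scal C_AbsRing C_NormedModule (@pow_n C_AbsRing z k) (c k) = c k * z ^ k).
  { intros k. rewrite P. change (z ^ k * c k = c k * z ^ k). ring. }
  unfold is_pseries. split; apply is_Cseries_ext; intros k; [|symmetry]; apply E.
Qed.

Lemma is_Cseries_Cmod_le (a : nat -> C) (b : nat -> R) (v : C) (B : R) :
  is_Cseries a v -> is_series b B -> (forall k, (Cmod (a k) <= b k)%R) -> (Cmod v <= B)%R.
Proof.
  intros Ha Hb H.
  assert (HS : forall n, (Cmod (@sum_n C_AbelianMonoid a n) <= sum_n b n)%R).
  { induction n as [|n IH].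
    - rewrite !sum_O. apply H.
    - rewrite !sum_Sn. eapply Rle_trans; [apply Cmod_triangle|].
      apply Rplus_le_compat; [exact IH|apply H]. }
  assert (L : is_lim_seq (fun n => Cmod (@sum_n C_AbelianMonoid a n)) (Cmod v)).
  { change (Cmod v) with (@norm C_AbsRing C_NormedModule v).
    apply (is_lim_seq_ext (fun n => @norm C_AbsRing C_NormedModule (@sum_n C_AbelianMonoid a n)));
      [reflexivity|].
    eapply (filterlim_comp nat C_NormedModule); [exact Ha|].
    apply (filterlim_norm (V := C_NormedModule)). }
  exact (is_lim_seq_le _ _ (Cmod v) B HS L Hb).
Qed.

(** Only local statements are needed, so the radius of convergence is replaced by an
    explicit geometric bound, which is stable under differentiation of the series. *)
Definition geom_bounded (K M : R) (c : nat -> C) : Prop :=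
  forall k, (Cmod (c k) <= K * M ^ k)%R.

Lemma geom_bounded_pos (K M : R) (c : nat -> C) : geom_bounded K M c -> (0 <= K)%R.
Proof.
  intros H. specialize (H 0%nat). simpl in H. pose proof (Cmod_ge_0 (c 0%nat)). lra.
Qed.

(** The sum as a total function of [z]; [iota] picks the unique limit where there is one. *)
Definition Cpsum (c : nat -> C) (z : C) : C :=
  @iota (CompleteNormedModule.CompleteSpace C_AbsRing C_CompleteNormedModule)
    (fun v : C => is_Cseries (fun k => c k * z ^ k) v).

Lemma Cpsum_unique (c : nat -> C) (z v : C) :
  is_Cseries (fun k => c k * z ^ k) v -> Cpsum c z = v.
Proof.
  intros H.
  apply (@iota_unique C_AbsRing C_CompleteNormedModule (fun v : C => is_Cseries (fun k => c k * z ^ k) v));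
    [|exact H].
  intros w Hw. eapply is_Cseries_unique; eassumption.
Qed.

Lemma Cpsum_correct (K M : R) (c : nat -> C) (z : C) :
  geom_bounded K M c -> (0 <= M)%R -> (Cmod z * M < 1)%R ->
  is_Cseries (fun k => c k * z ^ k) (Cpsum c z).
Proof.
  intros H HM Hz.
  assert (E : @ex_series C_AbsRing C_NormedModule (fun k => c k * z ^ k)).
  { apply (@ex_series_le C_AbsRing C_CompleteNormedModule _ (fun k => K * (Cmod z * M) ^ k)%R).
    - intros k.
      change (@norm C_AbsRing C_CompleteNormedModule (c k * z ^ k)) with (Cmod (c k * z ^ k)).
      rewrite Cmod_mult, Cmod_pow, Rpow_mult_distr.
      replace (K * (Cmod z ^ k * M ^ k))%R with (K * M ^ k * Cmod z ^ k)%R by ring.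
      apply Rmult_le_compat_r; [apply pow_le, Cmod_ge_0|apply H].
    - apply (ex_series_scal (V := R_NormedModule)).
      apply ex_series_geom. rewrite Rabs_pos_eq; [exact Hz|].
      apply Rmult_le_pos; [apply Cmod_ge_0|exact HM]. }
  destruct E as [v Hv]. rewrite (Cpsum_unique c z v Hv). exact Hv.
Qed.

Lemma Cpsum_0 (c : nat -> C) : Cpsum c 0 = c 0%nat.
Proof.
  apply Cpsum_unique.
  assert (HS : is_Cseries (fun k => match k with O => 0 | S j => c k * 0 ^ k end) 0).
  { apply is_Cseries_ext with (2 := is_Cseries_0). intros [|k]; [reflexivity|].
    rewrite Cpow_S. ring. }
  apply (is_series_decr_1 (V := C_NormedModule)).
  apply is_Cseries_ext with (a := fun _ => 0); [intros k; rewrite Cpow_S; ring|].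
  replace (@plus C_NormedModule (c 0%nat) (@opp C_NormedModule (c 0%nat * 0 ^ 0))) with (RtoC 0);
    [apply is_Cseries_0|].
  change (RtoC 0 = c 0%nat + - (c 0%nat * 1)). ring.
Qed.

Definition Cpderiv (c : nat -> C) (k : nat) : C := NtoC (S k) * c (S k).

Lemma NtoC_S (k : nat) : NtoC (S k) = NtoC k + 1.
Proof. unfold NtoC. now rewrite S_INR, RtoC_plus. Qed.

Lemma Cmod_NtoC (k : nat) : Cmod (NtoC k) = INR k.
Proof. unfold NtoC. rewrite Cmod_R. apply Rabs_pos_eq, pos_INR. Qed.

Lemma NtoC_S_neq_0 (k : nat) : NtoC (S k) <> 0.
Proof. apply Cmod_gt_0. rewrite Cmod_NtoC. apply lt_0_INR. lia. Qed.

Lemma INR_le_pow2 (k : nat) : (INR (S k) <= 2 ^ k)%R.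
Proof.
  induction k as [|k IH]; [simpl; lra|].
  rewrite S_INR. simpl pow. pose proof (pow_R1_Rle 2 k). lra.
Qed.

Lemma geom_bounded_Cpderiv (K M : R) (c : nat -> C) :
  (0 <= M)%R -> geom_bounded K M c -> geom_bounded (K * M) (2 * M) (Cpderiv c).
Proof.
  intros HM H k. unfold Cpderiv. rewrite Cmod_mult, Cmod_NtoC, Rpow_mult_distr.
  replace (K * M * (2 ^ k * M ^ k))%R with (2 ^ k * (K * M ^ S k))%R by (simpl; ring).
  apply Rmult_le_compat; [apply pos_INR|apply Cmod_ge_0|apply INR_le_pow2|apply H].
Qed.

(** Multiplying by [rho ^ 2] avoids the exponent [k - 2]. The induction uses
    [D (k + 1) = y * D k + k * z ^ (k - 1) * (y - z) ^ 2] for the second order remainder [D]. *)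
Lemma pow_remainder_bound (y z : C) (rho : R) (k : nat) :
  (0 < rho)%R -> (Cmod y <= rho)%R -> (Cmod z <= rho)%R ->
  (rho ^ 2 * Cmod (y ^ k - z ^ k - NtoC k * z ^ (k - 1) * (y - z))
   <= INR k ^ 2 * rho ^ k * Cmod (y - z) ^ 2)%R.
Proof.
  intros Hr Hy Hz. induction k as [|k IH].
  - replace (y ^ 0 - z ^ 0 - NtoC 0 * z ^ (0 - 1) * (y - z)) with (RtoC 0).
    + rewrite Cmod_0. simpl. lra.
    + unfold NtoC. change (INR 0) with 0%R. simpl. ring.
  - set (D := y ^ k - z ^ k - NtoC k * z ^ (k - 1) * (y - z)) in *.
    replace (y ^ S k - z ^ S k - NtoC (S k) * z ^ (S k - 1) * (y - z))
      with (y * D + NtoC k * z ^ (k - 1) * (y - z) ^ 2).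
    2:{ unfold D. rewrite NtoC_S. replace (S k - 1)%nat with k by lia.
        destruct k as [|k]; [unfold NtoC; change (INR 0) with 0%R; simpl; ring|].
        replace (S k - 1)%nat with k by lia. rewrite !Cpow_S. ring. }
    set (h := Cmod (y - z)) in *.
    assert (T : (rho ^ 2 * Cmod (NtoC k * z ^ (k - 1) * (y - z) ^ 2) <= INR k * rho ^ S k * h ^ 2)%R).
    { rewrite !Cmod_mult, !Cmod_pow, Cmod_NtoC. fold h.
      destruct k as [|k]; [simpl; lra|]. replace (S k - 1)%nat with k by lia.
      replace (INR (S k) * rho ^ S (S k) * h ^ 2)%R
        with (INR (S k) * rho ^ 2 * h ^ 2 * rho ^ k)%R by (simpl; ring).
      replace (rho ^ 2 * (INR (S k) * Cmod z ^ k * h ^ 2))%R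
        with (INR (S k) * rho ^ 2 * h ^ 2 * Cmod z ^ k)%R by ring.
      apply Rmult_le_compat_l.
      - pose proof (pos_INR (S k)). pose proof (pow2_ge_0 rho). pose proof (pow2_ge_0 h).
        apply Rmult_le_pos; [apply Rmult_le_pos|]; assumption.
      - apply pow_incr. split; [apply Cmod_ge_0|exact Hz]. }
    assert (T2 : (rho ^ 2 * Cmod (y * D) <= INR k ^ 2 * rho ^ S k * h ^ 2)%R).
    { rewrite Cmod_mult.
      replace (INR k ^ 2 * rho ^ S k * h ^ 2)%R with (rho * (INR k ^ 2 * rho ^ k * h ^ 2))%R by (simpl; ring).
      replace (rho ^ 2 * (Cmod y * Cmod D))%R with (Cmod y * (rho ^ 2 * Cmod D))%R by ring.
      apply Rmult_le_compat; [apply Cmod_ge_0| |exact Hy|exact IH].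
      apply Rmult_le_pos; [apply pow2_ge_0|apply Cmod_ge_0]. }
    eapply Rle_trans; [apply Rmult_le_compat_l; [apply pow2_ge_0|apply Cmod_triangle]|].
    rewrite S_INR.
    assert (0 <= INR k)%R by apply pos_INR.
    assert (0 <= rho ^ S k * h ^ 2)%R.
    { apply Rmult_le_pos; [apply pow_le; lra|apply pow2_ge_0]. }
    nra.
Qed.

(** The difference between the increment and its linear part is the series of the second
    order remainders of the monomials. The radius [1 / (8 M)] makes it dominated by a
    geometric series of ratio [1/2], because [k ^ 2 <= 4 ^ k]. *)
Lemma is_C_derive_Cpsum (K M : R) (c : nat -> C) (z : C) :
  (0 < M)%R -> geom_bounded K M c -> (Cmod z < / (8 * M))%R ->
  is_C_derive (Cpsum c) z (Cpsum (Cpderiv c) z).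
Proof.
  intros HM H Hz. set (rho := (/ (8 * M))%R) in *.
  assert (HK : (0 <= K)%R) by (eapply geom_bounded_pos; eassumption).
  assert (Hr : (0 < rho)%R) by (apply Rinv_0_lt_compat; lra).
  assert (HrM : (8 * M * rho = 1)%R) by (unfold rho; field; lra).
  apply is_C_derive_eps. intros e He.
  set (Q := (K * 2 / rho ^ 2)%R).
  assert (HQ : (0 <= Q)%R).
  { unfold Q. apply Rmult_le_pos; [lra|]. left. apply Rinv_0_lt_compat, pow_lt; lra. }
  exists (Rmin (rho - Cmod z) (e / (Q + 1))). split.
  { apply Rmin_glb_lt; [lra|]. apply Rdiv_lt_0_compat; lra. }
  intros y Hy.
  pose proof (Rlt_le_trans _ _ _ Hy (Rmin_l _ _)) as Y1.
  pose proof (Rlt_le_trans _ _ _ Hy (Rmin_r _ _)) as Y2.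
  assert (Yr : (Cmod y <= rho)%R).
  { pose proof (Cmod_triangle (y - z) z) as T. replace (y - z + z) with y in T by ring. lra. }
  assert (Sy : is_Cseries (fun k => c k * y ^ k) (Cpsum c y)).
  { apply Cpsum_correct with K M; [exact H|lra|]. nra. }
  assert (Sz : is_Cseries (fun k => c k * z ^ k) (Cpsum c z)).
  { apply Cpsum_correct with K M; [exact H|lra|]. nra. }
  assert (Sd : is_Cseries (fun k => NtoC k * z ^ (k - 1) * c k) (Cpsum (Cpderiv c) z)).
  { apply is_Cseries_shift.
    - apply is_Cseries_ext with (a := fun k => Cpderiv c k * z ^ k).
      + intros k. unfold Cpderiv. replace (S k - 1)%nat with k by lia. ring.
      + apply Cpsum_correct with (K * M)%R (2 * M)%R;
          [apply geom_bounded_Cpderiv; [lra|exact H]|lra|nra].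
    - unfold NtoC. change (INR 0) with 0%R. ring. }
  pose proof (is_Cseries_plus _ _ _ _ (is_Cseries_plus _ _ _ _ Sy (is_Cseries_scal (- (1)) _ _ Sz))
    (is_Cseries_scal (- (y - z)) _ _ Sd)) as HS.
  set (h := Cmod (y - z)) in *.
  assert (h0 : (0 <= h)%R) by apply Cmod_ge_0.
  assert (B : (Cmod (Cpsum c y - Cpsum c z - (y - z) * Cpsum (Cpderiv c) z) <= Q * h ^ 2)%R).
  { eapply is_Cseries_Cmod_le with (b := fun k => (K * h ^ 2 / rho ^ 2 * (/ 2) ^ k)%R).
    - eapply is_Cseries_ext with (a := fun k => c k * (y ^ k - z ^ k - NtoC k * z ^ (k - 1) * (y - z)));
        [reflexivity|].
      replace (Cpsum c y - Cpsum c z - (y - z) * Cpsum (Cpderiv c) z)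
        with (Cpsum c y + - (1) * Cpsum c z + - (y - z) * Cpsum (Cpderiv c) z) by ring.
      eapply is_Cseries_ext with (2 := HS). intros k. cbv beta. ring.
    - replace (Q * h ^ 2)%R with (K * h ^ 2 / rho ^ 2 * / (1 - / 2))%R by (unfold Q; field; lra).
      apply (is_series_scal (V := R_NormedModule) (K * h ^ 2 / rho ^ 2)%R (fun k => (/ 2) ^ k)%R).
      apply is_series_geom. rewrite Rabs_pos_eq; lra.
    - intros k. cbv beta; rewrite Cmod_mult.
      pose proof (pow_remainder_bound y z rho k Hr Yr (Rlt_le _ _ Hz)) as P. fold h in P.
      set (D := Cmod (y ^ k - z ^ k - NtoC k * z ^ (k - 1) * (y - z))) in *.
      assert (r2 : (0 < rho ^ 2)%R) by (apply pow_lt; exact Hr).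
      replace (K * h ^ 2 / rho ^ 2 * (/ 2) ^ k)%R with (K * h ^ 2 * (/ 2) ^ k / rho ^ 2)%R by (field; lra).
      apply (proj1 (Rle_div_r _ _ _ r2)).
      apply Rle_trans with (K * M ^ k * (INR k ^ 2 * rho ^ k * h ^ 2))%R.
      + replace (Cmod (c k) * D * rho ^ 2)%R with (Cmod (c k) * (rho ^ 2 * D))%R by ring.
        apply Rmult_le_compat; [apply Cmod_ge_0| |apply H|exact P].
        apply Rmult_le_pos; [lra|apply Cmod_ge_0].
      + replace (K * M ^ k * (INR k ^ 2 * rho ^ k * h ^ 2))%R
          with (K * h ^ 2 * (INR k ^ 2 * (M ^ k * rho ^ k)))%R by ring.
        apply Rmult_le_compat_l; [apply Rmult_le_pos; [exact HK|apply pow2_ge_0]|].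
        rewrite <- Rpow_mult_distr.
        replace (/ 2)%R with (4 * (M * rho))%R by lra.
        rewrite (Rpow_mult_distr 4). apply Rmult_le_compat_r; [apply pow_le; nra|].
        replace 4%R with (2 ^ 2)%R by ring. rewrite <- pow_mult, Nat.mul_comm, pow_mult.
        apply pow_incr. split; [apply pos_INR|].
        apply Rle_trans with (INR (S k)); [apply le_INR; lia|apply INR_le_pow2]. }
  eapply Rle_trans; [exact B|].
  apply Rlt_div_r in Y2; [|lra]. simpl. nra.
Qed.

(** * The local solution given by the hypergeometric series *)

(** The factor [C0 + k] grows like [k] and, by assumption, never vanishes; this is what
    bounds the quotients of consecutive hypergeometric coefficients. *)
Lemma Cmod_shift_lower_bound (C0 : C) :
  hyp2F1_defined C0 ->
  exists d : R, (0 < d)%R /\ forall k, (d * INR (S k) <= Cmod (C0 + NtoC k))%R.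
Proof.
  intros HC.
  assert (F : forall N, exists d : R, (0 < d)%R /\
    forall k, (k < N)%nat -> (d * INR (S k) <= Cmod (C0 + NtoC k))%R).
  { induction N as [|N [d [P D]]].
    - exists 1%R. split; [lra|]. intros k Hk. lia.
    - assert (N0 : (0 < Cmod (C0 + NtoC N))%R).
      { apply Cmod_gt_0. intros E. apply (HC N).
        replace C0 with (C0 + NtoC N - NtoC N) by ring. rewrite E. ring. }
      assert (s0 : (0 < INR (S N))%R) by (apply lt_0_INR; lia).
      exists (Rmin d (Cmod (C0 + NtoC N) / INR (S N))). split.
      { apply Rmin_glb_lt; [exact P|]. apply Rdiv_lt_0_compat; assumption. }
      intros k Hk. destruct (Nat.eq_dec k N) as [->|n].
      + apply Rle_trans with (Cmod (C0 + NtoC N) / INR (S N) * INR (S N))%R.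
        * apply Rmult_le_compat_r; [lra|apply Rmin_r].
        * right. field. lra.
      + apply Rle_trans with (d * INR (S k))%R; [|apply D; lia].
        apply Rmult_le_compat_r; [apply pos_INR|apply Rmin_l]. }
  destruct (nfloor_ex (2 * Cmod C0 + 1)) as [N [_ HN]]; [pose proof (Cmod_ge_0 C0); lra|].
  destruct (F (S N)) as [d [P D]].
  exists (Rmin d (/ 4)). split; [apply Rmin_glb_lt; lra|].
  intros k. destruct (Nat.le_gt_cases (S N) k) as [Hk|Hk].
  - apply Rle_trans with (/ 4 * INR (S k))%R.
    + apply Rmult_le_compat_r; [apply pos_INR|apply Rmin_r].
    + apply le_INR in Hk. rewrite S_INR in Hk |- *.
      pose proof (Cmod_triangle (C0 + NtoC k) (- C0)) as T.
      replace (C0 + NtoC k + - C0) with (NtoC k) in T by ring.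
      rewrite Cmod_opp, Cmod_NtoC in T. pose proof (Cmod_ge_0 C0). lra.
  - apply Rle_trans with (d * INR (S k))%R; [|apply D; exact Hk].
    apply Rmult_le_compat_r; [apply pos_INR|apply Rmin_l].
Qed.

Lemma poch_neq_0 (C0 : C) (k : nat) : hyp2F1_defined C0 -> poch C0 k <> 0.
Proof.
  intros H. induction k as [|k IH]; simpl; [apply C1_nz|].
  apply Cmult_neq_0; [exact IH|]. intros E. apply (H k).
  replace C0 with (C0 + NtoC k - NtoC k) by ring. rewrite E. ring.
Qed.

Lemma NtoC_fact_neq_0 (k : nat) : NtoC (fact k) <> 0.
Proof. apply Cmod_gt_0. rewrite Cmod_NtoC. apply INR_fact_lt_0. Qed.

Lemma hyp2F1_coef_S (A B C0 : C) (k : nat) :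
  hyp2F1_defined C0 ->
  NtoC (S k) * (C0 + NtoC k) * hyp2F1_coef A B C0 (S k)
  = (A + NtoC k) * (B + NtoC k) * hyp2F1_coef A B C0 k.
Proof.
  intros H. unfold hyp2F1_coef.
  pose proof (poch_neq_0 C0 k H) as P1. pose proof (poch_neq_0 C0 (S k) H) as P2.
  pose proof (NtoC_fact_neq_0 k) as P3. pose proof (NtoC_S_neq_0 k) as P4.
  assert (E : NtoC (fact (S k)) = NtoC (S k) * NtoC (fact k)).
  { unfold NtoC. change (fact (S k)) with (S k * fact k)%nat. now rewrite mult_INR, RtoC_mult. }
  rewrite E. simpl in *. 
  assert (P5 : C0 + NtoC k <> 0) by (intros Z; apply P2; rewrite Z; ring).
  field. repeat split; assumption.
Qed.

Lemma hyp2F1_coef_0 (A B C0 : C) : hyp2F1_coef A B C0 0 = 1.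
Proof. unfold hyp2F1_coef, NtoC. simpl. field. Qed.

Lemma geom_bounded_hyp2F1 (A B C0 : C) :
  hyp2F1_defined C0 -> exists M : R, (0 < M)%R /\ geom_bounded 1 M (hyp2F1_coef A B C0).
Proof.
  intros H. destruct (Cmod_shift_lower_bound C0 H) as [d [P D]].
  pose proof (Cmod_ge_0 A) as A0. pose proof (Cmod_ge_0 B) as B0.
  set (M := ((Cmod A + 1) * (Cmod B + 1) / d)%R).
  assert (HM : (0 < M)%R) by (apply Rdiv_lt_0_compat; nra).
  exists M. split; [exact HM|]. intros k. rewrite Rmult_1_l.
  induction k as [|k IH].
  - rewrite hyp2F1_coef_0, Cmod_1. simpl. lra.
  - pose proof (hyp2F1_coef_S A B C0 k H) as E. apply (f_equal Cmod) in E.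
    rewrite !Cmod_mult, Cmod_NtoC in E.
    set (u := Cmod (hyp2F1_coef A B C0 (S k))) in *.
    set (v := Cmod (hyp2F1_coef A B C0 k)) in *.
    specialize (D k). set (s := INR (S k)) in *.
    assert (s1 : (1 <= s)%R) by (unfold s; rewrite S_INR; pose proof (pos_INR k); lra).
    assert (bnd : forall X : C, (Cmod (X + NtoC k) <= (Cmod X + 1) * s)%R).
    { intros X. eapply Rle_trans; [apply Cmod_triangle|]. rewrite Cmod_NtoC.
      unfold s. rewrite S_INR. pose proof (pos_INR k). pose proof (Cmod_ge_0 X). nra. }
    pose proof (bnd A) as bA. pose proof (bnd B) as bB.
    pose proof (Cmod_ge_0 (A + NtoC k)). pose proof (Cmod_ge_0 (B + NtoC k)).
    assert (v0 : (0 <= v)%R) by apply Cmod_ge_0. assert (u0 : (0 <= u)%R) by apply Cmod_ge_0.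
    assert (L : (s * (d * s) * u <= (Cmod A + 1) * s * ((Cmod B + 1) * s) * v)%R).
    { apply Rle_trans with (s * Cmod (C0 + NtoC k) * u)%R.
      - apply Rmult_le_compat_r; [exact u0|]. apply Rmult_le_compat_l; lra.
      - rewrite E. apply Rmult_le_compat_r; [exact v0|]. apply Rmult_le_compat; assumption. }
    assert (L2 : (u <= M * v)%R).
    { apply Rmult_le_reg_l with (s * (d * s))%R; [apply Rmult_lt_0_compat; nra|].
      eapply Rle_trans; [exact L|]. right. unfold M. field. lra. }
    simpl. eapply Rle_trans; [exact L2|]. apply Rmult_le_compat_l; lra.
Qed.

Definition hyp2F1 (A B C0 : C) : C -> C := Cpsum (hyp2F1_coef A B C0).
Definition hyp2F1' (A B C0 : C) : C -> C := Cpsum (Cpderiv (hyp2F1_coef A B C0)).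
Definition hyp2F1'' (A B C0 : C) : C -> C := Cpsum (Cpderiv (Cpderiv (hyp2F1_coef A B C0))).

Lemma is_Cseries_mult_z (a : nat -> C) (z v : C) :
  is_Cseries (fun k => a (S k) * z ^ k) v -> a 0%nat = 0 ->
  is_Cseries (fun k => a k * z ^ k) (z * v).
Proof.
  intros H E. apply is_Cseries_shift; [|rewrite E; ring].
  apply is_Cseries_ext with (2 := is_Cseries_scal z _ _ H).
  intros k. rewrite Cpow_S. ring.
Qed.

(** The term-by-term differentiated series satisfies the hypergeometric equation because
    the coefficient of [z ^ k] in it is the two-term recurrence [hyp2F1_coef_S]. The series of
    the derivative is recorded as well: contiguity relations compare its coefficients. *)
Lemma hyp2F1_local (A B C0 : C) :
  hyp2F1_defined C0 ->
  exists r : R, (0 < r)%R /\ forall z, (Cmod z < r)%R ->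
    is_hyp2F1 A B C0 z (hyp2F1 A B C0 z) /\
    is_C_derive (hyp2F1 A B C0) z (hyp2F1' A B C0 z) /\
    is_C_derive (hyp2F1' A B C0) z (hyp2F1'' A B C0 z) /\
    is_Cseries (fun k => Cpderiv (hyp2F1_coef A B C0) k * z ^ k) (hyp2F1' A B C0 z) /\
    z * (1 - z) * hyp2F1'' A B C0 z + (C0 - (A + B + 1) * z) * hyp2F1' A B C0 z
      - A * B * hyp2F1 A B C0 z = 0.
Proof.
  intros HC. destruct (geom_bounded_hyp2F1 A B C0 HC) as [M [HM H]].
  set (c := hyp2F1_coef A B C0) in *.
  pose proof (geom_bounded_Cpderiv 1 M c (Rlt_le _ _ HM) H) as H1.
  pose proof (geom_bounded_Cpderiv _ (2 * M) (Cpderiv c) ltac:(lra) H1) as H2.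
  exists (/ (16 * M))%R. split; [apply Rinv_0_lt_compat; lra|]. intros z Hz.
  assert (Hz1 : (Cmod z * (16 * M) < 1)%R).
  { apply Rmult_lt_compat_r with (r := (16 * M)%R) in Hz; [|lra].
    rewrite Rinv_l in Hz; lra. }
  pose proof (Cmod_ge_0 z) as Z0.
  assert (HS0 : is_Cseries (fun k => c k * z ^ k) (Cpsum c z)).
  { eapply Cpsum_correct; [exact H|lra|nra]. }
  assert (HS1 : is_Cseries (fun k => Cpderiv c k * z ^ k) (Cpsum (Cpderiv c) z)).
  { eapply Cpsum_correct; [exact H1|lra|nra]. }
  assert (HS2 : is_Cseries (fun k => Cpderiv (Cpderiv c) k * z ^ k) (Cpsum (Cpderiv (Cpderiv c)) z)).
  { eapply Cpsum_correct; [exact H2|lra|nra]. }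
  unfold is_hyp2F1, hyp2F1, hyp2F1', hyp2F1''. fold c.
  refine (conj _ (conj _ (conj _ (conj _ _)))).
  - apply is_pseries_iff. exact HS0.
  - apply is_C_derive_Cpsum with 1%R M; [lra|exact H|].
    eapply Rlt_trans; [exact Hz|]. apply Rinv_lt_contravar; nra.
  - apply (is_C_derive_Cpsum (1 * M)%R (2 * M)%R (Cpderiv c)); [lra|exact H1|].
    replace (8 * (2 * M))%R with (16 * M)%R by ring. exact Hz.
  - exact HS1.
  - set (y := Cpsum c z) in *. set (y1 := Cpsum (Cpderiv c) z) in *.
    set (y2 := Cpsum (Cpderiv (Cpderiv c)) z) in *.
    assert (N0 : NtoC 0 = 0) by reflexivity.
    assert (T1 : is_Cseries (fun k => NtoC k * c k * z ^ k) (z * y1)).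
    { apply (is_Cseries_mult_z (fun k => NtoC k * c k)); [exact HS1|rewrite N0; ring]. }
    assert (T2 : is_Cseries (fun k => NtoC k * Cpderiv c k * z ^ k) (z * y2)).
    { apply (is_Cseries_mult_z (fun k => NtoC k * Cpderiv c k)); [exact HS2|rewrite N0; ring]. }
    assert (T3 : is_Cseries (fun k => NtoC k * (NtoC k - 1) * c k * z ^ k) (z * (z * y2))).
    { apply (is_Cseries_mult_z (fun k => NtoC k * (NtoC k - 1) * c k)); [|rewrite N0; ring].
      eapply is_Cseries_ext with (2 := T2). intros k. cbv beta. unfold Cpderiv.
      rewrite NtoC_S. ring. }
    pose proof (is_Cseries_plus _ _ _ _
      (is_Cseries_plus _ _ _ _ T2 (is_Cseries_scal (- (1)) _ _ T3))
      (is_Cseries_plus _ _ _ _ (is_Cseries_scal C0 _ _ HS1)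
        (is_Cseries_plus _ _ _ _ (is_Cseries_scal (- (A + B + 1)) _ _ T1)
          (is_Cseries_scal (- (A * B)) _ _ HS0)))) as HS.
    eapply is_Cseries_unique; [|exact is_Cseries_0].
    replace (z * (1 - z) * y2 + (C0 - (A + B + 1) * z) * y1 - A * B * y)
      with (z * y2 + - (1) * (z * (z * y2)) + (C0 * y1 + (- (A + B + 1) * (z * y1) + - (A * B) * y))) by ring.
    eapply is_Cseries_ext with (2 := HS). intros k. cbv beta. unfold Cpderiv.
    pose proof (hyp2F1_coef_S A B C0 k HC) as E. fold c in E.
    transitivity ((NtoC (S k) * (C0 + NtoC k) * c (S k) - (A + NtoC k) * (B + NtoC k) * c k) * z ^ k);
      [ring|]. rewrite E. ring.
Qed.

Lemma hyp2F1_at_0 (A B C0 : C) : hyp2F1 A B C0 0 = 1.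
Proof. unfold hyp2F1. rewrite Cpsum_0. apply hyp2F1_coef_0. Qed.

(** * The polynomials theta1 and theta2 *)

(** [sum_n] with result type [C] rather than the carrier of a structure, so that [ring]
    recognizes equations between such sums. *)
Definition Csum (f : nat -> C) (n : nat) : C := sum_n f n.

Lemma Csum_O (f : nat -> C) : Csum f 0 = f 0%nat.
Proof. apply (sum_O f). Qed.

Lemma Csum_S (f : nat -> C) (n : nat) :
  Csum f (S n) = Csum f n + f (S n).
Proof. apply (sum_Sn f). Qed.

Lemma binomial_n_n (n : nat) : Binomial.C n n = 1%R.
Proof.
  unfold Binomial.C. rewrite Nat.sub_diag. simpl (INR (fact 0)). field. apply INR_fact_neq_0.
Qed.

Ltac fold_Csum :=
  repeat match goal with |- context [@sum_n ?G ?f ?n] => change (@sum_n G f n) with (Csum f n) end.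

Lemma Cbinomial (s : C) (n : nat) :
  (1 + s) ^ n = Csum (fun i => RtoC (Binomial.C n i) * s ^ i) n.
Proof.
  induction n as [|n IH].
  - rewrite Csum_O, binomial_n_n. simpl. ring.
  - rewrite Cpow_S, IH. clear IH.
    assert (H : forall m, (m <= n)%nat ->
      Csum (fun i => RtoC (Binomial.C (S n) i) * s ^ i) m
      = (1 + s) * Csum (fun i => RtoC (Binomial.C n i) * s ^ i) m
        - RtoC (Binomial.C n m) * s ^ S m).
    { induction m as [|m IH]; intros Hm.
      - rewrite !Csum_O.
        assert (E : forall k, Binomial.C k 0 = 1%R).
        { intros k. rewrite Binomial.pascal_step1 by lia. rewrite Nat.sub_0_r. apply binomial_n_n. }
        rewrite !E. simpl. ring.
      - rewrite !Csum_S, IH by lia.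
        rewrite <- (Binomial.pascal n m) by lia.
        rewrite RtoC_plus, !Cpow_S. ring. }
    rewrite Csum_S, H by lia. rewrite !binomial_n_n. ring.
Qed.

Lemma Csum_even_odd (f : nat -> C) (n : nat) : (0 < n)%nat ->
  Csum f n
  = Csum (fun j => f (2 * j)%nat) (n / 2)
    + Csum (fun j => f (2 * j + 1)%nat) ((n - 1) / 2).
Proof.
  intros Hn.
  assert (H : forall m,
    Csum f (2 * m + 1)
    = Csum (fun j => f (2 * j)%nat) m
      + Csum (fun j => f (2 * j + 1)%nat) m).
  { induction m as [|m IH].
    - simpl. rewrite Csum_S, !Csum_O. reflexivity.
    - replace (2 * S m + 1)%nat with (S (S (2 * m + 1))) by lia.
      rewrite !Csum_S, IH.
      replace (S (2 * m + 1)) with (2 * S m)%nat by lia.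
      replace (S (2 * S m)) with (2 * S m + 1)%nat by lia. ring. }
  destruct (Nat.Even_or_Odd n) as [[m E]|[m E]]; subst n.
  - destruct m as [|m]; [lia|].
    replace (2 * S m / 2)%nat with (S m) by (rewrite Nat.mul_comm, Nat.div_mul; lia).
    replace (2 * S m - 1)%nat with (m * 2 + 1)%nat by lia.
    rewrite Nat.div_add_l by lia. replace (1 / 2)%nat with 0%nat by reflexivity.
    rewrite Nat.add_0_r.
    replace (2 * S m)%nat with (S (2 * m + 1)) at 1 by lia.
    rewrite !Csum_S, H. replace (S (2 * m + 1)) with (2 * S m)%nat by lia. ring.
  - replace (2 * m + 1 - 1)%nat with (m * 2)%nat by lia.
    rewrite Nat.div_mul by lia.
    replace ((2 * m + 1) / 2)%nat with m; [apply H|].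
    rewrite (Nat.mul_comm 2 m), Nat.div_add_l by lia. rewrite Nat.div_small; lia.
Qed.

Lemma Csum_mult_l (c : C) (f : nat -> C) (n : nat) :
  c * Csum f n = Csum (fun i => c * f i) n.
Proof.
  induction n as [|n IH]; [now rewrite !Csum_O|]. rewrite !Csum_S, <- IH. ring.
Qed.

Lemma Csum_ext (f g : nat -> C) (n : nat) :
  (forall i, (i <= n)%nat -> f i = g i) -> Csum f n = Csum g n.
Proof. intros H. apply (sum_n_ext_loc f g n). exact H. Qed.

(** The polynomials [theta1] and [theta2] collect the even and the odd powers in the
    binomial expansion of [(1 + s) ^ n]. *)
Lemma theta_plus (n : nat) (s : C) : (0 < n)%nat ->
  theta1 n (s ^ 2) + s * theta2 n (s ^ 2) = (1 + s) ^ n.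
Proof.
  intros Hn. rewrite Cbinomial, Csum_even_odd by exact Hn.
  unfold theta1, theta2; fold_Csum; rewrite Csum_mult_l. f_equal; apply Csum_ext; intros j _.
  - now rewrite <- Cpow_mult_r.
  - rewrite <- Cpow_mult_r, Cpow_add_r, Cpow_1_r. ring.
Qed.

Lemma theta_minus (n : nat) (s : C) : (0 < n)%nat ->
  theta1 n (s ^ 2) - s * theta2 n (s ^ 2) = (1 - s) ^ n.
Proof.
  intros Hn. pose proof (theta_plus n (- s) Hn) as H.
  replace ((- s) ^ 2) with (s ^ 2) in H by ring.
  replace (1 + - s) with (1 - s) in H by ring. rewrite <- H. ring.
Qed.

(** With [x = s ^ 2] the right-hand side factors as [(1 - s) ^ n * (1 + s) ^ n]. *)
Lemma theta_norm (n : nat) (x : C) : (0 < n)%nat ->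
  (1 - x) ^ n = theta1 n x ^ 2 - x * theta2 n x ^ 2.
Proof.
  intros Hn. destruct (C_sqrt_exists x) as [s <-].
  pose proof (theta_plus n s Hn) as P. pose proof (theta_minus n s Hn) as M.
  replace (1 - s ^ 2) with ((1 - s) * (1 + s)) by ring.
  rewrite Cpow_mult_l, <- P, <- M. ring.
Qed.

Lemma theta_at_1 (n : nat) : (0 < n)%nat ->
  theta1 n 1 = 2 ^ (n - 1) /\ theta2 n 1 = 2 ^ (n - 1).
Proof.
  intros Hn. pose proof (theta_plus n 1 Hn) as P. pose proof (theta_minus n 1 Hn) as M.
  replace (1 ^ 2) with (RtoC 1) in * by ring.
  replace (1 + 1) with (RtoC 2) in P by ring.
  destruct n as [|m]; [lia|]. replace (S m - 1)%nat with m by lia.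
  replace (1 - 1) with (RtoC 0) in M by ring.
  rewrite Cpow_S in P. rewrite Cpow_S, Cmult_0_l in M.
  set (u := theta1 (S m) 1) in *. set (v := theta2 (S m) 1) in *.
  assert (E : u = v) by (replace u with (u - 1 * v + v) by ring; rewrite M; ring).
  assert (F : v = 2 ^ m).
  { replace v with ((u + 1 * v) / 2) by (rewrite E; field). rewrite P. field. }
  split; congruence.
Qed.

Lemma theta_at_0 (n : nat) : (0 < n)%nat -> theta1 n 0 = 1 /\ theta2 n 0 = NtoC n.
Proof.
  intros Hn.
  assert (H : forall (b : nat -> C) d, polyval b d 0 = b 0%nat).
  { intros b d. unfold polyval; fold_Csum. induction d as [|d IH].
    - rewrite Csum_O. simpl. ring.
    - rewrite Csum_S, IH, Cpow_S. ring. }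
  split.
  - change (theta1 n 0) with (polyval (fun j => RtoC (Binomial.C n (2 * j))) (n / 2) 0).
    rewrite H. rewrite Binomial.pascal_step1 by lia. simpl. rewrite Nat.sub_0_r.
    now rewrite binomial_n_n.
  - change (theta2 n 0) with (polyval (fun j => RtoC (Binomial.C n (2 * j + 1))) ((n - 1) / 2) 0).
    rewrite H. unfold NtoC. f_equal. simpl. unfold Binomial.C.
    destruct n as [|m]; [lia|]. replace (S m - 1)%nat with m by lia.
    change (fact (S m)) with (S m * fact m)%nat. rewrite mult_INR. simpl (INR (fact 1)).
    field. apply INR_fact_neq_0.
Qed.

(** * Degrees *)

(** Polynomial functions with a degree bound [d] and a marked coefficient [l] of [x ^ d].
    The marked coefficient may vanish, so no uniqueness of coefficients has to be proved. *)
Definition poly_top (p : C -> C) (d : nat) (l : C) : Prop :=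
  exists b : nat -> C, b d = l /\ forall x, p x = polyval b d x.

Lemma polyval_S (b : nat -> C) (d : nat) (x : C) :
  polyval b (S d) x = polyval b d x + b (S d) * x ^ S d.
Proof. apply Csum_S. Qed.

Lemma polyval_horner (b : nat -> C) (d : nat) (x : C) :
  polyval b (S d) x = b 0%nat + x * polyval (fun i => b (S i)) d x.
Proof.
  induction d as [|d IH].
  - rewrite polyval_S. unfold polyval; fold_Csum. rewrite !Csum_O. simpl. ring.
  - rewrite polyval_S, IH, polyval_S, !Cpow_S. ring.
Qed.

Lemma poly_top_ext (p q : C -> C) (d : nat) (l m : C) :
  (forall x, p x = q x) -> l = m -> poly_top p d l -> poly_top q d m.
Proof. intros E <- [b [H1 H2]]. exists b. split; [exact H1|]. intros x. now rewrite <- E. Qed.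

Lemma poly_top_pad_S (p : C -> C) (d : nat) (l : C) : poly_top p d l -> poly_top p (S d) 0.
Proof.
  intros [b [_ H]]. exists (fun i => if (i <=? d)%nat then b i else 0). split.
  - destruct (Nat.leb_spec (S d) d); [lia|reflexivity].
  - intros x. rewrite polyval_S, H.
    destruct (Nat.leb_spec (S d) d); [lia|].
    transitivity (polyval (fun i => if (i <=? d)%nat then b i else 0) d x); [|ring].
    apply Csum_ext. intros i Hi. destruct (Nat.leb_spec i d); [reflexivity|lia].
Qed.

Lemma poly_top_plus (p q : C -> C) (d : nat) (l m : C) :
  poly_top p d l -> poly_top q d m -> poly_top (fun x => p x + q x) d (l + m).
Proof.
  intros [b [B1 B2]] [c [C1 C2]]. exists (fun i => b i + c i). split; [now rewrite B1, C1|].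
  intros x. rewrite B2, C2. unfold polyval; fold_Csum. clear.
  induction d as [|d IH]; [rewrite !Csum_O; ring|]. rewrite !Csum_S, <- IH. ring.
Qed.

Lemma poly_top_scal (k : C) (p : C -> C) (d : nat) (l : C) :
  poly_top p d l -> poly_top (fun x => k * p x) d (k * l).
Proof.
  intros [b [B1 B2]]. exists (fun i => k * b i). split; [now rewrite B1|].
  intros x. rewrite B2. unfold polyval; fold_Csum. rewrite Csum_mult_l. apply Csum_ext. intros. ring.
Qed.

Lemma poly_top_mult_X (p : C -> C) (d : nat) (l : C) :
  poly_top p d l -> poly_top (fun x => x * p x) (S d) l.
Proof.
  intros [b [B1 B2]]. exists (fun i => match i with O => RtoC 0 | S j => b j end).
  split; [exact B1|]. intros x. rewrite polyval_horner, B2. symmetry. apply Cplus_0_l.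
Qed.

Lemma poly_top_pad (p : C -> C) (d k : nat) (l : C) : poly_top p d l -> poly_top p (S k + d) 0.
Proof.
  intros H. induction k as [|k IH]; [exact (poly_top_pad_S p d l H)|].
  exact (poly_top_pad_S p (S k + d) 0 IH).
Qed.

Lemma poly_top_mult (p q : C -> C) (d e : nat) (l m : C) :
  poly_top p d l -> poly_top q e m -> poly_top (fun x => p x * q x) (d + e) (l * m).
Proof.
  intros Hp Hq. revert p l Hp. induction d as [|d IH]; intros p l [b [B1 B2]].
  - apply poly_top_ext with (p := fun x => l * q x) (l := l * m); [|reflexivity|].
    + intros x. rewrite B2. unfold polyval; fold_Csum. rewrite Csum_O, B1. simpl. ring.
    + apply poly_top_scal. exact Hq.
  - apply poly_top_ext
      with (p := fun x => b 0%nat * q x + x * (polyval (fun i => b (S i)) d x * q x)) (l := 0 + l * m).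
    + intros x. rewrite B2, polyval_horner. ring.
    + ring.
    + apply poly_top_plus.
      * apply (poly_top_pad _ e d (b 0%nat * m)). apply poly_top_scal. exact Hq.
      * apply poly_top_mult_X. apply IH. exists (fun i => b (S i)). split; [exact B1|reflexivity].
Qed.

Lemma poly_top_is_poly (p : C -> C) (d : nat) (l : C) : poly_top p d l -> is_poly p.
Proof. intros [b [_ H]]. exists b, d. exact H. Qed.

Lemma poly_top_theta1 (n : nat) : poly_top (theta1 n) (n / 2) (RtoC (Binomial.C n (2 * (n / 2)))).
Proof. exists (fun j => RtoC (Binomial.C n (2 * j))). split; reflexivity. Qed.

Lemma poly_top_theta2 (n : nat) :
  poly_top (theta2 n) ((n - 1) / 2) (RtoC (Binomial.C n (2 * ((n - 1) / 2) + 1))).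
Proof. exists (fun j => RtoC (Binomial.C n (2 * j + 1))). split; reflexivity. Qed.

Lemma poly_top_den (n : nat) :
  poly_top (fun x => theta1 n x ^ 2) (n / 2 + n / 2) (RtoC (Binomial.C n (2 * (n / 2))) ^ 2).
Proof.
  eapply poly_top_ext with (p := fun x => theta1 n x * theta1 n x);
    [intros; ring| |apply poly_top_mult; apply poly_top_theta1]. ring.
Qed.

Lemma poly_top_num (n : nat) :
  poly_top (fun x => x * theta2 n x ^ 2) (S ((n - 1) / 2 + (n - 1) / 2))
    (RtoC (Binomial.C n (2 * ((n - 1) / 2) + 1)) ^ 2).
Proof.
  apply poly_top_mult_X.
  eapply poly_top_ext with (p := fun x => theta2 n x * theta2 n x);
    [intros; ring| |apply poly_top_mult; apply poly_top_theta2]. ring.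
Qed.

(** The parity of [n] decides which of numerator and denominator has degree [n]. They have
    no common zero: by [theta_norm] it would be at [x = 1], where [theta1] is a power of 2. *)
Lemma phi_degree (n : nat) : (0 < n)%nat ->
  ratfun_degree (fun x => x * theta2 n x ^ 2) (fun x => theta1 n x ^ 2) n.
Proof.
  intros Hn. split; [|split].
  - pose proof (poly_top_den n) as D. pose proof (poly_top_num n) as N.
    destruct (Nat.Even_or_Odd n) as [[m E]|[m E]].
    + assert (E1 : (n / 2)%nat = m) by (subst n; rewrite Nat.mul_comm, Nat.div_mul; lia).
      destruct m as [|m]; [lia|].
      assert (E2 : ((n - 1) / 2)%nat = m).
      { subst n. replace (2 * S m - 1)%nat with (m * 2 + 1)%nat by lia.
        rewrite Nat.div_add_l by lia. rewrite Nat.add_0_r. reflexivity. }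
      rewrite E1 in D. rewrite E2 in N.
      replace (2 * S m)%nat with n in D by lia. replace (S m + S m)%nat with n in D by lia.
      apply poly_top_pad_S in N. replace (S (S (m + m))) with n in N by lia.
      destruct D as [c [C1 C2]], N as [b [_ B2]]. exists b, c.
      split; [|split; assumption]. right. rewrite C1, binomial_n_n.
      apply Cpow_nz, C1_nz.
    + assert (E1 : (n / 2)%nat = m).
      { subst n. rewrite (Nat.mul_comm 2 m), Nat.div_add_l by lia. rewrite Nat.div_small; lia. }
      assert (E2 : ((n - 1) / 2)%nat = m).
      { subst n. replace (2 * m + 1 - 1)%nat with (m * 2)%nat by lia. apply Nat.div_mul. lia. }
      rewrite E1 in D. rewrite E2 in N.
      replace (2 * m + 1)%nat with n in N by lia. replace (S (m + m)) with n in N by lia.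
      apply poly_top_pad_S in D. replace (S (m + m)) with n in D by lia.
      destruct D as [c [_ C2]], N as [b [B1 B2]]. exists b, c.
      split; [|split; assumption]. left. rewrite B1, binomial_n_n.
      apply Cpow_nz, C1_nz.
  - exists 0. rewrite (proj1 (theta_at_0 n Hn)). apply Cpow_nz, C1_nz.
  - intros x [H1 H2]. pose proof (theta_norm n x Hn) as E. rewrite H1, H2 in E.
    assert (X : x = 1).
    { destruct (classic (1 - x = 0)) as [Z|Z].
      - replace x with (1 - (1 - x)) by ring. rewrite Z. ring.
      - exfalso. apply (Cpow_nz _ n Z). rewrite E. ring. }
    subst x. rewrite (proj1 (theta_at_1 n Hn)) in H2. revert H2.
    apply Cpow_nz, Cpow_nz. intros Z. apply RtoC_inj in Z. lra.
Qed.

Lemma C_continuous_poly (p : C -> C) (x : C) : is_poly p -> C_continuous p x.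
Proof.
  intros [b [d H]].
  apply C_continuous_ext_loc with (f := polyval b d) (d := 1%R); [lra|now intros; rewrite H|].
  clear H p. revert b. induction d as [|d IH]; intros b.
  - apply C_continuous_ext_loc with (f := fun _ => b 0%nat) (d := 1%R);
      [lra| |apply C_continuous_const].
    intros y _. unfold polyval; fold_Csum. rewrite Csum_O. simpl. ring.
  - apply C_continuous_ext_loc
      with (f := fun y => b 0%nat + y * polyval (fun i => b (S i)) d y) (d := 1%R);
      [lra|intros y _; symmetry; apply polyval_horner|].
    apply C_continuous_plus; [apply C_continuous_const|].
    apply C_continuous_mult; [apply C_continuous_id|apply IH].
Qed.

Lemma C_continuous_theta1 (n : nat) (x : C) : C_continuous (theta1 n) x.
Proof. exact (C_continuous_poly _ x (poly_top_is_poly _ _ _ (poly_top_theta1 n))). Qed.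

(** * Hyperbolic functions *)

Definition Ccosh (t : C) : C := (Cexp t + Cexp (- t)) / 2.
Definition Csinh (t : C) : C := (Cexp t - Cexp (- t)) / 2.
Definition Ctanh (t : C) : C := Csinh t / Ccosh t.

Lemma is_C_derive_Cexp_opp (t : C) : is_C_derive (fun t => Cexp (- t)) t (- Cexp (- t)).
Proof.
  eapply is_C_derive_eq; [apply is_C_derive_Cexp_comp; derive_C|]. ring.
Qed.

Lemma is_C_derive_Ccosh (t : C) : is_C_derive Ccosh t (Csinh t).
Proof.
  unfold Ccosh. eapply is_C_derive_eq.
  - pose proof (is_C_derive_Cexp t). pose proof (is_C_derive_Cexp_opp t). derive_C.
    intros E. apply RtoC_inj in E. lra.
  - unfold Csinh. cbv beta. field.
Qed.

Lemma is_C_derive_Csinh (t : C) : is_C_derive Csinh t (Ccosh t).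
Proof.
  unfold Csinh. eapply is_C_derive_eq.
  - pose proof (is_C_derive_Cexp t). pose proof (is_C_derive_Cexp_opp t). derive_C.
    intros E. apply RtoC_inj in E. lra.
  - unfold Ccosh. cbv beta. field.
Qed.

Lemma Ccosh_sinh (t : C) : Ccosh t ^ 2 - Csinh t ^ 2 = 1.
Proof.
  unfold Ccosh, Csinh. rewrite Cexp_opp. pose proof (Cexp_neq_0 t). field. exact H.
Qed.

Lemma Ccosh_0 : Ccosh 0 = 1.
Proof. unfold Ccosh. replace (- 0) with (RtoC 0) by ring. rewrite Cexp_0. field. Qed.

Lemma Csinh_0 : Csinh 0 = 0.
Proof. unfold Csinh. replace (- 0) with (RtoC 0) by ring. rewrite Cexp_0. field. Qed.

Lemma Ctanh_0 : Ctanh 0 = 0.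
Proof. unfold Ctanh. rewrite Csinh_0, Ccosh_0. field. Qed.

Lemma is_C_derive_Ctanh (t : C) : Ccosh t <> 0 -> is_C_derive Ctanh t (1 - Ctanh t ^ 2).
Proof.
  intros N. unfold Ctanh. eapply is_C_derive_eq.
  - pose proof (is_C_derive_Ccosh t). pose proof (is_C_derive_Csinh t). 
    apply is_C_derive_div; [eassumption|eassumption|exact N].
  - field. exact N.
Qed.

(** For [s = tanh t] one has [1 + s = exp t / cosh t] and [1 - s = exp (- t) / cosh t]; taking
    [n]-th powers replaces [t] by [n * t]. *)
Lemma theta_Ctanh (n : nat) (t : C) : (0 < n)%nat -> Ccosh t <> 0 ->
  theta1 n (Ctanh t ^ 2) = Ccosh (NtoC n * t) / Ccosh t ^ n /\
  Ctanh t * theta2 n (Ctanh t ^ 2) = Csinh (NtoC n * t) / Ccosh t ^ n.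
Proof.
  intros Hn N.
  pose proof (theta_plus n (Ctanh t) Hn) as P. pose proof (theta_minus n (Ctanh t) Hn) as M.
  assert (Nn : Ccosh t ^ n <> 0) by (apply Cpow_nz; exact N).
  assert (P' : 1 + Ctanh t = Cexp t / Ccosh t).
  { unfold Ctanh. replace (Cexp t) with (Ccosh t + Csinh t); [field; exact N|].
    unfold Ccosh, Csinh. field. }
  assert (M' : 1 - Ctanh t = Cexp (- t) / Ccosh t).
  { unfold Ctanh. replace (Cexp (- t)) with (Ccosh t - Csinh t); [field; exact N|].
    unfold Ccosh, Csinh. field. }
  assert (D : forall z, (z / Ccosh t) ^ n = z ^ n / Ccosh t ^ n).
  { intros z. unfold Cdiv. now rewrite Cpow_mult_l, Cpow_inv by exact N. }
  rewrite P', D, <- Cexp_NtoC_mult in P. rewrite M', D, <- Cexp_NtoC_mult in M.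
  replace (NtoC n * - t) with (- (NtoC n * t)) in M by ring.
  set (u := theta1 n (Ctanh t ^ 2)) in *. set (v := Ctanh t * theta2 n (Ctanh t ^ 2)) in *.
  unfold Ccosh at 1, Csinh. split.
  - transitivity (((u + v) + (u - v)) / 2); [field|]. rewrite P, M. field. exact Nn.
  - transitivity (((u + v) - (u - v)) / 2); [field|]. rewrite P, M. field. exact Nn.
Qed.

Lemma C_continuous_near_0 (f : C -> C) (e : R) :
  C_continuous f 0 -> (0 < e)%R ->
  exists d : R, (0 < d)%R /\ forall t, (Cmod t < d)%R -> (Cmod (f t - f 0) < e)%R.
Proof.
  intros H He. destruct (proj1 (C_continuous_eps f 0) H e He) as [d [P D]].
  exists d. split; [exact P|]. intros t Ht. apply D. now replace (t - 0) with t by ring.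
Qed.

Lemma Re_pos_near_1 (w : C) : (Cmod (w - 1) < 1)%R -> (0 < Re w)%R.
Proof.
  intros H. pose proof (re_le_Cmod (w - 1)) as R1. destruct w as [x y]. simpl in *.
  pose proof (Rle_abs (- (x + - (1)))). rewrite Rabs_Ropp in *. lra.
Qed.

Lemma Re_pos_neq_0 (w : C) : (0 < Re w)%R -> w <> 0.
Proof. intros H ->. simpl in H. lra. Qed.

Lemma Ccosh_near_0 : exists d : R, (0 < d)%R /\ forall t, (Cmod t < d)%R -> (0 < Re (Ccosh t))%R.
Proof.
  destruct (C_continuous_near_0 Ccosh 1) as [d [P D]];
    [exact (is_C_derive_continuous _ _ _ (is_C_derive_Ccosh 0))|lra|].
  exists d. split; [exact P|]. intros t Ht. apply Re_pos_near_1.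
  rewrite <- Ccosh_0. apply D, Ht.
Qed.

Lemma Ctanh_near_0 (r : R) : (0 < r)%R ->
  exists d : R, (0 < d)%R /\ forall t, (Cmod t < d)%R ->
    (0 < Re (Ccosh t))%R /\ (Cmod (Ctanh t ^ 2) < r)%R.
Proof.
  intros Hr. destruct Ccosh_near_0 as [d1 [P1 D1]].
  assert (N0 : Ccosh 0 <> 0) by (rewrite Ccosh_0; apply C1_nz).
  destruct (C_continuous_near_0 (fun t => Ctanh t * Ctanh t) r) as [d2 [P2 D2]]; [|exact Hr|].
  { apply C_continuous_mult; exact (is_C_derive_continuous _ _ _ (is_C_derive_Ctanh 0 N0)). }
  exists (Rmin d1 d2). split; [apply Rmin_glb_lt; assumption|]. intros t Ht. split.
  - apply D1. eapply Rlt_le_trans; [exact Ht|apply Rmin_l].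
  - specialize (D2 t (Rlt_le_trans _ _ _ Ht (Rmin_r _ _))).
    rewrite Ctanh_0 in D2. replace (Ctanh t ^ 2) with (Ctanh t * Ctanh t - 0 * 0) by ring. exact D2.
Qed.

(** Take [s] with [s ^ 2 = x] and [t = log ((1 + s) / (1 - s)) / 2]. *)
Lemma Ctanh_sqr_surjective (d : R) : (0 < d)%R ->
  exists r : R, (0 < r)%R /\ forall x, (Cmod x < r)%R ->
    exists t, (Cmod t < d)%R /\ Ccosh t <> 0 /\ x = Ctanh t ^ 2.
Proof.
  intros Hd.
  set (g := fun s => (1 + s) * / (1 + - (1) * s)).
  assert (g0 : g 0 = 1) by (unfold g; field).
  assert (gc : C_continuous g 0).
  { unfold g. apply C_continuous_mult.
    - apply C_continuous_plus; [apply C_continuous_const|apply C_continuous_id].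
    - apply (C_continuous_inv (fun s => 1 + - (1) * s)).
      + apply C_continuous_plus; [apply C_continuous_const|].
        apply C_continuous_mult; [apply C_continuous_const|apply C_continuous_id].
      + replace (1 + - (1) * 0) with (RtoC 1) by ring. apply C1_nz. }
  destruct (C_continuous_near_0 g 1 gc) as [d1 [P1 D1]]; [lra|].
  destruct (C_continuous_near_0 (fun s => Clog (g s)) (2 * d)) as [d2 [P2 D2]]; [|lra|].
  { apply C_continuous_comp; [exact gc|]. rewrite g0. apply C_continuous_Clog. simpl. lra. }
  set (e := Rmin 1 (Rmin d1 d2)).
  assert (He : (0 < e)%R) by (repeat apply Rmin_glb_lt; lra).
  assert (e1 : (e <= 1)%R) by apply Rmin_l.
  assert (e2 : (e <= d1)%R) by (eapply Rle_trans; [apply Rmin_r|apply Rmin_l]).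
  assert (e3 : (e <= d2)%R) by (eapply Rle_trans; [apply Rmin_r|apply Rmin_r]).
  exists (e ^ 2)%R. split; [apply pow_lt; exact He|]. intros x Hx.
  destruct (C_sqrt_exists x) as [s <-].
  rewrite Cmod_pow in Hx.
  assert (Hs : (Cmod s < e)%R) by (pose proof (Cmod_ge_0 s); nra).
  specialize (D1 s ltac:(lra)). specialize (D2 s ltac:(lra)).
  rewrite g0 in *. rewrite Clog_1 in D2.
  pose proof (Cexp_Clog (g s) (Re_pos_near_1 _ D1)) as E.
  set (t := Clog (g s) / 2).
  assert (T : Clog (g s) = t + t) by (unfold t; field).
  rewrite T, Cexp_plus in E.
  assert (N1 : 1 - s <> 0).
  { intros Z. replace s with (1 - (1 - s)) in Hs by ring. rewrite Z in Hs.
    replace (1 - 0) with (RtoC 1) in Hs by ring. rewrite Cmod_1 in Hs. lra. }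
  assert (N2 : 1 + - (1) * s <> 0) by (replace (1 + - (1) * s) with (1 - s) by ring; exact N1).
  pose proof (Cexp_neq_0 t) as Nt.
  assert (T2 : RtoC 2 <> 0) by (intros Z; apply RtoC_inj in Z; lra).
  assert (Ec : Ccosh t = / (Cexp t * (1 - s))).
  { unfold Ccosh. rewrite Cexp_opp.
    transitivity ((Cexp t * Cexp t + 1) / (2 * Cexp t)); [field; auto|].
    rewrite E. unfold g. field. auto. }
  assert (Es : Csinh t = s / (Cexp t * (1 - s))).
  { unfold Csinh. rewrite Cexp_opp.
    transitivity ((Cexp t * Cexp t - 1) / (2 * Cexp t)); [field; auto|].
    rewrite E. unfold g. field. auto. }
  exists t. split; [|split].
  - unfold t. rewrite Cmod_div by exact T2.
    replace (Clog (g s)) with (Clog (g s) - 0) by ring.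
    replace (Cmod 2) with 2%R by (rewrite Cmod_R, Rabs_pos_eq; lra). lra.
  - rewrite Ec. intros Z. apply (Cmult_neq_0 _ _ Nt N1).
    transitivity (/ / (Cexp t * (1 - s))); [field; auto|]. rewrite Z.
    replace (/ 0) with (RtoC 0); [reflexivity|]. apply injective_projections; simpl; unfold Rdiv; ring.
  - unfold Ctanh. rewrite Ec, Es. field. auto.
Qed.

(** * The equation satisfied by cosh (a t) and sinh (a t) *)

Definition osc_solution (a : C) (d : R) (U U1 : C -> C) : Prop :=
  forall t, (Cmod t < d)%R -> is_C_derive U t (U1 t) /\ is_C_derive U1 t (a ^ 2 * U t).

(** The equation factors as [(d/dt - a) (d/dt + a)], so two first order equations are
    solved in turn with the integrating factors [exp (a t)] and [exp (- a t)]. This form also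
    covers [a = 0]. *)
Lemma osc_unique (a : C) (d : R) (U U1 : C -> C) :
  osc_solution a d U U1 -> U 0 = 0 -> U1 0 = 0 -> forall t, (Cmod t < d)%R -> U t = 0.
Proof.
  intros H E0 E1.
  assert (De : forall c t, is_C_derive (fun t => Cexp (c * t)) t (c * Cexp (c * t))).
  { intros c t. eapply is_C_derive_eq; [apply is_C_derive_Cexp_comp; derive_C|]. cbv beta. ring. }
  assert (Z : forall c t, Cexp (c * t) <> 0) by (intros; apply Cexp_neq_0).
  assert (H1 : forall t, (Cmod t < d)%R -> U1 t = a * U t).
  { intros t Ht.
    assert (K : (U1 t - a * U t) * Cexp (a * t) = (U1 0 - a * U 0) * Cexp (a * 0)).
    { apply (is_C_derive_zero_const (fun t => (U1 t - a * U t) * Cexp (a * t)) d); [|exact Ht].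
      intros z Hz. destruct (H z Hz) as [A B]. pose proof (De a z).
      eapply is_C_derive_eq; [derive_C|]. cbv beta. ring. }
    rewrite E0, E1 in K.
    replace (U1 t) with ((U1 t - a * U t) * Cexp (a * t) / Cexp (a * t) + a * U t) by (field; apply Z).
    rewrite K. field. apply Z. }
  intros t Ht.
  assert (K : U t * Cexp (- a * t) = U 0 * Cexp (- a * 0)).
  { apply (is_C_derive_zero_const (fun t => U t * Cexp (- a * t)) d); [|exact Ht].
    intros z Hz. destruct (H z Hz) as [A _]. rewrite (H1 z Hz) in A. pose proof (De (- a) z).
    eapply is_C_derive_eq; [derive_C|]. cbv beta. ring. }
  rewrite E0 in K.
  replace (U t) with (U t * Cexp (- a * t) / Cexp (- a * t)) by (field; apply Z).
  rewrite K. field. apply Z.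
Qed.

(** If [U] solves the equation with parameter [a], then [t -> U (n t)] solves the one with
    parameter [n a]; this is the whole content of the three identities near [x = 0]. *)
Lemma osc_dilation (n : nat) (a c : C) (d e : R) (U U1 V V1 : C -> C) :
  (0 < d)%R -> (0 < e)%R ->
  osc_solution a d U U1 -> osc_solution (NtoC n * a) e V V1 ->
  V 0 = c * U 0 -> V1 0 = c * NtoC n * U1 0 ->
  exists r : R, (0 < r)%R /\ forall t, (Cmod t < r)%R ->
    (Cmod t < e)%R /\ (Cmod (NtoC n * t) < d)%R /\ V t = c * U (NtoC n * t).
Proof.
  intros Hd He HU HV E0 E1.
  set (r := Rmin e (d / (INR n + 1))).
  pose proof (pos_INR n) as Hn.
  assert (Hr : forall t, (Cmod t < r)%R -> (Cmod t < e)%R /\ (Cmod (NtoC n * t) < d)%R).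
  { intros t Ht. split; [eapply Rlt_le_trans; [exact Ht|apply Rmin_l]|].
    rewrite Cmod_mult, Cmod_NtoC.
    assert (Ht2 : (Cmod t < d / (INR n + 1))%R) by (eapply Rlt_le_trans; [exact Ht|apply Rmin_r]).
    apply Rlt_div_r in Ht2; [|lra]. pose proof (Cmod_ge_0 t). nra. }
  exists r. split; [apply Rmin_glb_lt; [exact He|apply Rdiv_lt_0_compat; lra]|].
  intros t Ht. destruct (Hr t Ht) as [A B]. split; [exact A|]. split; [exact B|].
  assert (K : V t - c * U (NtoC n * t) = 0).
  { apply (osc_unique (NtoC n * a) r (fun t => V t - c * U (NtoC n * t))
             (fun t => V1 t - c * (NtoC n * U1 (NtoC n * t)))); [| | |exact Ht].
    - intros z Hz. destruct (Hr z Hz) as [Az Bz].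
      destruct (HV z Az) as [V' V1']. destruct (HU (NtoC n * z) Bz) as [U' U1'].
      assert (L : is_C_derive (fun z => NtoC n * z) z (NtoC n)).
      { eapply is_C_derive_eq; [derive_C|]. cbv beta. ring. }
      pose proof (is_C_derive_comp U (fun z => NtoC n * z) z _ _ L U') as U2.
      pose proof (is_C_derive_comp U1 (fun z => NtoC n * z) z _ _ L U1') as U3.
      cbv beta in U2, U3.
      split; (eapply is_C_derive_eq; [derive_C|cbv beta; ring]).
    - replace (NtoC n * 0) with (RtoC 0) by ring. rewrite E0. ring.
    - replace (NtoC n * 0) with (RtoC 0) by ring. rewrite E1. ring. }
  replace (V t) with (V t - c * U (NtoC n * t) + c * U (NtoC n * t)) by ring. rewrite K. ring.
Qed.

(** * Hypergeometric functions in the coordinate artanh (sqrt z) *)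

Lemma hyp2F1_defined_half (k : nat) : hyp2F1_defined (RtoC (INR k + / 2)).
Proof.
  intros j E. unfold NtoC in E. rewrite <- RtoC_opp in E. apply RtoC_inj in E.
  pose proof (pos_INR j). pose proof (pos_INR k). lra.
Qed.

Lemma hyp2F1_defined_1_2 : hyp2F1_defined (1 / 2).
Proof.
  replace (1 / 2) with (RtoC (INR 0 + / 2)); [apply hyp2F1_defined_half|].
  simpl. rewrite <- RtoC_div by lra. f_equal. lra.
Qed.

Lemma hyp2F1_defined_3_2 : hyp2F1_defined (3 / 2).
Proof.
  replace (3 / 2) with (RtoC (INR 1 + / 2)); [apply hyp2F1_defined_half|].
  simpl. rewrite <- RtoC_div by lra. f_equal. lra.
Qed.

(** [cosh (t) ^ (- a)]. As [1 - tanh (t) ^ 2 = cosh (t) ^ (- 2)], this is the factor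
    [(1 - z) ^ (a / 2)] that makes the exponents at [z = 1] symmetric. *)
Definition cosh_power (a t : C) : C := Cexp (- a * Clog (Ccosh t)).

Lemma cosh_power_0 (a : C) : cosh_power a 0 = 1.
Proof. unfold cosh_power. rewrite Ccosh_0, Clog_1, Cmult_0_r. apply Cexp_0. Qed.

Lemma is_C_derive_cosh_power (a t : C) (d : R) :
  (Cmod t < d)%R -> (forall t, (Cmod t < d)%R -> (0 < Re (Ccosh t))%R) ->
  is_C_derive (cosh_power a) t (- a * Ctanh t * cosh_power a t).
Proof.
  intros Ht H.
  assert (L : is_C_derive (fun t => Clog (Ccosh t)) t (Csinh t / Ccosh t)).
  { apply is_C_derive_log_branch with (d := (d - Cmod t)%R).
    - lra.
    - apply C_continuous_comp.
      + exact (is_C_derive_continuous _ _ _ (is_C_derive_Ccosh t)).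
      + apply C_continuous_Clog, H, Ht.
    - intros y Hy. apply Cexp_Clog, H.
      pose proof (Cmod_triangle (y - t) t) as T. replace (y - t + t) with y in T by ring. lra.
    - apply is_C_derive_Ccosh. }
  unfold cosh_power. eapply is_C_derive_eq; [apply is_C_derive_Cexp_comp; derive_C|].
  cbv beta. unfold Ctanh. ring.
Qed.

(** In the coordinate [t] with [z = tanh (t) ^ 2] the hypergeometric equation loses its
    singular points: [U] is [cosh (a t)], described by its equation and initial values. *)
Lemma osc_even (a : C) :
  let y := hyp2F1 (a / 2) ((a + 1) / 2) (1 / 2) in
  let U := fun t => cosh_power a t * y (Ctanh t ^ 2) in
  exists (d : R) (U1 : C -> C), (0 < d)%R /\ osc_solution a d U U1 /\ U 0 = 1 /\ U1 0 = 0 /\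
    forall t, (Cmod t < d)%R -> (0 < Re (Ccosh t))%R /\
      is_hyp2F1 (a / 2) ((a + 1) / 2) (1 / 2) (Ctanh t ^ 2) (y (Ctanh t ^ 2)).
Proof.
  intros y U.
  destruct (hyp2F1_local (a / 2) ((a + 1) / 2) (1 / 2) hyp2F1_defined_1_2) as [r [Hr D]].
  destruct (Ctanh_near_0 r Hr) as [d [Hd T]].
  set (y1 := hyp2F1' (a / 2) ((a + 1) / 2) (1 / 2)) in *.
  set (y2 := hyp2F1'' (a / 2) ((a + 1) / 2) (1 / 2)) in *.
  fold y in D.
  exists d. exists (fun t => cosh_power a t *
    (- a * Ctanh t * y (Ctanh t ^ 2) + 2 * Ctanh t * (1 - Ctanh t ^ 2) * y1 (Ctanh t ^ 2))).
  split; [exact Hd|]. split; [|split; [|split]].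
  - intros t Ht. destruct (T t Ht) as [T1 T2]. destruct (D _ T2) as (_ & Dy & Dy1 & _ & ODE).
    pose proof (is_C_derive_cosh_power a t d Ht (fun s Hs => proj1 (T s Hs))) as DE.
    pose proof (is_C_derive_Ctanh t (Re_pos_neq_0 _ T1)) as DT.
    assert (DT2 : is_C_derive (fun t => Ctanh t ^ 2) t (2 * Ctanh t * (1 - Ctanh t ^ 2))).
    { exact (is_C_derive_sqr _ _ _ DT). }
    pose proof (is_C_derive_comp y _ t _ _ DT2 Dy) as C1.
    pose proof (is_C_derive_comp y1 _ t _ _ DT2 Dy1) as C2. cbv beta in C1, C2.
    split.
    + unfold U. eapply is_C_derive_eq; [derive_C|]. cbv beta. ring.
    + eapply is_C_derive_eq.
      * apply is_C_derive_mult; [exact DE|].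
        apply is_C_derive_plus; apply is_C_derive_mult; [| exact C1 | |exact C2];
        apply is_C_derive_mult; derive_C.
      * cbv beta. unfold U.
        set (s := Ctanh t) in *. set (E := cosh_power a t) in *.
        set (Y := y (s ^ 2)) in *. set (Y1 := y1 (s ^ 2)) in *. set (Y2 := y2 (s ^ 2)) in *.
        assert (Q : 4 * s ^ 2 * (1 - s ^ 2) ^ 2 * Y2
          = 4 * (1 - s ^ 2) * (- ((1 / 2 - (a / 2 + (a + 1) / 2 + 1) * s ^ 2) * Y1) + a / 2 * ((a + 1) / 2) * Y)).
        { transitivity (4 * (1 - s ^ 2) * (s ^ 2 * (1 - s ^ 2) * Y2)); [ring|].
          f_equal. rewrite <- (Cplus_0_r (- _ + _)), <- ODE. ring. }
        transitivity (E * ((a ^ 2 * s ^ 2 - a * (1 - s ^ 2)) * Y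
          + ((1 - s ^ 2) * (- (4) * a * s ^ 2 + 2 - 6 * s ^ 2)) * Y1
          + 4 * s ^ 2 * (1 - s ^ 2) ^ 2 * Y2)); [ring|].
        rewrite Q. field.
  - unfold U. rewrite cosh_power_0, Ctanh_0. replace (0 ^ 2) with (RtoC 0) by ring.
    unfold y. rewrite hyp2F1_at_0. ring.
  - rewrite Ctanh_0. ring.
  - intros t Ht. destruct (T t Ht) as [T1 T2]. split; [exact T1|]. apply (D _ T2).
Qed.

(** The exponent [1/2] at [z = 0] gives the solution [sinh (a t) / a], which for [a = 0] is
    [t]. *)
Lemma osc_odd (a : C) :
  let y := hyp2F1 ((a + 1) / 2) (a / 2 + 1) (3 / 2) in
  let U := fun t => Ctanh t * (cosh_power a t * y (Ctanh t ^ 2)) in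
  exists (d : R) (U1 : C -> C), (0 < d)%R /\ osc_solution a d U U1 /\ U 0 = 0 /\ U1 0 = 1 /\
    forall t, (Cmod t < d)%R -> (0 < Re (Ccosh t))%R /\
      is_hyp2F1 ((a + 1) / 2) (a / 2 + 1) (3 / 2) (Ctanh t ^ 2) (y (Ctanh t ^ 2)).
Proof.
  intros y U.
  destruct (hyp2F1_local ((a + 1) / 2) (a / 2 + 1) (3 / 2) hyp2F1_defined_3_2) as [r [Hr D]].
  destruct (Ctanh_near_0 r Hr) as [d [Hd T]].
  set (y1 := hyp2F1' ((a + 1) / 2) (a / 2 + 1) (3 / 2)) in *.
  set (y2 := hyp2F1'' ((a + 1) / 2) (a / 2 + 1) (3 / 2)) in *.
  fold y in D.
  exists d. exists (fun t => cosh_power a t *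
    ((1 - Ctanh t ^ 2 - a * Ctanh t ^ 2) * y (Ctanh t ^ 2)
     + 2 * Ctanh t ^ 2 * (1 - Ctanh t ^ 2) * y1 (Ctanh t ^ 2))).
  split; [exact Hd|]. split; [|split; [|split]].
  - intros t Ht. destruct (T t Ht) as [T1 T2]. destruct (D _ T2) as (_ & Dy & Dy1 & _ & ODE).
    pose proof (is_C_derive_cosh_power a t d Ht (fun s Hs => proj1 (T s Hs))) as DE.
    pose proof (is_C_derive_Ctanh t (Re_pos_neq_0 _ T1)) as DT.
    assert (DT2 : is_C_derive (fun t => Ctanh t ^ 2) t (2 * Ctanh t * (1 - Ctanh t ^ 2))).
    { exact (is_C_derive_sqr _ _ _ DT). }
    pose proof (is_C_derive_comp y _ t _ _ DT2 Dy) as C1.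
    pose proof (is_C_derive_comp y1 _ t _ _ DT2 Dy1) as C2. cbv beta in C1, C2.
    split.
    + unfold U. eapply is_C_derive_eq; [derive_C|]. cbv beta. ring.
    + eapply is_C_derive_eq.
      * apply is_C_derive_mult; [exact DE|].
        apply is_C_derive_plus; apply is_C_derive_mult; [| exact C1 | |exact C2].
        -- apply is_C_derive_minus; [apply is_C_derive_minus; [apply is_C_derive_const|exact DT2]|].
           apply is_C_derive_mult; [apply is_C_derive_const|exact DT2].
        -- apply is_C_derive_mult; [apply is_C_derive_mult; [apply is_C_derive_const|exact DT2]|].
           apply is_C_derive_minus; [apply is_C_derive_const|exact DT2].
      * cbv beta. unfold U.
        set (s := Ctanh t) in *. set (E := cosh_power a t) in *.
        set (Y := y (s ^ 2)) in *. set (Y1 := y1 (s ^ 2)) in *. set (Y2 := y2 (s ^ 2)) in *.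
        assert (Q : 4 * s ^ 3 * (1 - s ^ 2) ^ 2 * Y2
          = 4 * s * (1 - s ^ 2) * (- ((3 / 2 - ((a + 1) / 2 + (a / 2 + 1) + 1) * s ^ 2) * Y1)
              + (a + 1) / 2 * (a / 2 + 1) * Y)).
        { transitivity (4 * s * (1 - s ^ 2) * (s ^ 2 * (1 - s ^ 2) * Y2)); [ring|].
          f_equal. rewrite <- (Cplus_0_r (- _ + _)), <- ODE. ring. }
        match goal with |- ?lhs = _ =>
          transitivity (lhs - E * (4 * s ^ 3 * (1 - s ^ 2) ^ 2 * Y2)
            + E * (4 * s ^ 3 * (1 - s ^ 2) ^ 2 * Y2)); [ring|] end.
        rewrite Q at 2. field.
  - unfold U. rewrite Ctanh_0. ring.
  - rewrite Ctanh_0, cosh_power_0. replace (0 ^ 2) with (RtoC 0) by ring.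
    unfold y. rewrite hyp2F1_at_0. ring.
  - intros t Ht. destruct (T t Ht) as [T1 T2]. split; [exact T1|]. apply (D _ T2).
Qed.

(** Here [z / (z - 1) = - sinh (t) ^ 2], and no factor is needed to reach [cosh (a t)]. *)
Lemma osc_sinh (a : C) :
  let y := hyp2F1 (a / 2) (- (a / 2)) (1 / 2) in
  let U := fun t => y (- Csinh t ^ 2) in
  exists (d : R) (U1 : C -> C), (0 < d)%R /\ osc_solution a d U U1 /\ U 0 = 1 /\ U1 0 = 0 /\
    forall t, (Cmod t < d)%R ->
      is_hyp2F1 (a / 2) (- (a / 2)) (1 / 2) (- Csinh t ^ 2) (y (- Csinh t ^ 2)).
Proof.
  intros y U.
  destruct (hyp2F1_local (a / 2) (- (a / 2)) (1 / 2) hyp2F1_defined_1_2) as [r [Hr D]].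
  assert (DS : forall t, is_C_derive (fun t => - Csinh t ^ 2) t (- (2) * Csinh t * Ccosh t)).
  { intros t. pose proof (is_C_derive_Csinh t). eapply is_C_derive_eq; [derive_C|].
    cbv beta. ring. }
  destruct (C_continuous_near_0 (fun t => - Csinh t ^ 2) r) as [d [Hd T]];
    [exact (is_C_derive_continuous _ _ _ (DS 0))|exact Hr|].
  assert (T' : forall t, (Cmod t < d)%R -> (Cmod (- Csinh t ^ 2) < r)%R).
  { intros t Ht. specialize (T t Ht). rewrite Csinh_0 in T.
    now replace (- Csinh t ^ 2 - - 0 ^ 2) with (- Csinh t ^ 2) in T by ring. }
  clear T.
  set (y1 := hyp2F1' (a / 2) (- (a / 2)) (1 / 2)) in *.
  set (y2 := hyp2F1'' (a / 2) (- (a / 2)) (1 / 2)) in *.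
  fold y in D.
  exists d, (fun t => (- (2) * (Csinh t * Ccosh t)) * y1 (- Csinh t ^ 2)).
  split; [exact Hd|]. split; [|split; [|split]].
  - intros t Ht. destruct (D _ (T' t Ht)) as (_ & Dy & Dy1 & _ & ODE).
    pose proof (is_C_derive_comp y _ t _ _ (DS t) Dy) as C1.
    pose proof (is_C_derive_comp y1 _ t _ _ (DS t) Dy1) as C2. cbv beta in C1, C2.
    pose proof (is_C_derive_Csinh t) as D1. pose proof (is_C_derive_Ccosh t) as D2.
    split.
    + unfold U. eapply is_C_derive_eq; [exact C1|]. ring.
    + eapply is_C_derive_eq.
      * apply is_C_derive_mult; [|exact C2].
        apply is_C_derive_mult; [apply is_C_derive_const|].
        apply is_C_derive_mult; [exact D1|exact D2].
      * cbv beta. unfold U. fold y2 in C2.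
        pose proof (Ccosh_sinh t) as H.
        set (s := Csinh t) in *. set (c := Ccosh t) in *.
        set (Y := y (- s ^ 2)) in *. set (Y1 := y1 (- s ^ 2)) in *. set (Y2 := y2 (- s ^ 2)) in *.
        assert (H2 : c * c = 1 + s ^ 2) by (rewrite <- H; ring).
        transitivity (- (2) * (c * c + s * s) * Y1 + 4 * s ^ 2 * (c * c) * Y2); [ring|].
        rewrite H2.
        match type of ODE with ?o = _ => transitivity (a ^ 2 * Y - 4 * o) end; [field|].
        rewrite ODE. ring.
  - unfold U. rewrite Csinh_0. replace (- 0 ^ 2) with (RtoC 0) by ring. apply hyp2F1_at_0.
  - rewrite Csinh_0. ring.
  - intros t Ht. apply (D _ (T' t Ht)).
Qed.

(** * The three identities near x = 0 *)

Lemma disk_0 (r : R) (x : C) : disk 0 r x -> (Cmod x < r)%R.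
Proof. unfold disk. now replace (x - 0) with x by ring. Qed.

(** The principal logarithm gives the branch near a point where [f] is 1. *)
Lemma power_branch_near_1 (f : C -> C) (x0 : C) :
  (forall x, C_continuous f x) -> f x0 = 1 ->
  exists r : R, (0 < r)%R /\ forall r', (r' <= r)%R ->
    (forall x, disk x0 r' x -> (0 < Re (f x))%R) /\
    forall c, power_branch_at x0 r' f c (fun x => Cexp (c * Clog (f x))).
Proof.
  intros Hc E.
  destruct (proj1 (C_continuous_eps f x0) (Hc x0) 1%R) as [r [Hr D]]; [lra|].
  exists r. split; [exact Hr|]. intros r' Hr'.
  assert (P : forall x, disk x0 r' x -> (0 < Re (f x))%R).
  { intros x Hx. apply Re_pos_near_1. rewrite <- E. apply D.
    eapply Rlt_le_trans; [exact Hx|exact Hr']. }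
  split; [exact P|]. intros c. split.
  - exists (fun x => Clog (f x)). intros x Hx. split; [|split].
    + apply C_continuous_comp; [apply Hc|]. apply C_continuous_Clog, P, Hx.
    + apply Cexp_Clog, P, Hx.
    + reflexivity.
  - rewrite E, Clog_1, Cmult_0_r. apply Cexp_0.
Qed.

(** The two sides are logarithms of the same number, and their imaginary parts are too
    small for a multiple of [2 * PI] to intervene. *)
Lemma Clog_div_pow (u v : C) (n : nat) :
  (0 < Re u)%R -> (0 < Re v)%R ->
  (Cmod (Clog v) < 1 / 2)%R -> (INR n * Cmod (Clog u) < 1 / 2)%R ->
  Clog (v / u ^ n) = Clog v - NtoC n * Clog u.
Proof.
  intros Hu Hv Bv Bu.
  assert (E : v / u ^ n = Cexp (Clog v - NtoC n * Clog u)).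
  { unfold Cminus. rewrite Cexp_plus, Cexp_opp, Cexp_NtoC_mult, !Cexp_Clog by assumption.
    reflexivity. }
  rewrite E. apply Clog_Cexp.
  assert (B : (Cmod (Clog v - NtoC n * Clog u) < 1)%R).
  { unfold Cminus. eapply Rle_lt_trans; [apply Cmod_triangle|].
    rewrite Cmod_opp, Cmod_mult, Cmod_NtoC. lra. }
  pose proof (Im_le_Cmod (Clog v - NtoC n * Clog u)) as B2.
  pose proof PI2_1.
  assert (B3 : (Rabs (Im (Clog v - NtoC n * Clog u)) < PI / 2)%R) by lra.
  apply Rabs_def2 in B3. lra.
Qed.

Lemma Clog_small_near_0 (f : C -> C) (K : R) :
  C_continuous f 0 -> f 0 = 1 -> (0 <= K)%R ->
  exists d : R, (0 < d)%R /\ forall t, (Cmod t < d)%R ->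
    (0 < Re (f t))%R /\ (K * Cmod (Clog (f t)) < 1 / 2)%R.
Proof.
  intros Hc E HK.
  destruct (C_continuous_near_0 f 1 Hc) as [d1 [P1 D1]]; [lra|].
  destruct (C_continuous_near_0 (fun t => Clog (f t)) (/ (2 * (K + 1)))) as [d2 [P2 D2]].
  { apply C_continuous_comp; [exact Hc|]. rewrite E. apply C_continuous_Clog. simpl. lra. }
  { apply Rinv_0_lt_compat. lra. }
  exists (Rmin d1 d2). split; [apply Rmin_glb_lt; assumption|]. intros t Ht. split.
  - apply Re_pos_near_1. rewrite <- E. apply D1. eapply Rlt_le_trans; [exact Ht|apply Rmin_l].
  - specialize (D2 t (Rlt_le_trans _ _ _ Ht (Rmin_r _ _))).
    rewrite E, Clog_1 in D2. replace (Clog (f t) - 0) with (Clog (f t)) in D2 by ring.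
    assert (A : (Cmod (Clog (f t)) * (2 * (K + 1)) < 1)%R).
    { apply Rmult_lt_compat_r with (r := (2 * (K + 1))%R) in D2; [|lra].
      rewrite Rinv_l in D2; lra. }
    pose proof (Cmod_ge_0 (Clog (f t))). nra.
Qed.

(** The dictionary between [x] and [t]: if [x = tanh (t) ^ 2] then
    [phi n x = tanh (n t) ^ 2], and the branch of [log (theta1 n x)] is the one that the factors
    [cosh] prescribe. *)
Lemma tanh_parameter (n : nat) (d : R) : (0 < n)%nat -> (0 < d)%R ->
  exists r : R, (0 < r)%R /\ forall x, (Cmod x < r)%R ->
    exists t, (Cmod t < d)%R /\ Ccosh t <> 0 /\ Ccosh (NtoC n * t) <> 0 /\ x = Ctanh t ^ 2 /\
      theta1 n x = Ccosh (NtoC n * t) / Ccosh t ^ n /\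
      Ctanh t * theta2 n x = Csinh (NtoC n * t) / Ccosh t ^ n /\
      phi n x = Ctanh (NtoC n * t) ^ 2 /\
      Clog (theta1 n x) = Clog (Ccosh (NtoC n * t)) - NtoC n * Clog (Ccosh t).
Proof.
  intros Hn Hd.
  assert (Hc : C_continuous Ccosh 0) by exact (is_C_derive_continuous _ _ _ (is_C_derive_Ccosh 0)).
  destruct (Clog_small_near_0 Ccosh (INR n) Hc Ccosh_0 (pos_INR n)) as [d1 [P1 D1]].
  destruct (Clog_small_near_0 (fun t => Ccosh (NtoC n * t)) 1) as [d2 [P2 D2]].
  { apply C_continuous_comp.
    - apply C_continuous_mult; [apply C_continuous_const|apply C_continuous_id].
    - replace (NtoC n * 0) with (RtoC 0) by ring. exact Hc. }
  { replace (NtoC n * 0) with (RtoC 0) by ring. exact Ccosh_0. }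
  { lra. }
  destruct (Ctanh_sqr_surjective (Rmin d (Rmin d1 d2))) as [r [Hr D]];
    [repeat apply Rmin_glb_lt; assumption|].
  exists r. split; [exact Hr|]. intros x Hx.
  destruct (D x Hx) as [t [Ht [N ->]]].
  assert (T1 : (Cmod t < d)%R) by (eapply Rlt_le_trans; [exact Ht|apply Rmin_l]).
  assert (T' : (Cmod t < Rmin d1 d2)%R) by (eapply Rlt_le_trans; [exact Ht|apply Rmin_r]).
  destruct (D1 t) as [R1 L1]; [eapply Rlt_le_trans; [exact T'|apply Rmin_l]|].
  destruct (D2 t) as [R2 L2]; [eapply Rlt_le_trans; [exact T'|apply Rmin_r]|].
  destruct (theta_Ctanh n t Hn N) as [E1 E2].
  pose proof (Re_pos_neq_0 _ R2) as N2.
  pose proof (Cpow_nz _ n N) as Nn.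
  exists t. split; [exact T1|]. split; [exact N|]. split; [exact N2|]. split; [reflexivity|].
  split; [exact E1|]. split; [exact E2|]. split.
  - unfold phi.
    replace (Ctanh t ^ 2 * theta2 n (Ctanh t ^ 2) ^ 2) with ((Ctanh t * theta2 n (Ctanh t ^ 2)) ^ 2) by ring.
    rewrite E1, E2. unfold Ctanh. field. auto.
  - rewrite E1. apply Clog_div_pow; try assumption. lra.
Qed.

Lemma even_identity (n : nat) (a : C) : (0 < n)%nat ->
  exists (r : R) (p : C -> C),
     (0 < r)%R /\ power_branch_at 0 r (theta1 n) (- a) p /\
     forall x : C, disk 0 r x ->
       exists F G : C,
         is_hyp2F1 (NtoC n * a / 2) ((NtoC n * a + 1) / 2) (1 / 2) x F /\
         is_hyp2F1 (a / 2) ((a + 1) / 2) (1 / 2) (phi n x) G /\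
         F = p x * G.
Proof.
  intros Hn.
  destruct (osc_even a) as (d & U1 & Hd & HU & U0 & U10 & HF).
  destruct (osc_even (NtoC n * a)) as (e & V1 & He & HV & V0 & V10 & HG).
  destruct (osc_dilation n a 1 d e _ U1 _ V1 Hd He HU HV) as [s [Hs K]].
  { rewrite V0, U0. ring. }
  { rewrite V10, U10. ring. }
  destruct (tanh_parameter n s Hn Hs) as [r1 [Hr1 T]].
  destruct (power_branch_near_1 (theta1 n) 0 (C_continuous_theta1 n) (proj1 (theta_at_0 n Hn)))
    as [r2 [Hr2 B]].
  destruct (B (Rmin r1 r2) (Rmin_r _ _)) as [_ Bp].
  exists (Rmin r1 r2), (fun x => Cexp (- a * Clog (theta1 n x))).
  split; [apply Rmin_glb_lt; assumption|]. split; [apply Bp|].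
  intros x Hx. apply disk_0 in Hx.
  destruct (T x) as (t & Ht & _ & _ & Ex & _ & _ & Ephi & El);
    [eapply Rlt_le_trans; [exact Hx|apply Rmin_l]|].
  destruct (K t Ht) as (K1 & K2 & K3).
  destruct (HG t K1) as [_ HG']. destruct (HF _ K2) as [_ HF'].
  rewrite <- Ephi in HF', K3. rewrite <- Ex in HG', K3.
  eexists _, _. split; [exact HG'|]. split; [exact HF'|].
  unfold cosh_power in K3. rewrite El.
  set (F := hyp2F1 (NtoC n * a / 2) ((NtoC n * a + 1) / 2) (1 / 2) x) in *.
  set (G := hyp2F1 (a / 2) ((a + 1) / 2) (1 / 2) (phi n x)) in *.
  set (lu := Clog (Ccosh t)) in *. set (lv := Clog (Ccosh (NtoC n * t))) in *.
  replace F with (Cexp (NtoC n * a * lu) * (Cexp (- (NtoC n * a) * lu) * F)).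
  - rewrite K3. rewrite Cmult_1_l, Cmult_assoc, <- Cexp_plus. f_equal. f_equal. ring.
  - rewrite Cmult_assoc, <- Cexp_plus.
    replace (NtoC n * a * lu + - (NtoC n * a) * lu) with (RtoC 0) by ring.
    rewrite Cexp_0. ring.
Qed.

Lemma NtoC_neq_0 (n : nat) : (0 < n)%nat -> NtoC n <> 0.
Proof. destruct n as [|n]; [lia|intros _; apply NtoC_S_neq_0]. Qed.

Lemma odd_identity (n : nat) (a : C) : (0 < n)%nat ->
  exists (r : R) (p : C -> C),
     (0 < r)%R /\ power_branch_at 0 r (theta1 n) (- a - 1) p /\
     forall x : C, disk 0 r x ->
       exists F G : C,
         is_hyp2F1 ((NtoC n * a + 1) / 2) (NtoC n * a / 2 + 1) (3 / 2) x F /\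
         is_hyp2F1 ((a + 1) / 2) (a / 2 + 1) (3 / 2) (phi n x) G /\
         F = p x * (theta2 n x / NtoC n) * G.
Proof.
  intros Hn. pose proof (NtoC_neq_0 n Hn) as Nn.
  destruct (osc_odd a) as (d & U1 & Hd & HU & U0 & U10 & HF).
  destruct (osc_odd (NtoC n * a)) as (e & V1 & He & HV & V0 & V10 & HG).
  destruct (osc_dilation n a (/ NtoC n) d e _ U1 _ V1 Hd He HU HV) as [s [Hs K]].
  { rewrite V0, U0. ring. }
  { rewrite V10, U10. field. exact Nn. }
  destruct (tanh_parameter n s Hn Hs) as [r1 [Hr1 T]].
  destruct (power_branch_near_1 (theta1 n) 0 (C_continuous_theta1 n) (proj1 (theta_at_0 n Hn)))
    as [r2 [Hr2 B]].
  destruct (B (Rmin r1 r2) (Rmin_r _ _)) as [Bre Bp].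
  exists (Rmin r1 r2), (fun x => Cexp ((- a - 1) * Clog (theta1 n x))).
  split; [apply Rmin_glb_lt; assumption|]. split; [apply Bp|].
  intros x Hx. pose proof (Bre x Hx) as Rx. apply disk_0 in Hx.
  destruct (T x) as (t & Ht & Nc & Ncn & Ex & E1 & E2 & Ephi & El);
    [eapply Rlt_le_trans; [exact Hx|apply Rmin_l]|].
  destruct (K t Ht) as (K1 & K2 & K3).
  destruct (HG t K1) as [_ HG']. destruct (HF _ K2) as [_ HF'].
  rewrite <- Ephi in HF', K3. rewrite <- Ex in HG', K3.
  eexists _, _. split; [exact HG'|]. split; [exact HF'|].
  destruct (classic (Ctanh t = 0)) as [Z|Z].
  - (* x = 0: the coordinate tanh(t) cannot be cancelled, but all series equal 1 *)
    assert (X0 : x = 0) by (rewrite Ex, Z; ring).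
    assert (P0 : phi n x = 0) by (unfold phi; rewrite X0; unfold Cdiv; ring).
    rewrite P0, X0, !hyp2F1_at_0. destruct (theta_at_0 n Hn) as [-> ->].
    rewrite Clog_1, Cmult_0_r, Cexp_0. field. exact Nn.
  - unfold cosh_power in K3.
    assert (Cpw : Cexp ((- a - 1) * Clog (theta1 n x))
      = Cexp (- a * Clog (theta1 n x)) / theta1 n x).
    { replace ((- a - 1) * Clog (theta1 n x))
        with (- a * Clog (theta1 n x) + - Clog (theta1 n x)) by ring.
      rewrite Cexp_plus, Cexp_opp, Cexp_Clog by exact Rx. reflexivity. }
    rewrite Cpw, El.
    set (F := hyp2F1 ((NtoC n * a + 1) / 2) (NtoC n * a / 2 + 1) (3 / 2) x) in *.
    set (G := hyp2F1 ((a + 1) / 2) (a / 2 + 1) (3 / 2) (phi n x)) in *.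
    set (lu := Clog (Ccosh t)) in *. set (lv := Clog (Ccosh (NtoC n * t))) in *.
    pose proof (Cpow_nz _ n Nc) as Ncp.
    assert (Nt1 : theta1 n x <> 0) by (apply Re_pos_neq_0; exact Rx).
    assert (Eth : Ctanh (NtoC n * t) = Ctanh t * theta2 n x / theta1 n x).
    { rewrite E1, E2. unfold Ctanh. field. auto. }
    rewrite Eth in K3.
    assert (Q : Cexp (NtoC n * a * lu) * Cexp (- (NtoC n * a) * lu) = 1).
    { rewrite <- Cexp_plus, <- Cexp_0. f_equal. ring. }
    assert (Q2 : Cexp (- a * (lv - NtoC n * lu)) = Cexp (NtoC n * a * lu) * Cexp (- a * lv)).
    { rewrite <- Cexp_plus. f_equal. ring. }
    rewrite Q2.
    set (A := Cexp (NtoC n * a * lu)) in *. set (A' := Cexp (- (NtoC n * a) * lu)) in *.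
    set (B' := Cexp (- a * lv)) in *.
    transitivity (A * (Ctanh t * (A' * F)) / Ctanh t).
    + transitivity (A * A' * F); [rewrite Q; ring|field; exact Z].
    + rewrite K3. field. auto.
Qed.

Lemma sinh_identity (n : nat) (a : C) : (0 < n)%nat ->
  exists r : R,
     (0 < r)%R /\
     forall x : C, disk 0 r x ->
       x <> 1 /\
       exists F : C,
         is_hyp2F1 (NtoC n * a / 2) (- (NtoC n * a / 2)) (1 / 2)
           (x / (x - 1)) F /\
         is_hyp2F1 (a / 2) (- (a / 2)) (1 / 2)
           (- (x * theta2 n x ^ 2 / (1 - x) ^ n)) F.
Proof.
  intros Hn.
  destruct (osc_sinh a) as (d & U1 & Hd & HU & U0 & U10 & HF).
  destruct (osc_sinh (NtoC n * a)) as (e & V1 & He & HV & V0 & V10 & HG).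
  destruct (osc_dilation n a 1 d e _ U1 _ V1 Hd He HU HV) as [s [Hs K]].
  { rewrite V0, U0. ring. }
  { rewrite V10, U10. ring. }
  destruct (tanh_parameter n s Hn Hs) as [r1 [Hr1 T]].
  exists (Rmin r1 1). split; [apply Rmin_glb_lt; lra|].
  intros x Hx. apply disk_0 in Hx. split.
  { intros ->. rewrite Cmod_1 in Hx. pose proof (Rmin_r r1 1). lra. }
  destruct (T x) as (t & Ht & Nc & Ncn & Ex & E1 & E2 & _ & _);
    [eapply Rlt_le_trans; [exact Hx|apply Rmin_l]|].
  destruct (K t Ht) as (K1 & K2 & K3).
  pose proof (HG t K1) as HG'. pose proof (HF _ K2) as HF'.
  pose proof (Cpow_nz _ n Nc) as Ncp.
  assert (X1 : 1 - x = / Ccosh t ^ 2).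
  { rewrite Ex. unfold Ctanh. rewrite <- (Ccosh_sinh t). field_simplify_eq; [|exact Nc].
    pose proof (Ccosh_sinh t) as H.
    replace (Csinh t ^ 2) with (Ccosh t ^ 2 - 1) by (rewrite <- H; ring). ring. }
  assert (X2 : x / (x - 1) = - Csinh t ^ 2).
  { replace (x - 1) with (- / Ccosh t ^ 2) by (rewrite <- X1; ring).
    rewrite Ex. unfold Ctanh. field. exact Nc. }
  assert (X3 : - (x * theta2 n x ^ 2 / (1 - x) ^ n) = - Csinh (NtoC n * t) ^ 2).
  { f_equal. rewrite X1, Cpow_inv by (apply Cpow_nz; exact Nc).
    rewrite <- Cpow_mult_r, Nat.mul_comm, Cpow_mult_r.
    replace (x * theta2 n x ^ 2) with ((Ctanh t * theta2 n x) ^ 2) by (rewrite Ex; ring).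
    rewrite E2. field. exact Ncp. }
  eexists. split.
  - rewrite X2. exact HG'.
  - rewrite X3, K3, Cmult_1_l. exact HF'.
Qed.

(** * The identity near x = 1 *)

Lemma RtoC_neq (r s : R) : r <> s -> RtoC r <> RtoC s.
Proof. intros H E. apply H, RtoC_inj, E. Qed.

(** For [h q = q * G q] the equation says [q * h' = - a * h], so along a ray the derivative of
    [|h| ^ 2] has the sign of [- Re a]: it cannot grow from its value 0 at the origin. The
    sign condition cannot be dropped: for [a = - 2] there is the solution [G q = q]. *)
Lemma singular_unique (a : C) (rho : R) (G G1 : C -> C) :
  (0 <= Re a)%R ->
  (forall q, (Cmod q < rho)%R -> is_C_derive G q (G1 q) /\ q * G1 q = - (1 + a) * G q) ->
  forall q, (Cmod q < rho)%R -> G q = 0.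
Proof.
  intros Ha H q Hq.
  assert (Na : 1 + a <> 0).
  { intros Z. apply (f_equal Re) in Z. rewrite re_plus, !re_RtoC in Z. lra. }
  destruct (classic (q = 0)) as [->|Nq].
  { destruct (H 0 Hq) as [_ E]. rewrite Cmult_0_l in E.
    replace (G 0) with (- (- (1 + a) * G 0) / (1 + a)) by (field; exact Na).
    rewrite <- E. field. exact Na. }
  set (h := fun z => z * G z).
  assert (Dh : forall z, (Cmod z < rho)%R -> is_C_derive h z (- a * G z)).
  { intros z Hz. destruct (H z Hz) as [D E]. unfold h.
    eapply is_C_derive_eq; [derive_C|]. cbv beta.
    transitivity (G z + z * G1 z); [ring|]. rewrite E. ring. }
  assert (Ht : forall t : R, (0 <= t <= 1)%R -> (Cmod (t * q) < rho)%R).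
  { intros t Ht. rewrite Cmod_mult, Cmod_R, Rabs_pos_eq by lra. pose proof (Cmod_ge_0 q). nra. }
  set (X := fun t : R => Re (h (t * q))). set (Y := fun t : R => Im (h (t * q))).
  set (X' := fun t : R => Re (q * (- a * G (t * q)))). set (Y' := fun t : R => Im (q * (- a * G (t * q)))).
  assert (DX : forall t, (0 <= t <= 1)%R -> is_derive X t (X' t)).
  { intros t T. apply is_derive_ray_Re, Dh, Ht, T. }
  assert (DY : forall t, (0 <= t <= 1)%R -> is_derive Y t (Y' t)).
  { intros t T. apply is_derive_ray_Im, Dh, Ht, T. }
  assert (DN : forall t, (0 <= t <= 1)%R ->
    is_derive (fun t => (X t * X t + Y t * Y t)%R) t (2 * (X t * X' t + Y t * Y' t))%R).
  { intros t T. specialize (DX t T). specialize (DY t T).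
    apply is_derive_Reals. apply is_derive_Reals in DX, DY.
    replace (2 * (X t * X' t + Y t * Y' t))%R
      with ((X' t * X t + X t * X' t) + (Y' t * Y t + Y t * Y' t))%R by ring.
    apply (derivable_pt_lim_plus (fun t => X t * X t)%R (fun t => Y t * Y t)%R);
      apply derivable_pt_lim_mult; assumption. }
  destruct (MVT_gen (fun t => (X t * X t + Y t * Y t)%R) 0 1
              (fun t => 2 * (X t * X' t + Y t * Y' t))%R) as [c [Hc E]].
  { intros t T. rewrite Rmin_left, Rmax_right in T by lra. apply DN. lra. }
  { intros t T. rewrite Rmin_left, Rmax_right in T by lra.
    specialize (DN t T). apply is_derive_Reals in DN.
    apply derivable_continuous_pt. eexists. exact DN. }
  rewrite Rmin_left, Rmax_right in Hc by lra.
  assert (X0 : X 0%R = 0%R) by (unfold X, h; rewrite !Cmult_0_l; reflexivity).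
  assert (Y0 : Y 0%R = 0%R) by (unfold Y, h; rewrite !Cmult_0_l; reflexivity).
  assert (S : (X c * X' c + Y c * Y' c <= 0)%R).
  { unfold X, Y, X', Y', h. destruct a as [a1 a2], q as [q1 q2], (G (c * (q1, q2))) as [g1 g2].
    simpl in *. clear - Ha Hc.
    match goal with |- (?e <= 0)%R =>
      replace e with (- (c * a1 * ((q1 * q1 + q2 * q2) * (g1 * g1 + g2 * g2))))%R by ring end.
    assert (0 <= c * a1)%R by nra.
    assert (0 <= (q1 * q1 + q2 * q2) * (g1 * g1 + g2 * g2))%R by (apply Rmult_le_pos; nra).
    nra. }
  rewrite X0, Y0 in E.
  assert (X1 : X 1%R = 0%R) by nra. assert (Y1 : Y 1%R = 0%R) by nra.
  assert (Hh : h q = 0).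
  { unfold X, Y in X1, Y1. rewrite Cmult_1_l in X1, Y1.
    apply injective_projections; assumption. }
  unfold h in Hh. replace (G q) with (q * G q / q) by (field; exact Nq). rewrite Hh. field. exact Nq.
Qed.

(** The principal branch of [(1 + q) ^ a]. *)
Definition one_plus_power (a q : C) : C := Cexp (a * Clog (1 + q)).

Lemma Re_one_plus (q : C) : (Cmod q < 1)%R -> (0 < Re (1 + q))%R.
Proof. intros H. apply Re_pos_near_1. now replace (1 + q - 1) with q by ring. Qed.

Lemma is_C_derive_one_plus_power (a q : C) : (Cmod q < 1)%R ->
  is_C_derive (one_plus_power a) q (a * one_plus_power a q / (1 + q)).
Proof.
  intros H.
  assert (Q : forall y, (Cmod (y - q) < 1 - Cmod q)%R -> (0 < Re (1 + y))%R).
  { intros y Hy. apply Re_one_plus.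
    pose proof (Cmod_triangle (y - q) q) as T. replace (y - q + q) with y in T by ring. lra. }
  assert (D : is_C_derive (fun q => Clog (1 + q)) q (1 / (1 + q))).
  { apply is_C_derive_log_branch with (f := fun q => 1 + q) (d := (1 - Cmod q)%R).
    - lra.
    - apply C_continuous_comp.
      + apply C_continuous_plus; [apply C_continuous_const|apply C_continuous_id].
      + apply C_continuous_Clog, Re_one_plus, H.
    - intros y Hy. apply Cexp_Clog, Q, Hy.
    - eapply is_C_derive_eq; [derive_C|]. ring. }
  unfold one_plus_power. eapply is_C_derive_eq; [apply is_C_derive_Cexp_comp; derive_C|].
  cbv beta. unfold Cdiv. ring.
Qed.

Lemma one_plus_power_0 (a : C) : one_plus_power a 0 = 1.
Proof.
  unfold one_plus_power. replace (1 + 0) with (RtoC 1) by ring. rewrite Clog_1, Cmult_0_r. apply Cexp_0.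
Qed.

Lemma one_plus_power_plus (a b q : C) :
  one_plus_power (a + b) q = one_plus_power a q * one_plus_power b q.
Proof. unfold one_plus_power. rewrite <- Cexp_plus. f_equal. ring. Qed.

Lemma one_plus_power_2 (q : C) : (Cmod q < 1)%R -> one_plus_power 2 q = (1 + q) ^ 2.
Proof.
  intros H. unfold one_plus_power. replace (2 * Clog (1 + q)) with (Clog (1 + q) + Clog (1 + q)) by ring.
  rewrite Cexp_plus, Cexp_Clog by (apply Re_one_plus, H). ring.
Qed.

(** With [q = exp (- 2 t)] this is [1 - tanh (t) ^ 2]: the coordinate [q] is adapted to the
    point [z = 1], where [t] is infinite. *)
Definition koebe (q : C) : C := 4 * q / (1 + q) ^ 2.

Lemma one_plus_neq_0 (q : C) : (Cmod q < 1)%R -> 1 + q <> 0.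
Proof. intros H. apply Re_pos_neq_0, Re_one_plus, H. Qed.

Lemma is_C_derive_koebe (q : C) : (Cmod q < 1)%R ->
  is_C_derive koebe q (4 * (1 - q) / (1 + q) ^ 3).
Proof.
  intros H. pose proof (one_plus_neq_0 q H) as N.
  unfold koebe. eapply is_C_derive_eq.
  - derive_C. apply Cpow_nz, N.
  - cbv beta. field. exact N.
Qed.

Lemma koebe_0 : koebe 0 = 0.
Proof. unfold koebe. field. Qed.

Lemma koebe_near_0 (r : R) : (0 < r)%R ->
  exists rho : R, (0 < rho <= 1)%R /\ forall q, (Cmod q < rho)%R -> (Cmod (koebe q) < r)%R.
Proof.
  intros Hr. destruct (C_continuous_near_0 koebe r) as [d [P D]]; [|exact Hr|].
  { apply (is_C_derive_continuous _ _ _ (is_C_derive_koebe 0 ltac:(rewrite Cmod_0; lra))). }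
  exists (Rmin d 1). split; [split; [apply Rmin_glb_lt; lra|apply Rmin_r]|].
  intros q Hq. specialize (D q (Rlt_le_trans _ _ _ Hq (Rmin_l _ _))).
  rewrite koebe_0 in D. now replace (koebe q - 0) with (koebe q) in D by ring.
Qed.

(** A degenerate quadratic transformation of 2F1, in which one side is elementary. It is a
    predicate on [a] because its proof shifts the parameter. *)
Definition quadratic_form (a : C) : Prop :=
  exists rho : R, (0 < rho <= 1)%R /\ forall q, (Cmod q < rho)%R ->
    is_hyp2F1 (a / 2) ((a + 1) / 2) (a + 1) (koebe q) (one_plus_power a q).

(** Let [F] be the quotient of the two sides. The hypergeometric equation becomes
    [q * F'' + (1 + a) * F' = 0], so that [singular_unique] applies to [F']. *)
Lemma quadratic_form_right_half_plane (a : C) : (0 <= Re a)%R -> quadratic_form a.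
Proof.
  intros Ha.
  assert (HC : hyp2F1_defined (a + 1)).
  { intros k E. apply (f_equal Re) in E. unfold NtoC in E.
    rewrite re_plus, re_opp, !re_RtoC in E. pose proof (pos_INR k). lra. }
  destruct (hyp2F1_local (a / 2) ((a + 1) / 2) (a + 1) HC) as [r [Hr D]].
  destruct (koebe_near_0 r Hr) as [rho [Hrho K]].
  pose proof (hyp2F1_at_0 (a / 2) ((a + 1) / 2) (a + 1)) as f_0.
  set (f := hyp2F1 (a / 2) ((a + 1) / 2) (a + 1)) in *.
  set (f1 := hyp2F1' (a / 2) ((a + 1) / 2) (a + 1)) in *.
  set (f2 := hyp2F1'' (a / 2) ((a + 1) / 2) (a + 1)) in *.
  exists rho. split; [exact Hrho|]. intros q Hq.
  set (F := fun q => one_plus_power (- a) q * f (koebe q)).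
  set (G := fun q => one_plus_power (- a) q *
    (4 * (1 - q) / (1 + q) ^ 3 * f1 (koebe q) - a / (1 + q) * f (koebe q))).
  assert (DF : forall z, (Cmod z < rho)%R -> is_C_derive F z (G z)).
  { intros z Hz. destruct (D _ (K z Hz)) as (_ & Df & _ & _ & _).
    assert (Hz1 : (Cmod z < 1)%R) by lra.
    pose proof (is_C_derive_one_plus_power (- a) z Hz1) as DP.
    pose proof (is_C_derive_comp f koebe z _ _ (is_C_derive_koebe z Hz1) Df) as C1.
    unfold F, G. eapply is_C_derive_eq; [apply is_C_derive_mult; [exact DP|exact C1]|].
    cbv beta. field. apply one_plus_neq_0, Hz1. }
  assert (G0 : forall z, (Cmod z < rho)%R -> G z = 0).
  { set (G1 := fun z => one_plus_power (- a) z *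
      (- (a) / (1 + z) * (4 * (1 - z) / (1 + z) ^ 3 * f1 (koebe z) - a / (1 + z) * f (koebe z))
       + (8 * (z - 2) / (1 + z) ^ 4 * f1 (koebe z) + (4 * (1 - z) / (1 + z) ^ 3) ^ 2 * f2 (koebe z)
          + a / (1 + z) ^ 2 * f (koebe z) - a / (1 + z) * (4 * (1 - z) / (1 + z) ^ 3) * f1 (koebe z)))).
    apply (singular_unique a rho G G1 Ha). intros z Hz.
    destruct (D _ (K z Hz)) as (_ & Df & Df1 & _ & ODE).
    assert (Hz1 : (Cmod z < 1)%R) by lra.
    pose proof (one_plus_neq_0 z Hz1) as N.
    pose proof (is_C_derive_one_plus_power (- a) z Hz1) as DP.
    pose proof (is_C_derive_comp f koebe z _ _ (is_C_derive_koebe z Hz1) Df) as C1.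
    pose proof (is_C_derive_comp f1 koebe z _ _ (is_C_derive_koebe z Hz1) Df1) as C2.
    fold f2 in C2.
    assert (DK : is_C_derive (fun q => 4 * (1 - q) / (1 + q) ^ 3) z (8 * (z - 2) / (1 + z) ^ 4)).
    { eapply is_C_derive_eq; [derive_C; apply Cpow_nz, N|]. cbv beta.
      replace (NtoC 3) with (RtoC 3) by (unfold NtoC; f_equal; simpl; lra).
      simpl Nat.sub. field. exact N. }
    assert (DA : is_C_derive (fun q => a / (1 + q)) z (- a / (1 + z) ^ 2)).
    { eapply is_C_derive_eq; [derive_C; exact N|]. cbv beta. field. exact N. }
    split.
    - unfold G, G1. eapply is_C_derive_eq.
      + apply is_C_derive_mult; [exact DP|]. apply is_C_derive_minus; apply is_C_derive_mult.
        * exact DK.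
        * exact C2.
        * exact DA.
        * exact C1.
      + cbv beta. field. exact N.
    - unfold G, G1.
      set (E := one_plus_power (- a) z).
      set (Y := f (koebe z)) in *. set (Y1 := f1 (koebe z)) in *. set (Y2 := f2 (koebe z)) in *.
      assert (Q : z * (4 * (1 - z) / (1 + z) ^ 3) ^ 2 * Y2
        = 4 / (1 + z) ^ 2 * (a / 2 * ((a + 1) / 2) * Y
            - (a + 1 - (a / 2 + (a + 1) / 2 + 1) * koebe z) * Y1)).
      { transitivity (4 / (1 + z) ^ 2 * (koebe z * (1 - koebe z) * Y2)).
        - unfold koebe. field. exact N.
        - f_equal. rewrite <- (Cplus_0_r (a / 2 * ((a + 1) / 2) * Y - _)), <- ODE. ring. }
      match goal with |- ?lhs = _ =>
        transitivity (lhs - E * (z * (4 * (1 - z) / (1 + z) ^ 3) ^ 2 * Y2)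
            + E * (z * (4 * (1 - z) / (1 + z) ^ 3) ^ 2 * Y2)); [ring|] end.
      rewrite Q at 2. unfold koebe. field. exact N. }
  assert (F0 : F 0 = 1).
  { unfold F. rewrite one_plus_power_0, koebe_0, f_0. ring. }
  assert (Fq : F q = 1).
  { rewrite <- F0. apply (is_C_derive_zero_const F rho); [|exact Hq].
    intros z Hz. rewrite <- (G0 z Hz). apply DF, Hz. }
  replace (one_plus_power a q) with (f (koebe q)); [apply (D _ (K q Hq))|].
  transitivity (one_plus_power a q * F q); [|rewrite Fq; ring].
  unfold F. rewrite Cmult_assoc, <- one_plus_power_plus.
  replace (a + - a) with (RtoC 0) by ring.
  unfold one_plus_power. rewrite Cmult_0_l, Cexp_0. ring.
Qed.

Lemma poch_S_l (x : C) (k : nat) : poch x (S k) = x * poch (x + 1) k.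
Proof.
  induction k as [|k IH].
  - simpl. unfold NtoC. change (INR 0) with 0%R. ring.
  - change (poch x (S (S k))) with (poch x (S k) * (x + NtoC (S k))). rewrite IH.
    change (poch (x + 1) (S k)) with (poch (x + 1) k * (x + 1 + NtoC k)). rewrite NtoC_S. ring.
Qed.

(** The derivative in parameter [a] is expressed through parameter [a + 2]. The factor
    [1 + k / (a + 2)] accounts for replacing [poch (a + 3) k] by [poch (a + 2) k]. *)
Lemma hyp2F1_coef_contiguous (a : C) (k : nat) :
  hyp2F1_defined (a + 1) ->
  Cpderiv (hyp2F1_coef (a / 2) ((a + 1) / 2) (a + 1)) k
  = a / 4 * ((1 + NtoC k / (a + 2))
      * hyp2F1_coef ((a + 2) / 2) ((a + 2 + 1) / 2) (a + 2 + 1) k).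
Proof.
  intros H.
  assert (H2 : a + 2 <> 0).
  { intros E. apply (H 1%nat). unfold NtoC. simpl INR.
    replace (a + 1) with (a + 2 - 1) by ring. rewrite E. ring. }
  assert (H3 : hyp2F1_defined (a + 2 + 1)).
  { intros j E. apply (H (S (S j))). rewrite !NtoC_S.
    replace (a + 1) with (a + 2 + 1 - 2) by ring. rewrite E. ring. }
  pose proof (poch_neq_0 _ k H3) as P3.
  pose proof (poch_neq_0 _ (S k) H) as P1. rewrite poch_S_l in P1.
  unfold Cpderiv, hyp2F1_coef.
  assert (E : NtoC (fact (S k)) = NtoC (S k) * NtoC (fact k)).
  { unfold NtoC. change (fact (S k)) with (S k * fact k)%nat. now rewrite mult_INR, RtoC_mult. }
  rewrite E, !poch_S_l.
  pose proof (NtoC_fact_neq_0 k) as Nf. pose proof (NtoC_S_neq_0 k) as Ns.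
  assert (N1 : a + 1 <> 0) by (intros Z; apply P1; rewrite Z; ring).
  assert (N2 : poch (a + 1 + 1) k <> 0) by (intros Z; apply P1; rewrite Z; ring).
  assert (Q : (a + 2) * poch (a + 2 + 1) k = poch (a + 1 + 1) k * (a + 2 + NtoC k)).
  { rewrite <- poch_S_l. replace (a + 1 + 1) with (a + 2) by ring. reflexivity. }
  replace (a / 2 + 1) with ((a + 2) / 2) by field.
  replace ((a + 1) / 2 + 1) with ((a + 2 + 1) / 2) by field.
  set (u := poch ((a + 2) / 2) k). set (v := poch ((a + 2 + 1) / 2) k).
  set (w := poch (a + 2 + 1) k) in *. set (z := poch (a + 1 + 1) k) in *.
  transitivity (a / 4 * (u * v / NtoC (fact k)) / z); [field; auto|].
  transitivity (a / 4 * (u * v / NtoC (fact k)) * (((a + 2) * w) / (z * (a + 2) * w)));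
    [field; auto|].
  rewrite Q at 1. field. auto.
Qed.

Lemma hyp2F1'_contiguous (a : C) :
  hyp2F1_defined (a + 1) -> hyp2F1_defined (a + 2 + 1) ->
  exists r : R, (0 < r)%R /\ forall v, (Cmod v < r)%R ->
    hyp2F1' (a / 2) ((a + 1) / 2) (a + 1) v
    = a / 4 * (hyp2F1 ((a + 2) / 2) ((a + 2 + 1) / 2) (a + 2 + 1) v
        + v / (a + 2) * hyp2F1' ((a + 2) / 2) ((a + 2 + 1) / 2) (a + 2 + 1) v).
Proof.
  intros H H3.
  destruct (hyp2F1_local (a / 2) ((a + 1) / 2) (a + 1) H) as [r1 [P1 D1]].
  destruct (hyp2F1_local ((a + 2) / 2) ((a + 2 + 1) / 2) (a + 2 + 1) H3) as [r2 [P2 D2]].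
  exists (Rmin r1 r2). split; [apply Rmin_glb_lt; assumption|]. intros v Hv.
  destruct (D1 v) as (_ & _ & _ & S1 & _); [eapply Rlt_le_trans; [exact Hv|apply Rmin_l]|].
  destruct (D2 v) as (S2 & _ & _ & S3 & _); [eapply Rlt_le_trans; [exact Hv|apply Rmin_r]|].
  apply (proj1 (is_pseries_iff _ _ _)) in S2.
  pose proof (is_Cseries_mult_z
    (fun k => NtoC k * hyp2F1_coef ((a + 2) / 2) ((a + 2 + 1) / 2) (a + 2 + 1) k) v _ S3) as S4.
  assert (S4' := S4 ltac:(unfold NtoC; change (INR 0) with 0%R; ring)). clear S4.
  pose proof (is_Cseries_scal (a / 4) _ _
    (is_Cseries_plus _ _ _ _ S2 (is_Cseries_scal (/ (a + 2)) _ _ S4'))) as S5.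
  eapply is_Cseries_unique; [exact S1|].
  match type of S5 with is_Cseries _ ?x => replace (_ * _) with x end.
  - eapply is_Cseries_ext with (2 := S5). intros k. cbv beta.
    rewrite hyp2F1_coef_contiguous by exact H. unfold Cdiv. ring.
  - unfold Cdiv. ring.
Qed.

Lemma is_hyp2F1_unique (A B C0 z v : C) : is_hyp2F1 A B C0 z v -> hyp2F1 A B C0 z = v.
Proof. intros H. exact (Cpsum_unique _ _ _ (proj1 (is_pseries_iff _ _ _) H)). Qed.

(** By the contiguity relation the closed form in parameter [a + 2] gives the derivative of
    the left-hand side in parameter [a], and it agrees with that of [(1 + q) ^ a]. *)
Lemma quadratic_form_shift (a : C) :
  hyp2F1_defined (a + 1) -> quadratic_form (a + 2) -> quadratic_form a.
Proof.
  intros H [rho2 [Hr2 Q2]].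
  assert (N2 : a + 2 <> 0).
  { intros E. apply (H 1%nat). unfold NtoC. simpl INR.
    replace (a + 1) with (a + 2 - 1) by ring. rewrite E. ring. }
  assert (H3 : hyp2F1_defined (a + 2 + 1)).
  { intros j E. apply (H (S (S j))). rewrite !NtoC_S.
    replace (a + 1) with (a + 2 + 1 - 2) by ring. rewrite E. ring. }
  destruct (hyp2F1'_contiguous a H H3) as [r0 [P0 D0]].
  destruct (hyp2F1_local (a / 2) ((a + 1) / 2) (a + 1) H) as [r1 [P1 D1]].
  destruct (hyp2F1_local ((a + 2) / 2) ((a + 2 + 1) / 2) (a + 2 + 1) H3) as [r2 [P2 D2]].
  destruct (koebe_near_0 (Rmin r0 (Rmin r1 r2))) as [rho1 [Hr1 K]];
    [repeat apply Rmin_glb_lt; assumption|].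
  pose proof (hyp2F1_at_0 (a / 2) ((a + 1) / 2) (a + 1)) as f_0.
  set (f := hyp2F1 (a / 2) ((a + 1) / 2) (a + 1)) in *.
  set (f1 := hyp2F1' (a / 2) ((a + 1) / 2) (a + 1)) in *.
  set (g := hyp2F1 ((a + 2) / 2) ((a + 2 + 1) / 2) (a + 2 + 1)) in *.
  set (g1 := hyp2F1' ((a + 2) / 2) ((a + 2 + 1) / 2) (a + 2 + 1)) in *.
  set (rho := Rmin rho1 rho2).
  assert (R1 : (rho <= rho1)%R) by apply Rmin_l. assert (R2 : (rho <= rho2)%R) by apply Rmin_r.
  assert (R0 : (0 < rho)%R) by (apply Rmin_glb_lt; lra).
  assert (Kb : forall q, (Cmod q < rho)%R ->
    (Cmod (koebe q) < r0)%R /\ (Cmod (koebe q) < r1)%R /\ (Cmod (koebe q) < r2)%R).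
  { intros q Hq. specialize (K q ltac:(lra)).
    pose proof (Rmin_l r0 (Rmin r1 r2)). pose proof (Rmin_r r0 (Rmin r1 r2)).
    pose proof (Rmin_l r1 r2). pose proof (Rmin_r r1 r2). lra. }
  assert (Dz : forall z, (Cmod z < rho)%R ->
    is_C_derive (fun q => f (koebe q) - one_plus_power a q) z 0).
  { intros z Hz. destruct (Kb z Hz) as (K0 & K1 & K2).
    assert (Hz1 : (Cmod z < 1)%R) by lra.
    pose proof (one_plus_neq_0 z Hz1) as N.
    destruct (D1 _ K1) as (_ & Df & _). destruct (D2 _ K2) as (_ & Dg & _).
    pose proof (is_C_derive_comp f koebe z _ _ (is_C_derive_koebe z Hz1) Df) as C1.
    pose proof (is_C_derive_comp g koebe z _ _ (is_C_derive_koebe z Hz1) Dg) as C2.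
    assert (Eg : forall q, (Cmod q < rho)%R -> g (koebe q) = one_plus_power (a + 2) q).
    { intros q Hq. apply is_hyp2F1_unique, Q2. lra. }
    assert (C3 : is_C_derive (fun q => g (koebe q)) z ((a + 2) * one_plus_power (a + 2) z / (1 + z))).
    { apply is_C_derive_ext_loc with (f := one_plus_power (a + 2)) (d := (rho - Cmod z)%R); [lra| |].
      - intros y Hy. symmetry. apply Eg.
        pose proof (Cmod_triangle (y - z) z) as T. replace (y - z + z) with y in T by ring. lra.
      - apply is_C_derive_one_plus_power, Hz1. }
    pose proof (is_C_derive_fun _ _ _ _ C2 C3) as E. fold g1 in E.
    fold f1 in C1.
    eapply is_C_derive_eq; [apply is_C_derive_minus; [exact C1|apply is_C_derive_one_plus_power, Hz1]|].
    rewrite (D0 _ K0), (Eg z Hz).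
    set (W := one_plus_power (a + 2) z) in *.
    transitivity (a / 4 * (W * (4 * (1 - z) / (1 + z) ^ 3)
        + koebe z / (a + 2) * (g1 (koebe z) * (4 * (1 - z) / (1 + z) ^ 3)))
        - a * one_plus_power a z / (1 + z)); [unfold Cdiv; ring|].
    rewrite E. unfold W. rewrite one_plus_power_plus, one_plus_power_2 by exact Hz1.
    unfold koebe. field. auto. }
  exists rho. split; [lra|]. intros q Hq.
  assert (E : f (koebe q) - one_plus_power a q = 0).
  { rewrite (is_C_derive_zero_const _ rho Dz q Hq).
    rewrite koebe_0, f_0, one_plus_power_0. ring. }
  replace (one_plus_power a q) with (f (koebe q) - (f (koebe q) - one_plus_power a q)) by ring.
  rewrite E. replace (f (koebe q) - 0) with (f (koebe q)) by ring.
  exact (proj1 (D1 _ (proj1 (proj2 (Kb q Hq))))).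
Qed.

(** The left half plane is reached from [quadratic_form_right_half_plane] by finitely many
    shifts by 2, all of them through admissible parameters. *)
Lemma quadratic_transformation (a : C) : hyp2F1_defined (a + 1) -> quadratic_form a.
Proof.
  assert (M : forall m a, (0 <= Re a + 2 * INR m)%R -> hyp2F1_defined (a + 1) -> quadratic_form a).
  { induction m as [|m IH]; intros b Hb HC.
    - apply quadratic_form_right_half_plane. simpl in Hb. lra.
    - apply quadratic_form_shift; [exact HC|]. apply IH.
      + rewrite S_INR in Hb. rewrite re_plus, re_RtoC. lra.
      + intros j E. apply (HC (S (S j))). rewrite !NtoC_S.
        replace (b + 1) with (b + 2 + 1 - 2) by ring. rewrite E. ring. }
  intros HC. destruct (nfloor_ex (Rabs (Re a))) as [N [_ HN]]; [apply Rabs_pos|].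
  apply (M (S N)); [|exact HC]. rewrite S_INR.
  pose proof (Rle_abs (- Re a)). rewrite Rabs_Ropp in *. pose proof (pos_INR N). lra.
Qed.

Lemma Cpow_2_pred (n : nat) : (0 < n)%nat -> RtoC 2 ^ n = 2 * 2 ^ (n - 1).
Proof. intros H. destruct n as [|m]; [lia|]. replace (S m - 1)%nat with m by lia. apply Cpow_S. Qed.

Lemma theta1_at_square (n : nat) (s q : C) : (0 < n)%nat ->
  1 + q <> 0 -> 1 + s = 2 / (1 + q) ->
  theta1 n (s ^ 2) / 2 ^ (n - 1) = (1 + q ^ n) / (1 + q) ^ n.
Proof.
  intros Hn N E.
  pose proof (theta_plus n s Hn) as P. pose proof (theta_minus n s Hn) as M.
  assert (E' : 1 - s = 2 * q / (1 + q)).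
  { transitivity (2 - (1 + s)); [ring|]. rewrite E. field. exact N. }
  assert (Nn : (1 + q) ^ n <> 0) by (apply Cpow_nz, N).
  assert (N2 : RtoC 2 ^ (n - 1) <> 0) by (apply Cpow_nz, RtoC_neq; lra).
  assert (D : forall z, (z / (1 + q)) ^ n = z ^ n / (1 + q) ^ n).
  { intros z. unfold Cdiv. now rewrite Cpow_mult_l, Cpow_inv by exact N. }
  rewrite E, D, Cpow_2_pred in P by exact Hn.
  rewrite E', D, Cpow_mult_l, Cpow_2_pred in M by exact Hn.
  transitivity (((theta1 n (s ^ 2) + s * theta2 n (s ^ 2)) + (theta1 n (s ^ 2) - s * theta2 n (s ^ 2)))
    / (2 * 2 ^ (n - 1))); [field; exact N2|].
  rewrite P, M. field. auto.
Qed.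

Lemma one_plus_pow_at_0 (m : nat) : (0 < m)%nat ->
  C_continuous (fun q => 1 + q ^ m) 0 /\ 1 + 0 ^ m = 1.
Proof.
  intros Hm. split.
  - apply C_continuous_plus; [apply C_continuous_const|].
    exact (is_C_derive_continuous _ _ _ (is_C_derive_pow (fun q => q) m 0 1 (is_C_derive_id 0))).
  - destruct m as [|k]; [lia|]. rewrite Cpow_S. ring.
Qed.

(** Put [x = s ^ 2] with [s] near 1 and [q = (1 - s) / (1 + s)]. Then [1 - x] and [1 - phi n x]
    are [koebe q] and [koebe (q ^ n)], and [theta1 n x / 2 ^ (n - 1)] is
    [(1 + q ^ n) / (1 + q) ^ n]. *)
Lemma identity_at_1 (n : nat) (a : C) : (0 < n)%nat ->
  hyp2F1_defined (NtoC n * a + 1) -> hyp2F1_defined (a + 1) ->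
   exists (r : R) (p : C -> C),
     (0 < r)%R /\
     power_branch_at 1 r (fun x => theta1 n x / 2 ^ (n - 1)) (- a) p /\
     forall x : C, disk 1 r x ->
       exists F G : C,
         is_hyp2F1 (NtoC n * a / 2) ((NtoC n * a + 1) / 2) (NtoC n * a + 1)
           (1 - x) F /\
         is_hyp2F1 (a / 2) ((a + 1) / 2) (a + 1)
           ((1 - x) ^ n / theta1 n x ^ 2) G /\
         F = p x * G.
Proof.
  intros Hn H1 H2.
  destruct (quadratic_transformation _ H1) as [rho1 [P1 Q1]].
  destruct (quadratic_transformation _ H2) as [rho2 [P2 Q2]].
  assert (N2 : RtoC 2 ^ (n - 1) <> 0) by (apply Cpow_nz, RtoC_neq; lra).
  set (f := fun x => theta1 n x / 2 ^ (n - 1)).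
  destruct (power_branch_near_1 f 1) as [r1 [R1 B]].
  { intros x. apply C_continuous_mult; [apply C_continuous_theta1|apply C_continuous_const]. }
  { unfold f. rewrite (proj1 (theta_at_1 n Hn)). field. exact N2. }
  destruct (one_plus_pow_at_0 n Hn) as [Cn En].
  destruct (Clog_small_near_0 _ 1 Cn En ltac:(lra)) as [d1 [Pd1 D1]].
  destruct (one_plus_pow_at_0 1 ltac:(lia)) as [C1 E1].
  destruct (Clog_small_near_0 _ (INR n) C1 E1 (pos_INR n)) as [d2 [Pd2 D2]].
  set (rho := Rmin (Rmin rho1 rho2) (Rmin d1 d2)).
  assert (Hrho : (0 < rho)%R) by (repeat apply Rmin_glb_lt; lra).
  set (sq := fun x => Cexp (/ 2 * Clog x)).
  assert (sq1 : sq 1 = 1) by (unfold sq; rewrite Clog_1, Cmult_0_r; apply Cexp_0).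
  assert (Csq : C_continuous sq 1).
  { unfold sq. apply (C_continuous_comp Cexp (fun x => / 2 * Clog x)); [|apply C_continuous_Cexp].
    apply C_continuous_mult; [apply C_continuous_const|]. apply C_continuous_Clog. simpl. lra. }
  assert (Cq : C_continuous (fun x => (1 + - (1) * sq x) * / (1 + sq x)) 1).
  { apply C_continuous_mult; [|apply (C_continuous_inv (fun x => 1 + sq x))].
    - apply C_continuous_plus; [apply C_continuous_const|].
      apply C_continuous_mult; [apply C_continuous_const|exact Csq].
    - apply C_continuous_plus; [apply C_continuous_const|exact Csq].
    - rewrite sq1, <- RtoC_plus. apply RtoC_neq. lra. }
  destruct (proj1 (C_continuous_eps _ _) Cq rho Hrho) as [r2 [R2 Dq]].
  destruct (proj1 (C_continuous_eps _ _) Csq 1%R ltac:(lra)) as [r3 [R3 Ds]].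
  set (r := Rmin (Rmin r1 1) (Rmin r2 r3)).
  assert (Hr : (0 < r)%R) by (repeat apply Rmin_glb_lt; lra).
  destruct (B r) as [_ Bp]; [eapply Rle_trans; apply Rmin_l|].
  exists r, (fun x => Cexp (- a * Clog (f x))).
  split; [exact Hr|]. split; [apply Bp|].
  intros x Hx. unfold disk in Hx.
  assert (X1 : (Cmod (x - 1) < 1)%R).
  { eapply Rlt_le_trans; [exact Hx|]. eapply Rle_trans; [apply Rmin_l|apply Rmin_r]. }
  assert (X2 : (Cmod (x - 1) < r2)%R).
  { eapply Rlt_le_trans; [exact Hx|]. eapply Rle_trans; [apply Rmin_r|apply Rmin_l]. }
  assert (X3 : (Cmod (x - 1) < r3)%R).
  { eapply Rlt_le_trans; [exact Hx|]. eapply Rle_trans; [apply Rmin_r|apply Rmin_r]. }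
  specialize (Dq x X2). specialize (Ds x X3). cbv beta in Dq. rewrite sq1 in Dq, Ds.
  set (s := sq x) in *.
  assert (Es : x = s ^ 2).
  { unfold s, sq. replace (Cexp (/ 2 * Clog x) ^ 2)
      with (Cexp (/ 2 * Clog x) * Cexp (/ 2 * Clog x)) by ring.
    rewrite <- Cexp_plus. replace (/ 2 * Clog x + / 2 * Clog x) with (Clog x) by field.
    symmetry. apply Cexp_Clog, Re_pos_near_1, X1. }
  assert (Ns : 1 + s <> 0).
  { pose proof (Re_pos_near_1 s Ds) as Rs. intros Z. apply (f_equal Re) in Z.
    rewrite re_plus, !re_RtoC in Z. lra. }
  set (q := (1 - s) / (1 + s)).
  replace ((1 + - (1) * s) * / (1 + s) - (1 + - (1) * 1) * / (1 + 1)) with q in Dq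
    by (unfold q; field; exact Ns).
  assert (Lq : forall e, (rho <= e)%R -> (Cmod q < e)%R) by (intros; lra).
  assert (L1 : (Cmod q < rho1)%R) by (apply Lq; eapply Rle_trans; [apply Rmin_l|apply Rmin_l]).
  assert (L2 : (Cmod q < rho2)%R) by (apply Lq; eapply Rle_trans; [apply Rmin_l|apply Rmin_r]).
  assert (L3 : (Cmod q < d1)%R) by (apply Lq; eapply Rle_trans; [apply Rmin_r|apply Rmin_l]).
  assert (L4 : (Cmod q < d2)%R) by (apply Lq; eapply Rle_trans; [apply Rmin_r|apply Rmin_r]).
  assert (Nq : 1 + q <> 0) by (apply one_plus_neq_0; lra).
  assert (E2 : 1 + s = 2 / (1 + q)).
  { unfold q. field. split; [exact Ns|].
    replace (1 + s + (1 - s)) with (RtoC 2) by ring. apply RtoC_neq. lra. }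
  assert (Lqn : (Cmod (q ^ n) < rho2)%R).
  { rewrite Cmod_pow. destruct n as [|m]; [lia|]. simpl.
    pose proof (Cmod_ge_0 q) as Z. 
    assert (Cmod q ^ m <= 1)%R.
    { rewrite <- (pow1 m). apply pow_incr. lra. }
    assert (0 <= Cmod q ^ m)%R by (apply pow_le, Z). nra. }
  pose proof (theta1_at_square n s q Hn Nq E2) as ET. rewrite <- Es in ET.
  destruct (D1 q L3) as [Rn Ln]. destruct (D2 q L4) as [Ro Lo].
  rewrite Cpow_1_r in Ro, Lo.
  assert (Nqn : 1 + q ^ n <> 0) by (apply Re_pos_neq_0, Rn).
  assert (Npw : (1 + q) ^ n <> 0) by (apply Cpow_nz, Nq).
  assert (Ex : 1 - x = koebe q).
  { rewrite Es. transitivity ((1 + s) * (2 - (1 + s))); [ring|]. rewrite E2. unfold koebe. field. exact Nq. }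
  assert (ET' : theta1 n x = 2 ^ (n - 1) * ((1 + q ^ n) / (1 + q) ^ n)).
  { rewrite <- ET. field. exact N2. }
  assert (Ez : (1 - x) ^ n / theta1 n x ^ 2 = koebe (q ^ n)).
  { rewrite Ex, ET'. unfold koebe. unfold Cdiv at 2. rewrite Cpow_mult_l, Cpow_inv by (apply Cpow_nz, Nq).
    rewrite <- Cpow_mult_r, Nat.mul_comm, Cpow_mult_r, Cpow_mult_l.
    replace (RtoC 4) with (RtoC 2 * 2) by ring.
    rewrite Cpow_mult_l, Cpow_2_pred by exact Hn. field. auto. }
  eexists _, _. split; [rewrite Ex; apply Q1, L1|]. split; [rewrite Ez; apply Q2, Lqn|].
  unfold one_plus_power, f. rewrite ET.
  rewrite Clog_div_pow; [|exact Ro|exact Rn|lra|exact Lo].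
  rewrite <- Cexp_plus. f_equal. ring.
Qed.

(** * The pull-back transformation *)

Lemma is_C_derive_ext_on (U : C -> Prop) (f g : C -> C) (x l : C) :
  C_open U -> U x -> (forall y, U y -> f y = g y) -> is_C_derive f x l -> is_C_derive g x l.
Proof.
  intros HU Hx E. destruct (C_open_eps U x HU Hx) as [d [P D]].
  apply is_C_derive_ext_loc with (d := d); [exact P|]. intros y Hy. apply E, D, Hy.
Qed.

Lemma is_C_derive_log_on (U : C -> Prop) (L f : C -> C) (x l : C) :
  C_open U -> U x -> C_continuous L x -> (forall y, U y -> Cexp (L y) = f y) ->
  is_C_derive f x l -> is_C_derive L x (l / f x).
Proof.
  intros HU Hx HL E. destruct (C_open_eps U x HU Hx) as [d [P D]].
  apply is_C_derive_log_branch with (d := d); [exact P|exact HL|]. intros y Hy. apply E, D, Hy.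
Qed.

Lemma power_branch_nonzero (U : C -> Prop) (f : C -> C) (c : C) (p : C -> C) (x : C) :
  power_branch_on U f c p -> U x -> f x <> 0.
Proof. intros [L H] Hx. destruct (H x Hx) as (_ & <- & _). apply Cexp_neq_0. Qed.

Lemma is_C_derive_power_branch (U : C -> Prop) (f : C -> C) (c : C) (p : C -> C) (x l : C) :
  C_open U -> U x -> power_branch_on U f c p -> is_C_derive f x l ->
  is_C_derive p x (c * (l / f x) * p x).
Proof.
  intros HU Hx [L H] Hf. destruct (H x Hx) as (HL & _ & Ep). rewrite Ep.
  apply is_C_derive_ext_on with (U := U) (f := fun y => Cexp (c * L y));
    [exact HU|exact Hx|intros y Hy; symmetry; apply H, Hy|].
  assert (DL : is_C_derive L x (l / f x)).
  { apply is_C_derive_log_on with U; try assumption. intros y Hy. apply H, Hy. }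
  eapply is_C_derive_eq.
  - apply is_C_derive_Cexp_comp. apply is_C_derive_mult; [apply is_C_derive_const|exact DL].
  - cbv beta. ring.
Qed.

(** [tanh (n * t)] as a rational function of [s = tanh t]. *)
Definition tanh_mult (n : nat) (s : C) : C :=
  ((1 + s) ^ n - (1 - s) ^ n) / ((1 + s) ^ n + (1 - s) ^ n).

(** This is [d tanh (n t) / d tanh t]. *)
Lemma is_C_derive_tanh_mult (n : nat) (s : C) : (0 < n)%nat ->
  (1 + s) ^ n + (1 - s) ^ n <> 0 -> 1 - s ^ 2 <> 0 ->
  is_C_derive (tanh_mult n) s (NtoC n * (1 - tanh_mult n s ^ 2) / (1 - s ^ 2)).
Proof.
  intros Hn N1 N2. unfold tanh_mult.
  destruct n as [|m]; [lia|].
  eapply is_C_derive_eq; [derive_C; exact N1|]. cbv beta.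
  replace (S m - 1)%nat with m by lia.
  rewrite !Cpow_S in *. set (u := (1 + s) ^ m) in *. set (v := (1 - s) ^ m) in *.
  field. split; [exact N1|intros Z; apply N2; rewrite <- Z; ring].
Qed.

Lemma tanh_mult_sqr (n : nat) (s : C) : (0 < n)%nat -> theta1 n (s ^ 2) <> 0 ->
  (1 + s) ^ n + (1 - s) ^ n <> 0 /\
  tanh_mult n s ^ 2 = s ^ 2 * theta2 n (s ^ 2) ^ 2 / theta1 n (s ^ 2) ^ 2.
Proof.
  intros Hn N. unfold tanh_mult.
  rewrite <- (theta_plus n s Hn), <- (theta_minus n s Hn).
  set (u := theta1 n (s ^ 2)) in *. set (v := theta2 n (s ^ 2)).
  assert (N' : u + s * v + (u - s * v) <> 0).
  { replace (u + s * v + (u - s * v)) with (2 * u) by ring.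
    apply Cmult_neq_0; [apply RtoC_neq; lra|exact N]. }
  split; [exact N'|]. field. split; [exact N|exact N'].
Qed.


(** [T] stands for [sqrt phi = tanh (n t)] and [m] for [dt/dx], where [x = tanh (t) ^ 2]. The
    factors [p] and [q], powers of [phi] and [1 - phi], shift the exponents at 0, 1, infinity to
    [{0, 1/2}], [{- s/2, s/2}], [{0, 1/2}]; the equation with these exponents is
    [d^2 W / dt^2 = (n s)^2 W], whichever of 1/2, 3/2 is the value of [C0]. *)
Lemma hypergeom_to_osc (U : C -> Prop) (n s A0 B0 C0 : C) (T m p q Y Y1 Y2 : C -> C) :
  C0 = 1 / 2 \/ C0 = 3 / 2 -> A0 + B0 = C0 - s -> A0 * B0 = ((C0 - s) ^ 2 - 1 / 4) / 4 ->
  (forall x, U x -> T x <> 0 /\ 1 - T x ^ 2 <> 0 /\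
    is_C_derive T x (n * (1 - T x ^ 2) * m x) /\
    is_C_derive p x ((C0 - 1 / 2) * (n * (1 - T x ^ 2) * m x / T x) * p x) /\
    is_C_derive q x (s * n * T x * m x * q x) /\
    is_C_derive Y x (2 * T x * (n * (1 - T x ^ 2) * m x) * Y1 x) /\
    is_C_derive Y1 x (2 * T x * (n * (1 - T x ^ 2) * m x) * Y2 x) /\
    T x ^ 2 * (1 - T x ^ 2) * Y2 x + (C0 - (A0 + B0 + 1) * T x ^ 2) * Y1 x - A0 * B0 * Y x = 0) ->
  forall x, U x ->
    is_C_derive (fun x => p x * q x * Y x) x
      (m x * (p x * q x * (n * (((C0 - 1 / 2) * ((1 - T x ^ 2) / T x) + s * T x) * Y x
         + 2 * T x * (1 - T x ^ 2) * Y1 x)))) /\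
    is_C_derive (fun x => p x * q x * (n * (((C0 - 1 / 2) * ((1 - T x ^ 2) / T x) + s * T x) * Y x
         + 2 * T x * (1 - T x ^ 2) * Y1 x))) x
      (m x * ((n * s) ^ 2 * (p x * q x * Y x))).
Proof.
  intros HC HS HP H x Hx.
  destruct (H x Hx) as (N1 & N2 & DT & Dp & Dq & DY & DY1 & ODE).
  rewrite HS, HP in ODE. split.
  - eapply is_C_derive_eq; [derive_C|]. cbv beta. field. exact N1.
  - eapply is_C_derive_eq; [derive_C; exact N1|]. cbv beta.
    set (t := T x) in *. set (u := Y x) in *. set (u1 := Y1 x) in *. set (u2 := Y2 x) in *.
    assert (Q : t ^ 2 * (1 - t ^ 2) * u2
      = ((C0 - s) ^ 2 - 1 / 4) / 4 * u - (C0 - (C0 - s + 1) * t ^ 2) * u1).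
    { rewrite <- (Cplus_0_r (((C0 - s) ^ 2 - 1 / 4) / 4 * u - _)), <- ODE. ring. }
    match goal with |- ?lhs = _ =>
      transitivity (lhs - 4 * p x * q x * n ^ 2 * m x * (1 - t ^ 2) * (t ^ 2 * (1 - t ^ 2) * u2)
        + 4 * p x * q x * n ^ 2 * m x * (1 - t ^ 2) * (t ^ 2 * (1 - t ^ 2) * u2)); [ring|] end.
    rewrite Q at 2. destruct HC as [-> | ->]; field; exact N1.
Qed.

(** The converse change of exponents, with [S = sqrt x = tanh t] and powers [r] of [x] and [t] of
    [1 - x]. *)
Lemma osc_to_hypergeom (U : C -> Prop) (k A1 B1 C1 : C) (S r t W W1 : C -> C) :
  C1 = 1 / 2 \/ C1 = 3 / 2 -> A1 + B1 = C1 - k -> A1 * B1 = ((C1 - k) ^ 2 - 1 / 4) / 4 ->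
  (forall x, U x -> S x <> 0 /\ 1 - S x ^ 2 <> 0 /\ x = S x ^ 2 /\
    is_C_derive S x (/ (2 * S x)) /\
    is_C_derive r x (- ((C1 - 1 / 2) / (2 * S x ^ 2)) * r x) /\
    is_C_derive t x (- (k / (2 * (1 - S x ^ 2))) * t x) /\
    is_C_derive W x (/ (2 * S x * (1 - S x ^ 2)) * W1 x) /\
    is_C_derive W1 x (/ (2 * S x * (1 - S x ^ 2)) * (k ^ 2 * W x))) ->
  hypergeom_solution A1 B1 C1 U (fun x => r x * t x * W x).
Proof.
  intros HC HS HP H.
  set (h := fun x => - ((C1 - 1 / 2) / (2 * S x ^ 2)) - k / (2 * (1 - S x ^ 2))).
  set (h1 := fun x => (C1 - 1 / 2) / (2 * S x ^ 4) - k / (2 * (1 - S x ^ 2) ^ 2)).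
  set (m := fun x => / (2 * S x * (1 - S x ^ 2))).
  set (m1 := fun x => - ((1 - 3 * S x ^ 2) / (4 * S x ^ 3 * (1 - S x ^ 2) ^ 2))).
  exists (fun x => r x * t x * (h x * W x + m x * W1 x)).
  exists (fun x => r x * t x * (h x * (h x * W x + m x * W1 x)
    + (h1 x * W x + h x * (m x * W1 x) + m1 x * W1 x + m x * (m x * (k ^ 2 * W x))))).
  intros x Hx. destruct (H x Hx) as (N1 & N2 & Ex & DS & Dr & Dt & DW & DW1).
  assert (Dh : is_C_derive h x (h1 x)).
  { unfold h, h1. eapply is_C_derive_eq.
    - derive_C; apply Cmult_neq_0; first [apply RtoC_neq; lra|apply Cpow_nz; exact N1|exact N2].
    - cbv beta. field. auto. }
  assert (Dm : is_C_derive m x (m1 x)).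
  { unfold m, m1. eapply is_C_derive_eq.
    - apply is_C_derive_inv; [derive_C|].
      apply Cmult_neq_0; [apply Cmult_neq_0; [apply RtoC_neq; lra|exact N1]|exact N2].
    - cbv beta. field. auto. }
  fold (m x) in DW, DW1.
  split; [|split].
  - eapply is_C_derive_eq; [derive_C|]. cbv beta. unfold h. field. auto.
  - eapply is_C_derive_eq.
    + apply is_C_derive_mult; [exact (is_C_derive_mult _ _ _ _ _ Dr Dt)|].
      apply is_C_derive_plus; apply is_C_derive_mult; [exact Dh|exact DW|exact Dm|exact DW1].
    + cbv beta. unfold h. field. auto.
  - rewrite HS, HP. unfold h, h1, m, m1.
    clear - Ex N1 N2 HC.
    revert Ex N1 N2. generalize (S x) (r x) (t x) (W x) (W1 x).
    intros s rx tx w w1 -> N1 N2.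
    destruct HC as [-> | ->]; field; auto.
Qed.

(** The hypergeometric equation involves [A] and [B] only through their sum and product,
    which the exponent differences determine up to the sign of [d]. *)
Lemma exponent_data (A B C0 d : C) :
  exponent_differences A B C0 (1 / 2) d (1 / 2) ->
  (C0 = 1 / 2 \/ C0 = 3 / 2) /\
  exists s : C, (s = d \/ s = - d) /\ A + B = C0 - s /\ A * B = ((C0 - s) ^ 2 - 1 / 4) / 4.
Proof.
  intros (H0 & H1 & H2). split.
  - destruct H0 as [H0|H0]; [left|right];
      (transitivity (1 - (1 - C0)); [ring|]); rewrite H0; field.
  - exists (C0 - A - B). split; [exact H1|]. split; [ring|].
    replace (C0 - (C0 - A - B)) with (A + B) by ring.
    transitivity (((A + B) ^ 2 - (A - B) ^ 2) / 4); [field|].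
    f_equal. f_equal. f_equal. destruct H2 as [-> | ->]; field.
Qed.

Lemma nonzero_ratfun_of_poly (p : C -> C) :
  is_poly p -> (exists x, p x <> 0) -> nonzero_ratfun p.
Proof.
  intros Hp Nz. exists p, (fun _ => RtoC 1). split; [exact Hp|]. split.
  - exists (fun _ => RtoC 1), 0%nat. intros x. unfold polyval. fold_Csum. rewrite Csum_O. simpl. ring.
  - split; [exact Nz|]. split; [exists 0; apply C1_nz|]. intros x _. field.
Qed.

(** The factor is a product of powers of [x], [1 - x], [phi] and [1 - phi]; their logarithms
    being branches on [U], none of the four vanishes there. The branch of [log x] also supplies
    [S = sqrt x] on the whole of [U], and then [T = tanh_mult n S] is a square root of [phi]. *)
Lemma phi_pullback (n : nat) (a : C) : (0 < n)%nat ->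
  forall A0 B0 C0 A1 B1 C1 : C,
     exponent_differences A0 B0 C0 (1 / 2) a (1 / 2) ->
     exponent_differences A1 B1 C1 (1 / 2) (NtoC n * a) (1 / 2) ->
     pullback_transformation A0 B0 C0 A1 B1 C1
       (fun x => x * theta2 n x ^ 2) (fun x => theta1 n x ^ 2) n.
Proof.
  intros Hn A0 B0 C0 A1 B1 C1 E0 E1.
  destruct (exponent_data _ _ _ _ E0) as (HC0 & s0 & Hs0 & S0 & P0).
  destruct (exponent_data _ _ _ _ E1) as (HC1 & s1 & Hs1 & S1 & P1).
  assert (Hs : s1 ^ 2 = (NtoC n * s0) ^ 2).
  { destruct Hs0 as [-> | ->], Hs1 as [-> | ->]; ring. }
  split; [exact (phi_degree n Hn)|].
  set (f := fun x => x * theta2 n x ^ 2 / theta1 n x ^ 2).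
  pose proof (theta_at_0 n Hn) as [T01 T02]. pose proof (theta_at_1 n Hn) as [T11 T12].
  assert (N2 : RtoC 2 ^ (n - 1) <> 0) by (apply Cpow_nz, RtoC_neq; lra).
  pose proof (poly_top_is_poly _ _ _ (poly_top_num n)) as Pn.
  pose proof (poly_top_is_poly _ _ _ (poly_top_den n)) as Pd.
  assert (X : poly_top (fun x : C => x) 1 (RtoC 1)).
  { apply poly_top_ext with (p := fun x : C => x * RtoC 1) (l := RtoC 1); [intros; ring|reflexivity|].
    apply poly_top_mult_X. exists (fun _ => RtoC 1). split; [reflexivity|].
    intros x. unfold polyval. fold_Csum. rewrite Csum_O. simpl. ring. }
  assert (X1 : poly_top (fun x : C => 1 - x) 1 (- RtoC 1)).
  { apply poly_top_ext with (p := fun x : C => RtoC 1 + - RtoC 1 * x) (l := RtoC 0 + - RtoC 1 * RtoC 1); [intros; ring|ring|].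
    apply poly_top_plus; [|apply poly_top_scal, X].
    apply (poly_top_pad_S (fun _ => RtoC 1) 0 (RtoC 1)). exists (fun _ => RtoC 1). split; [reflexivity|].
    intros x. unfold polyval. fold_Csum. rewrite Csum_O. simpl. ring. }
  assert (XP : forall k, is_poly (fun x => (1 - x) ^ k)).
  { intros k. apply (poly_top_is_poly _ k ((- (1)) ^ k)). induction k as [|k IH].
    - exists (fun _ => RtoC 1). split; [reflexivity|].
      intros x. unfold polyval. fold_Csum. rewrite Csum_O. simpl. ring.
    - exact (poly_top_mult (fun x => 1 - x) (fun x => (1 - x) ^ k) 1 k _ _ X1 IH). }
  exists [ (fun x => x, - ((C1 - 1 / 2) / 2)); (fun x => 1 - x, s1 / 2);
           (f, (C0 - 1 / 2) / 2); (fun x => 1 - f x, - (s0 / 2)) ].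
  split.
  { repeat apply List.Forall_cons; [| | | |apply List.Forall_nil]; simpl fst.
    - apply nonzero_ratfun_of_poly; [exact (poly_top_is_poly _ _ _ X)|exists 1; apply C1_nz].
    - apply nonzero_ratfun_of_poly; [exact (poly_top_is_poly _ _ _ X1)|].
      exists 0. replace (1 - 0) with (RtoC 1) by ring. apply C1_nz.
    - exists (fun x => x * theta2 n x ^ 2), (fun x => theta1 n x ^ 2).
      split; [exact Pn|]. split; [exact Pd|]. split; [|split; [|reflexivity]].
      + exists 1. rewrite T12, Cmult_1_l. apply Cpow_nz, N2.
      + exists 1. rewrite T11. apply Cpow_nz, N2.
    - exists (fun x => (1 - x) ^ n), (fun x => theta1 n x ^ 2).
      split; [apply XP|]. split; [exact Pd|]. split; [|split].
      + exists 0. replace (1 - 0) with (RtoC 1) by ring. apply Cpow_nz, C1_nz.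
      + exists 1. rewrite T11. apply Cpow_nz, N2.
      + intros x Nx. rewrite (theta_norm n x Hn). unfold f. field.
        intros Z. apply Nx. rewrite Z. ring. }
  intros U D theta y HU HD HUD Htheta [y1 [y2 Hy]].
  destruct Htheta as (p1 & th1 & B1' & (p2 & th2 & B2' & (p3 & th3 & B3' & (p4 & th4 & B4' & E4 & E3) & E2) & E1') & E0').
  pose proof B1' as [L1 HL1].
  set (S := fun x => Cexp (/ 2 * L1 x)).
  assert (ES : forall x, U x -> x = S x ^ 2).
  { intros x Hx. destruct (HL1 x Hx) as (_ & E & _). rewrite <- E at 1. unfold S.
    replace (Cexp (/ 2 * L1 x) ^ 2) with (Cexp (/ 2 * L1 x) * Cexp (/ 2 * L1 x)) by ring.
    rewrite <- Cexp_plus. f_equal. field. }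
  assert (NS : forall x, S x <> 0) by (intros x; apply Cexp_neq_0).
  set (T := fun x => tanh_mult n (S x)).
  assert (ET : forall x, U x -> (1 + S x) ^ n + (1 - S x) ^ n <> 0 /\ f x = T x ^ 2).
  { intros x Hx. destruct (HUD x Hx) as [Nd _].
    assert (Nt : theta1 n (S x ^ 2) <> 0).
    { rewrite <- ES by exact Hx. intros Z. apply Nd. rewrite Z. ring. }
    destruct (tanh_mult_sqr n (S x) Hn Nt) as [A B]. split; [exact A|].
    unfold T, f. rewrite B, <- ES by exact Hx. reflexivity. }
  set (m := fun x => / (2 * S x * (1 - S x ^ 2))).
  assert (base : forall x, U x -> 1 - S x ^ 2 <> 0 /\ T x <> 0 /\ 1 - T x ^ 2 <> 0 /\
    is_C_derive S x (/ (2 * S x)) /\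
    is_C_derive T x (NtoC n * (1 - T x ^ 2) * m x)).
  { intros x Hx. destruct (ET x Hx) as [Nd Ef].
    assert (M1 : 1 - S x ^ 2 <> 0).
    { rewrite <- ES by exact Hx. exact (power_branch_nonzero _ _ _ _ x B2' Hx). }
    assert (M2 : T x <> 0).
    { intros Z. apply (power_branch_nonzero _ _ _ _ x B3' Hx). rewrite Ef, Z. ring. }
    assert (M3 : 1 - T x ^ 2 <> 0).
    { rewrite <- Ef. exact (power_branch_nonzero _ _ _ _ x B4' Hx). }
    assert (DS : is_C_derive S x (/ (2 * S x))).
    { assert (DL : is_C_derive L1 x (1 / x)).
      { apply (is_C_derive_log_on U L1 (fun x => x)); [exact HU|exact Hx|apply HL1, Hx| |derive_C].
        intros z Hz. apply HL1, Hz. }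
      unfold S. eapply is_C_derive_eq.
      - apply is_C_derive_Cexp_comp. apply is_C_derive_mult; [apply is_C_derive_const|exact DL].
      - cbv beta. fold (S x).
        replace (1 / x) with (1 / S x ^ 2) by (rewrite <- (ES x Hx); reflexivity).
        field. apply NS. }
    repeat (split; [assumption|]).
    pose proof (is_C_derive_comp (tanh_mult n) S x _ _ DS (is_C_derive_tanh_mult n (S x) Hn Nd M1)) as DT.
    eapply is_C_derive_eq; [exact DT|]. unfold m, T. field. auto. }
  assert (Df : forall x, U x -> is_C_derive f x (2 * T x * (NtoC n * (1 - T x ^ 2) * m x))).
  { intros x Hx. destruct (base x Hx) as (_ & _ & _ & _ & DT).
    apply is_C_derive_ext_on with (U := U) (f := fun x => T x ^ 2); [exact HU|exact Hx| |].
    - intros z Hz. symmetry. apply ET, Hz.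
    - exact (is_C_derive_sqr _ _ _ DT). }
  pose proof (hypergeom_to_osc U (NtoC n) s0 A0 B0 C0 T m p3 p4
    (fun x => y (f x)) (fun x => y1 (f x)) (fun x => y2 (f x)) HC0 S0 P0) as HW.
  assert (HW' := HW ltac:(
    intros x Hx; destruct (base x Hx) as (M1 & M2 & M3 & DS & DT);
    destruct (ET x Hx) as [Nd Ef]; destruct (HUD x Hx) as [_ HDx];
    destruct (Hy (f x) HDx) as (Dy & Dy1 & ODE);
    pose proof (is_C_derive_comp y f x _ _ (Df x Hx) Dy) as C1';
    pose proof (is_C_derive_comp y1 f x _ _ (Df x Hx) Dy1) as C2';
    pose proof (is_C_derive_power_branch U f _ p3 x _ HU Hx B3' (Df x Hx)) as D3;
    assert (Df' : is_C_derive (fun x => 1 - f x) x (0 - 2 * T x * (NtoC n * (1 - T x ^ 2) * m x)))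
      by (apply is_C_derive_minus; [apply is_C_derive_const|exact (Df x Hx)]);
    pose proof (is_C_derive_power_branch U _ _ p4 x _ HU Hx B4' Df') as D4;
    rewrite Ef in D3, ODE; cbv beta in D4; rewrite Ef in D4;
    refine (conj M2 (conj M3 (conj DT (conj _ (conj _ (conj _ (conj _ _)))))));
    [ eapply is_C_derive_eq; [exact D3|]; field; exact M2
    | eapply is_C_derive_eq; [exact D4|]; field; exact M3
    | eapply is_C_derive_eq; [exact C1'|]; ring
    | eapply is_C_derive_eq; [exact C2'|]; ring
    | cbv beta; rewrite Ef; exact ODE ])).
  clear HW.
  set (W := fun x => p3 x * p4 x * y (f x)) in *.
  set (W1 := fun x => p3 x * p4 x * (NtoC n * (((C0 - 1 / 2) * ((1 - T x ^ 2) / T x) + s0 * T x) * y (f x)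
         + 2 * T x * (1 - T x ^ 2) * y1 (f x)))) in *.
  assert (HY : hypergeom_solution A1 B1 C1 U (fun x => p1 x * p2 x * W x)).
  { apply (osc_to_hypergeom U s1 A1 B1 C1 S p1 p2 W W1 HC1 S1 P1).
    intros x Hx. destruct (base x Hx) as (M1 & M2 & M3 & DS & DT).
    destruct (HW' x Hx) as [DW DW1].
    pose proof (is_C_derive_power_branch U _ _ p1 x _ HU Hx B1' (is_C_derive_id x)) as D1.
    assert (Dm : is_C_derive (fun x => 1 - x) x (0 - 1))
      by (apply is_C_derive_minus; [apply is_C_derive_const|apply is_C_derive_id]).
    pose proof (is_C_derive_power_branch U _ _ p2 x _ HU Hx B2' Dm) as D2.
    cbv beta in D2.
    refine (conj (NS x) (conj M1 (conj (ES x Hx) (conj DS (conj _ (conj _ (conj DW _))))))).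
    - eapply is_C_derive_eq; [exact D1|]. rewrite <- (ES x Hx). field.
      exact (power_branch_nonzero _ _ _ _ x B1' Hx).
    - eapply is_C_derive_eq; [exact D2|]. rewrite <- (ES x Hx) in *. field. exact M1.
    - eapply is_C_derive_eq; [exact DW1|]. rewrite Hs. reflexivity. }
  destruct HY as [z1 [z2 HY]]. exists z1, z2. intros x Hx.
  destruct (HY x Hx) as (DY & DY1 & ODE).
  assert (Eq : forall x, U x -> p1 x * p2 x * W x = theta x * y (x * theta2 n x ^ 2 / theta1 n x ^ 2)).
  { intros z Hz. rewrite (E0' z Hz), (E1' z Hz), (E2 z Hz), (E3 z Hz), (E4 z Hz).
    unfold W, f. ring. }
  split; [|split].
  - apply is_C_derive_ext_on with (U := U) (f := fun x => p1 x * p2 x * W x); assumption.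
  - exact DY1.
  - rewrite <- Eq by exact Hx. exact ODE.
Qed.

(** * The theorem *)

Theorem theorem4p1 (n : nat) (hn : (0 < n)%nat) (a : C) :
  (* pull-back E(1/2,1/2,a) <- E(1/2,1/2,na), differences listed at 0, 1, oo *)
  (forall A0 B0 C0 A1 B1 C1 : C,
     exponent_differences A0 B0 C0 (1 / 2) a (1 / 2) ->
     exponent_differences A1 B1 C1 (1 / 2) (NtoC n * a) (1 / 2) ->
     pullback_transformation A0 B0 C0 A1 B1 C1
       (fun x => x * theta2 n x ^ 2) (fun x => theta1 n x ^ 2) n) /\
  (forall x : C, (1 - x) ^ n = theta1 n (x ^ 2) - x * theta2 n (x ^ 2)) /\
  (forall x : C, (1 - x) ^ n = theta1 n x ^ 2 - x * theta2 n x ^ 2) /\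
  (exists (r : R) (p : C -> C),
     (0 < r)%R /\ power_branch_at 0 r (theta1 n) (- a) p /\
     forall x : C, disk 0 r x ->
       exists F G : C,
         is_hyp2F1 (NtoC n * a / 2) ((NtoC n * a + 1) / 2) (1 / 2) x F /\
         is_hyp2F1 (a / 2) ((a + 1) / 2) (1 / 2) (phi n x) G /\
         F = p x * G) /\
  (exists (r : R) (p : C -> C),
     (0 < r)%R /\ power_branch_at 0 r (theta1 n) (- a - 1) p /\
     forall x : C, disk 0 r x ->
       exists F G : C,
         is_hyp2F1 ((NtoC n * a + 1) / 2) (NtoC n * a / 2 + 1) (3 / 2) x F /\
         is_hyp2F1 ((a + 1) / 2) (a / 2 + 1) (3 / 2) (phi n x) G /\
         F = p x * (theta2 n x / NtoC n) * G) /\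
  (exists r : R,
     (0 < r)%R /\
     forall x : C, disk 0 r x ->
       x <> 1 /\
       exists F : C,
         is_hyp2F1 (NtoC n * a / 2) (- (NtoC n * a / 2)) (1 / 2)
           (x / (x - 1)) F /\
         is_hyp2F1 (a / 2) (- (a / 2)) (1 / 2)
           (- (x * theta2 n x ^ 2 / (1 - x) ^ n)) F) /\
  (hyp2F1_defined (NtoC n * a + 1) -> hyp2F1_defined (a + 1) ->
   exists (r : R) (p : C -> C),
     (0 < r)%R /\
     power_branch_at 1 r (fun x => theta1 n x / 2 ^ (n - 1)) (- a) p /\
     forall x : C, disk 1 r x ->
       exists F G : C,
         is_hyp2F1 (NtoC n * a / 2) ((NtoC n * a + 1) / 2) (NtoC n * a + 1)
           (1 - x) F /\
         is_hyp2F1 (a / 2) ((a + 1) / 2) (a + 1)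
           ((1 - x) ^ n / theta1 n x ^ 2) G /\
         F = p x * G).
Proof.
  split; [exact (phi_pullback n a hn)|].
  split.
  { intros x. symmetry. exact (theta_minus n x hn). }
  split; [intros x; exact (theta_norm n x hn)|].
  split; [exact (even_identity n a hn)|].
  split; [exact (odd_identity n a hn)|].
  split; [exact (sinh_identity n a hn)|].
  exact (identity_at_1 n a hn).
Qed.
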